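(* Let $\mathcal O=\mathsf{Comm}$. Then $I\mathsf{Comm}_V\cong V$ with trivial (zero) multiplication and trivial involution, and for every $k\ge0$ $$H_{k+1,1}(\mathcal H\mathsf{Comm}_V)=HD_k(I\mathsf{Comm}_V)=V^{\otimes(k+1)}/(1-t,1-y),$$ where in the last term $t\cdot(v_0\otimes\cdots\otimes v_k)=(-1)^k v_1\otimes\cdots\otimes v_k\otimes v_0$ and $y\cdot(v_0\otimes\cdots\otimes v_k)=(-1)^{k+1+\binom{k+1}{2}}v_k\otimes\cdots\otimes v_0$.
   Context: $F$ is a field of characteristic $0$ and $V$ a finite-dimensional symplectic $F$-vector space. $\mathsf{Comm}$ is the cyclic commutative operad: $\mathsf{Comm}((s))=F$ with trivial $\mathfrak S_s$-action for all $s\ge2$, all compositions being the identity of $F$. Equality signs in the claim denote isomorphisms. Hairy graph complex. An admissible graph is a finite graph with no bivalent vertices; univalent vertices are leaves, the edge at a leaf is a hair, other vertices and edges are internal. An orientation is an ordering of internal vertices and a direction of each internal edge; transposing two vertices or reversing an edge changes the sign. $C_k\mathcal H\mathsf{Comm}_V$ is spanned by oriented admissible graphs with $k$ internal vertices (each colored by the generator of $\mathsf{Comm}$, which adds no structure) and leaves labeled by vectors in $V$, modulo isomorphism, multilinearity in labels, and $(X,-or)=-(X,or)$. The boundary sums over contractions of non-loop internal edges, with signs determined by the orientation (if the orientation is represented so that the edge goes from the first vertex to the second, the merged vertex is put first with sign $+$). $H_{k,1}$ denotes the $k$-th homology of the subcomplex spanned by connected graphs of rank one, i.e. with infinite cyclic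 fundamental group. $\mathsf B_\bullet\mathsf{Comm}_V((2))$ is the chain complex spanned by oriented trees with a distinguished internal vertex, all internal vertices of valence at least $3$, two leaves labeled $0$ and $1$ attached to the distinguished vertex, and all other leaves labeled by vectors in $V$; $k$-chains have $k+1$ internal vertices and the boundary contracts internal edges. The product joins leaf $0$ of one tree to leaf $1$ of another, merging the distinguished vertices into one; this makes $I\mathsf{Comm}_V=H_0(\mathsf B_\bullet\mathsf{Comm}_V((2)))$ a non-unital associative algebra, with an involution induced by exchanging the labels $0$ and $1$. Dihedral homology. For a (possibly non-unital) associative $F$-algebra $A$ with involution $a\mapsto\bar a$, let $C_k(A)=A^{\otimes(k+1)}$ with Hochschild boundary $b=\sum_{i=0}^{k}(-1)^id_i$, where $d_i(a_0\otimes\cdots\otimes a_k)=a_0\otimes\cdots\otimes a_ia_{i+1}\otimes\cdots\otimes a_k$ for $0\le i<k$ and $d_k(a_0\otimes\cdots\otimes a_k)=a_ka_0\otimes a_1\otimes\cdots\otimes a_{k-1}$. Let $\tau_k(a_0,\dots,a_k)=(a_k,a_0,\dots,a_{k-1})$ and $\omega_k(a_0,\dots,a_k)=(\bar a_0,\bar a_k,\dots,\bar a_1)$. The dihedral homology $HD_*(A)$ is the homology of the quotient of $C(A)$ by the images of $1-(-1)^k\tau_k$ and $1-(-1)^{k(k+1)/2}\omega_k$ for all $k$, with boundary induced by $b$ (Loday's definition in characteristic $0$).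
   Formalization: HD_k is replaced by skew-dihedral homology, i.e. the relation 1-(-1)^{k(k+1)/2}ω_k becomes 1+(-1)^{k(k+1)/2}ω_k; with the printed sign the claim fails, e.g. at k=0, where HD_0=V but V/(1-t,1-y)=0. *)

(* Defs.v *)
From HB Require Import structures.
From mathcomp.multinomials Require Import freeg.
From mathcomp Require Import all_boot all_algebra perm.
From mathcomp Require Import boolp.

Set Implicit Arguments.
Unset Strict Implicit.
Unset Printing Implicit Defensive.

Import GRing.Theory.
Local Open Scope ring_scope.
Local Open Scope quotient_scope.

(** * Subspaces, quotients and complexes given by generators and relations *)

Definition subspace_closed (F : fieldType) (M : lmodType F) (P : M -> Prop) :=
  P 0 /\ forall a x y, P x -> P y -> P (a *: x + y).

Record subspace (F : fieldType) (M : lmodType F) := Subspace {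
  in_subspace :> M -> Prop;
  subspaceP : subspace_closed in_subspace }.

Section Subspaces.
Variables (F : fieldType) (M : lmodType F) (S : subspace M).

Definition subspace_pred : {pred M} := fun x => `[< S x >].

Lemma subspace_pred_closed : submod_closed subspace_pred.
Proof.
case: (subspaceP S) => S0 SD; split; first exact/asboolP.
by move=> a x y /asboolP Sx /asboolP Sy; apply/asboolP/SD.
Qed.

HB.instance Definition _ :=
  GRing.isSubmodClosed.Build F M subspace_pred subspace_pred_closed.

Lemma subspace0 : S 0. Proof. by case: (subspaceP S). Qed.

Lemma subspaceD x y : S x -> S y -> S (x + y).
Proof. by move=> Sx Sy; rewrite -[x]scale1r; apply: (subspaceP S).2. Qed.

Lemma subspaceZ a x : S x -> S (a *: x).
Proof.
by move=> Sx; rewrite -[_ *: _]addr0; apply: (subspaceP S).2 => //; exact: subspace0.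
Qed.

Lemma subspaceN x : S x -> S (- x).
Proof. by rewrite -scaleN1r; exact: subspaceZ. Qed.

Lemma subspaceB x y : S x -> S y -> S (x - y).
Proof. by move=> Sx /subspaceN; exact: subspaceD. Qed.

Definition subspace_type := {x : M | x \in subspace_pred}.
HB.instance Definition _ := SubChoice.on subspace_type.
HB.instance Definition _ := [SubChoice_isSubLmodule of subspace_type by <:].

Lemma subspace_typeP (x : subspace_type) : S (val x).
Proof. exact/asboolP/(valP x). Qed.

Definition to_subspace (x : M) (Sx : S x) : subspace_type :=
  exist _ x (asboolT Sx).

Definition quotient := ring_quotient.Quotient.quot subspace_pred.
HB.instance Definition _ := GRing.Zmodule.on quotient.
HB.instance Definition _ :=
  ZmodQuotient.on quotient.

Definition quotient_scale (a : F) (q : quotient) : quotient :=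
  \pi_quotient (a *: repr q).

Lemma quotient_eq x y : (\pi_quotient x = \pi_quotient y) <-> S (x - y).
Proof.
split=> [/eqP|Sxy]; first by rewrite -Quotient.idealrBE => /asboolP.
by apply/eqP; rewrite -Quotient.idealrBE; apply/asboolP.
Qed.

Lemma pi_quotientD x y :
  \pi_quotient (x + y) = \pi_quotient x + \pi_quotient y.
Proof. exact: pi_addr. Qed.

Lemma pi_quotientZ a x :
  \pi_quotient (a *: x) = quotient_scale a (\pi_quotient x).
Proof.
apply/quotient_eq; rewrite -scalerBr; apply: subspaceZ.
by apply/quotient_eq; rewrite reprK.
Qed.

Lemma quotientW (P : quotient -> Prop) :
  (forall x, P (\pi_quotient x)) -> forall q, P q.
Proof. by move=> h q; rewrite -[q]reprK. Qed.
Lemma quotient_scaleA a b q :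
  quotient_scale a (quotient_scale b q) = quotient_scale (a * b) q.
Proof. by elim/quotientW: q => x; rewrite -!pi_quotientZ scalerA. Qed.
Lemma quotient_scale1 : left_id 1 quotient_scale.
Proof. by elim/quotientW=> x; rewrite -pi_quotientZ scale1r. Qed.
Lemma quotient_scaleDr : right_distributive quotient_scale +%R.
Proof.
move=> a; elim/quotientW=> x; elim/quotientW=> y.
by rewrite -pi_quotientD -!pi_quotientZ -pi_quotientD scalerDr.
Qed.
Lemma quotient_scaleDl q : {morph quotient_scale^~ q : a b / a + b}.
Proof.
by move=> a b; elim/quotientW: q => x; rewrite -!pi_quotientZ -pi_quotientD scalerDl.
Qed.
HB.instance Definition _ := GRing.Zmodule_isLmodule.Build F quotient
  quotient_scaleA quotient_scale1 quotient_scaleDr quotient_scaleDl.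

Definition quotient_class (x : M) : quotient := \pi_quotient x.

Lemma quotient_class_is_linear : linear quotient_class.
Proof. by move=> a x y; rewrite /quotient_class pi_quotientD pi_quotientZ. Qed.
HB.instance Definition _ :=
  GRing.isLinear.Build F M quotient _ quotient_class quotient_class_is_linear.

End Subspaces.

Definition linearly_isomorphic (F : fieldType) (U W : lmodType F) : Prop :=
  exists f : {linear U -> W}, bijective f.

Section Span.
Variables (F : fieldType) (M : lmodType F).

Inductive spanned (G : M -> Prop) : M -> Prop :=
| Spanned0 : spanned G 0
| SpannedD a g x : G g -> spanned G x -> spanned G (a *: g + x).

Lemma spanned_closed G : subspace_closed (spanned G).
Proof.
split=> [|a x y Gx Gy]; first exact: Spanned0.
elim: Gx => [|b g z Gg _ IH]; first by rewrite scaler0 add0r.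
by rewrite scalerDr scalerA -addrA; apply: SpannedD.
Qed.

Definition linspan (G : M -> Prop) : subspace M := Subspace (spanned_closed G).

Lemma span_gen (G : M -> Prop) g : G g -> linspan G g.
Proof.
by move=> Gg; rewrite -[g]addr0 -[g in g + _]scale1r; apply/SpannedD/Spanned0.
Qed.

Lemma span_min (G : M -> Prop) (W : subspace M) :
  (forall g, G g -> W g) -> forall x, linspan G x -> W x.
Proof.
move=> GW x; elim=> [|a g y Gg _ Wy]; first exact: subspace0.
by apply: (subspaceP W).2 => //; apply: GW.
Qed.

End Span.

Definition free_module (F : fieldType) (K : choiceType) : lmodType F :=
  GRing.Lmodule.clone F {freeg K / F} _.

Section FreeModule.
Variables (F : fieldType) (K : choiceType) (M : lmodType F) (f : K -> M).

HB.instance Definition _ := GRing.isZmodMorphism.Build {freeg K / F} M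
  (fglift f) (lift_is_additive f).

Lemma fglift_scalable : scalable (fglift f).
Proof.
move=> c D; rewrite -[D]freeg_sumE scaler_sumr.
rewrite (raddf_sum (fglift f)) (raddf_sum (fglift f)) scaler_sumr.
apply: eq_bigr => z _.
have -> : c *: << coeff z D *g z >> = << c * coeff z D *g z >> :> {freeg K / F}.
  by apply/eqP/freeg_eqP => x; rewrite coeffZ !coeffU mulrA.
by rewrite /= !liftU scalerA.
Qed.

HB.instance Definition _ := GRing.isScalable.Build F {freeg K / F} M *:%R
  (fglift f) fglift_scalable.

Lemma fglift1 k : fglift f << k >> = f k.
Proof. by rewrite liftU scale1r. Qed.

End FreeModule.

(* The chain complex whose [k]-chains are the quotient of the free module on
   [generator k] by the span of [relation k], with boundary induced by
   [boundary k]. *)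
Record presented_complex (F : fieldType) := PresentedComplex {
  generator : nat -> choiceType;
  relation : forall k, free_module F (generator k) -> Prop;
  boundary : forall k, generator k.+1 -> free_module F (generator k) }.

(* Homology of the subcomplex spanned by the classes of the generators in [A],
   computed upstairs in the free modules: cycles are the combinations of
   generators in [A] whose boundary is a relation, and they are taken modulo
   relations and boundaries of combinations of generators in [A]. *)
Section Homology.
Variables (F : fieldType) (C : presented_complex F).
Variable A : forall k, pred (generator C k).

Local Notation free k := (free_module F (generator C k)).

Definition relations k : subspace (free k) := linspan (@relation F C k).

Definition chains k : subspace (free k) :=
  linspan (fun x => exists2 g, A g & x = << g >>).

Definition is_cycle k : free k -> Prop :=
  match k with
  | 0 => chains 0
  | k'.+1 => fun x => chains k'.+1 x /\ relations k' (fglift (@boundary F C k') x)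
  end.

Lemma is_cycle_closed k : subspace_closed (@is_cycle k).
Proof.
case: k => [|k]; first exact: subspaceP.
split=> [|a x y [Ax Rx] [Ay Ry]]; split; [exact: subspace0 | | |].
- by rewrite linear0; apply: subspace0.
- exact: (subspaceP _).2.
- by rewrite linearP; apply: (subspaceP _).2.
Qed.

Definition cycles k : subspace (free k) := Subspace (@is_cycle_closed k).

Definition is_boundary k (x : subspace_type (cycles k)) : Prop :=
  exists2 y, chains k.+1 y & relations k (val x - fglift (@boundary F C k) y).

Lemma is_boundary_closed k : subspace_closed (@is_boundary k).
Proof.
split=> [|a x y [u Au Ru] [v Av Rv]].
  by exists 0; [exact: subspace0 | rewrite !linear0 addr0; exact: subspace0].
exists (a *: u + v); first exact: (subspaceP _).2.
rewrite !linearP addrACA -scalerDr.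
exact: (subspaceP _).2.
Qed.

Definition boundaries k : subspace (subspace_type (cycles k)) :=
  Subspace (@is_boundary_closed k).

Definition homology k : lmodType F := quotient (boundaries k).

Definition homology_class k (x : free k) (Zx : cycles k x) : homology k :=
  quotient_class (boundaries k) (to_subspace Zx).

Lemma homology_classP k (P : homology k -> Prop) :
  (forall x (Zx : cycles k x), P (homology_class Zx)) -> forall h, P h.
Proof.
move=> hP; elim/quotientW=> z.
have -> : z = to_subspace (subspace_typeP z) by apply: val_inj.
exact: hP.
Qed.

Lemma homology_class_eq k (x y : free k) (Zx : cycles k x) (Zy : cycles k y) :
  homology_class Zx = homology_class Zy <->
  exists2 z, chains k.+1 z & relations k (x - y - fglift (@boundary F C k) z).
Proof. exact: quotient_eq. Qed.

End Homology.

(** * Multilinearity *)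

Section Multilinear.
Variables (F : fieldType) (W : lmodType F) (n : nat).

Definition subst_at (a : {ffun 'I_n -> W}) (i : 'I_n) (x : W) :
    {ffun 'I_n -> W} :=
  [ffun j => if j == i then x else a j].

(* The quotient of the free module on n-tuples by the span of these relations
   is the n-th tensor power of W. *)
Inductive multilinear_relation : free_module F {ffun 'I_n -> W} -> Prop :=
| MultilinearRelation a i c x y :
    multilinear_relation
      (<< subst_at a i (c *: x + y) >> - c *: << subst_at a i x >>
         - << subst_at a i y >>).

End Multilinear.

(** * Algebras with involution and dihedral homology *)

(* Associative, not necessarily unital. *)
Record involutive_algebra (F : fieldType) := InvolutiveAlgebra {
  ia_space :> lmodType F;
  ia_mul : ia_space -> ia_space -> ia_space;
  ia_bar : ia_space -> ia_space;
  ia_mul_linearl : forall b, linear (ia_mul^~ b);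
  ia_mul_linearr : forall a, linear (ia_mul a);
  ia_mulA : associative ia_mul;
  ia_bar_linear : linear ia_bar;
  ia_barK : involutive ia_bar;
  ia_barM : forall a b, ia_bar (ia_mul a b) = ia_mul (ia_bar b) (ia_bar a) }.

Definition involutive_algebra_isomorphic (F : fieldType)
    (A B : involutive_algebra F) : Prop :=
  exists f : {linear A -> B},
    [/\ bijective f,
        forall a b, f (ia_mul a b) = ia_mul (f a) (f b)
      & forall a, f (ia_bar a) = ia_bar (f a)].

Section TrivialAlgebra.
Variables (F : fieldType) (W : lmodType F).

Definition trivial_mul (_ _ : W) : W := 0.

Lemma trivial_mul_linearl b : linear (trivial_mul^~ b).
Proof. by move=> c x y; rewrite /trivial_mul /= scaler0 addr0. Qed.

Lemma trivial_mul_linearr a : linear (trivial_mul a).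
Proof. by move=> c x y; rewrite /trivial_mul /= scaler0 addr0. Qed.

Lemma id_linear : linear (@id W). Proof. by []. Qed.

Definition trivial_algebra : involutive_algebra F :=
  @InvolutiveAlgebra F W trivial_mul id trivial_mul_linearl trivial_mul_linearr
    (fun _ _ _ => erefl) id_linear (fun _ => erefl) (fun _ _ => erefl).

End TrivialAlgebra.

Section DihedralHomology.
Variables (F : fieldType) (A : involutive_algebra F).

Local Notation tuples k := {ffun 'I_k.+1 -> A}.

Definition face k (i : nat) (a : tuples k.+1) : tuples k :=
  [ffun j : 'I_k.+1 =>
     if (j < i)%N then a (widen_ord (leqnSn _) j)
     else if (j == i :> nat) then
       ia_mul (a (widen_ord (leqnSn _) j)) (a (lift ord0 j))
     else a (lift ord0 j)].

Definition last_face k (a : tuples k.+1) : tuples k :=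
  [ffun j : 'I_k.+1 =>
     if j == ord0 then ia_mul (a ord_max) (a ord0)
     else a (widen_ord (leqnSn _) j)].

Definition hochschild_boundary k (a : tuples k.+1) : free_module F (tuples k) :=
  \sum_(i < k.+1) (-1) ^+ i *: << face i a >> + (-1) ^+ k.+1 *: << last_face a >>.

Definition tau k (a : tuples k) : tuples k := [ffun j => a (ord_pred j)].

(* [- j] is the opposite of [j] modulo [k.+1], so that
   omega (a_0, a_1, ..., a_k) = (bar a_0, bar a_k, ..., bar a_1). *)
Definition omega k (a : tuples k) : tuples k := [ffun j => ia_bar (a (- j))].

(* [skew = false] gives the sign (-1)^(k(k+1)/2) of Loday's dihedral homology,
   [skew = true] the opposite one, of his skew-dihedral homology. *)
Inductive dihedral_relation (skew : bool) k : free_module F (tuples k) -> Prop :=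
| DihedralMultilinear x :
    multilinear_relation x -> dihedral_relation skew x
| DihedralTau a :
    dihedral_relation skew (<< a >> - (-1) ^+ k *: << tau a >>)
| DihedralOmega a :
    dihedral_relation skew
      (<< a >> - (-1) ^+ (skew + (k * k.+1)./2) *: << omega a >>).

Definition dihedral_complex (skew : bool) : presented_complex F :=
  PresentedComplex (fun k => @dihedral_relation skew k) hochschild_boundary.

Definition dihedral_homology k : lmodType F :=
  @homology F (dihedral_complex false) (fun _ _ => true) k.

(* An orientation of a cycle with k+1 vertices and k+1 edges is changed by a
   reflection by the sign (-1)^('C(k+1, 2) + (k+1)).  Composing with the rotation
   of sign (-1)^k leaves -(-1)^(k(k+1)/2) for omega: graphs of rank one compute
   the skew variant. *)
Definition skew_dihedral_homology k : lmodType F :=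
  @homology F (dihedral_complex true) (fun _ _ => true) k.

End DihedralHomology.

(** * Coinvariants of the tensor powers *)

Section TensorCoinvariants.
Variables (F : fieldType) (W : lmodType F) (k : nat).

Definition rotate (v : {ffun 'I_k.+1 -> W}) : {ffun 'I_k.+1 -> W} :=
  [ffun j => v (ordS j)].

Definition reverse (v : {ffun 'I_k.+1 -> W}) : {ffun 'I_k.+1 -> W} :=
  [ffun j => v (rev_ord j)].

(* On pure tensors, t and y are the two signed permutations below; pure tensors
   span, so these relations present the quotient by 1 - t and 1 - y. *)
Inductive coinvariant_relation : free_module F {ffun 'I_k.+1 -> W} -> Prop :=
| CoinvariantMultilinear x :
    multilinear_relation x -> coinvariant_relation x
| CoinvariantT v :
    coinvariant_relation (<< v >> - (-1) ^+ k *: << rotate v >>)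
| CoinvariantY v :
    coinvariant_relation
      (<< v >> - (-1) ^+ (k.+1 + 'C(k.+1, 2)) *: << reverse v >>).

Definition tensor_coinvariants : lmodType F := quotient (linspan coinvariant_relation).

End TensorCoinvariants.

(** * Oriented graphs *)

(* An oriented graph on n internal vertices is given by its list of directed
   internal edges and its list of leaves; the internal vertices are numbered by
   'I_n in the order prescribed by the orientation, a leaf is recorded by the
   vertex its hair is attached to and its label.  (The interval joining two
   leaves, which has no internal vertex, is not represented: it is connected of
   rank 0.) *)
Definition graph (L : choiceType) (n : nat) : choiceType :=
  (seq ('I_n * 'I_n) * seq ('I_n * L))%type.

Section Graphs.
Variable L : choiceType.

Definition edges n (g : graph L n) : seq ('I_n * 'I_n) := g.1.
Definition leaves n (g : graph L n) : seq ('I_n * L) := g.2.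

Definition map_vertices m n (f : 'I_m -> 'I_n) (g : graph L m) : graph L n :=
  ([seq (f e.1, f e.2) | e <- edges g], [seq (f h.1, h.2) | h <- leaves g]).

Definition valence n (g : graph L n) (i : 'I_n) : nat :=
  (count (fun e => e.1 == i) (edges g) + count (fun e => e.2 == i) (edges g)
     + count (fun h => h.1 == i) (leaves g))%N.

Definition adjacent n (g : graph L n) : rel 'I_n :=
  [rel i j | ((i, j) \in edges g) || ((j, i) \in edges g)].

Definition connected n (g : graph L n) : bool :=
  (0 < n)%N && [forall i, forall j, connect (adjacent g) i j].

(* Internal vertices are neither bivalent nor univalent (univalent vertices are
   leaves), and Comm((0)) is not defined. *)
Definition admissible n (g : graph L n) : bool :=
  [forall i, 2 < valence g i]%N.

(* For connected graphs, the first Betti number 1 - n + #edges is the rank of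
   the fundamental group; leaves and hairs cancel out. *)
Definition has_rank r n (g : graph L n) : bool := ((size (edges g)).+1 == n + r)%N.

(* Contraction of an edge from i to j: the merged vertex comes first, the other
   vertices keep their relative order. *)
Definition contract_vertex n (i j : 'I_n.+2) (v : 'I_n.+2) : 'I_n.+1 :=
  if (v == i) || (v == j) then ord0 else inord (v - (i < v) - (j < v)).+1.

(* Signature of the permutation moving i and j to the first two places and
   preserving the order of the others. *)
Definition contract_sign n (i j : 'I_n.+2) : nat := (i + j + (i < j))%N.

Variable F : fieldType.

Definition graph_boundary n : graph L n.+1 -> free_module F (graph L n) :=
  match n with
  | 0 => fun _ => 0
  | n'.+1 => fun g =>
      \sum_(e <- edges g | e.1 != e.2)
        (-1) ^+ contract_sign e.1 e.2 *:
          << map_vertices (contract_vertex e.1 e.2) (rem e (edges g), leaves g) >>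
  end.

Variables (W : lmodType F) (vec : W -> L).

(* The lists of edges and leaves are only defined up to permutation, renumbering
   the vertices or reversing an edge changes the orientation, and labels in W
   are multilinear. *)
Inductive graph_relation n : free_module F (graph L n) -> Prop :=
| GraphEdges es es' ls :
    perm_eq es es' -> graph_relation (<< (es, ls) >> - << (es', ls) >>)
| GraphLeaves es ls ls' :
    perm_eq ls ls' -> graph_relation (<< (es, ls) >> - << (es, ls') >>)
| GraphVertices (s : 'S_n) g :
    graph_relation (<< g >> - (-1) ^+ (s : bool) *: << map_vertices s g >>)
| GraphReverse es1 i j es2 ls :
    graph_relation (<< (es1 ++ (i, j) :: es2, ls) >>
                      + << (es1 ++ (j, i) :: es2, ls) >>)
| GraphLabels es ls1 i c x y ls2 :
    graph_relation (<< (es, ls1 ++ (i, vec (c *: x + y)) :: ls2) >>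
                      - c *: << (es, ls1 ++ (i, vec x) :: ls2) >>
                      - << (es, ls1 ++ (i, vec y) :: ls2) >>).

End Graphs.

(** * The hairy graph complex of Comm *)

Section HairyGraphs.
Variables (F : fieldType) (V : lmodType F).

(* All graphs; C_k H Comm_V is the subcomplex spanned by the admissible ones. *)
Definition hairy_complex : presented_complex F :=
  @PresentedComplex F (graph V) (@graph_relation V F V id) (@graph_boundary V F).

Definition hairy_homology k r : lmodType F :=
  @homology F hairy_complex
    (fun _ g => [&& admissible g, connected g & has_rank r g]) k.

End HairyGraphs.

(** * The tree complex and the algebra I Comm_V *)

Section Trees.
Variables (F : fieldType) (V : lmodType F).

(* [inl false] and [inl true] are the labels 0 and 1. *)
Definition tree_label : choiceType := (bool + V)%type.
Definition is_vec (l : tree_label) : bool := if l is inr _ then true else false.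

(* The distinguished vertex is the vertex d carrying the leaves 0 and 1. *)
Definition is_tree n (g : graph tree_label n) : bool :=
  [&& admissible g, connected g, has_rank 0 g &
      [exists d, perm_eq [seq h <- leaves g | ~~ is_vec h.2]
                         [:: (d, inl false); (d, inl true)]]].

Definition tree_complex : presented_complex F :=
  @PresentedComplex F (fun k => graph tree_label k.+1)
    (fun k => @graph_relation tree_label F V inr k.+1)
    (fun k => @graph_boundary tree_label F k.+1).

Definition tree_homology k : lmodType F :=
  @homology F tree_complex (fun _ g => is_tree g) k.

End Trees.

Section JoinTrees.
Variables (F : fieldType) (V : lmodType F).

Local Notation label := (tree_label V).
Local Notation free n := (free_module F (graph label n)).

Definition swap_label (l : label) : label :=
  match l with inl b => inl (~~ b) | inr v => inr v end.

Definition swap n (g : graph label n) : graph label n :=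
  (edges g, [seq (h.1, swap_label h.2) | h <- leaves g]).

(* Joining leaf 0 of g to leaf 1 of h and merging the two distinguished
   vertices, for trees with a single internal vertex. *)
Definition join (g h : graph label 1) : graph label 1 :=
  (edges g ++ edges h,
   [seq l <- leaves g | l.2 != inl false] ++ [seq l <- leaves h | l.2 != inl true]).

Definition free_swap n : free n -> free n := fglift (fun g => << swap g >>).

Definition free_join (x y : free 1) : free 1 :=
  fglift (fun g => fglift (fun h => << join g h >>) y) x.

Local Notation trees0 := (@chains F (tree_complex V) (fun _ g => is_tree g) 0).
Local Notation trees1 := (@chains F (tree_complex V) (fun _ g => is_tree g) 1).
Local Notation rel0 := (@relations F (tree_complex V) 0).
Local Notation bnd1 := (fglift (@graph_boundary label F 1)).

Lemma fgliftE (K : choiceType) (M : lmodType F) (f : K -> M) (x : free_module F K) :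
  fglift f x = \sum_(z <- dom x) coeff z x *: f z.
Proof.
by rewrite -[x in LHS]freeg_sumE linear_sum; apply: eq_bigr => z _; rewrite /= liftU.
Qed.

Lemma free_joinl_linear y : linear (free_join^~ y).
Proof. by move=> a x z; rewrite /free_join linearP. Qed.

Lemma free_joinr_linear x : linear (free_join x).
Proof.
move=> a y z; rewrite /free_join !fgliftE scaler_sumr -big_split /=.
by apply: eq_bigr => g _; rewrite linearP scalerDr !scalerA mulrC.
Qed.

Lemma free_join1 g h : free_join << g >> << h >> = << join g h >>.
Proof. by rewrite /free_join !fglift1. Qed.

Lemma free_swap_linear n : linear (@free_swap n).
Proof. by move=> a x y; rewrite /free_swap linearP. Qed.

HB.instance Definition _ n :=
  GRing.isLinear.Build F (free n) (free n) _ (@free_swap n) (@free_swap_linear n).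
HB.instance Definition _ x :=
  GRing.isLinear.Build F (free 1) (free 1) _ (free_join x) (free_joinr_linear x).

Lemma free_swap1 n (g : graph label n) : free_swap << g >> = << swap g >>.
Proof. exact: fglift1. Qed.

Lemma free_module_ind n (P : free n -> Prop) :
  (forall g, P << g >>) -> P 0 ->
  (forall a x y, P x -> P y -> P (a *: x + y)) -> forall x, P x.
Proof.
move=> Pg P0 PD x; rewrite -[x]freeg_sumE.
elim: (dom x) => [|z s IH]; first by rewrite big_nil.
rewrite big_cons; have -> : << coeff z x *g z >> = coeff z x *: << z >> :> free n.
  by apply/eqP/freeg_eqP => u; rewrite coeffZ !coeffU mul1r.
exact: PD.
Qed.

Lemma swap_labelK : involutive swap_label.
Proof. by case=> [b|v] //=; rewrite negbK. Qed.

Lemma swapK n : involutive (@swap n).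
Proof.
case=> es ls; rewrite /swap /=; congr (_, _).
rewrite -map_comp -[RHS]map_id; apply: eq_map => -[i l] /=.
by rewrite swap_labelK.
Qed.

Lemma free_swapK n : involutive (@free_swap n).
Proof.
move=> x; elim/free_module_ind: x => [g||a x y IHx IHy].
- by rewrite !free_swap1 swapK.
- by rewrite !linear0.
- by rewrite !linearP /= IHx IHy.
Qed.

Lemma joinA : associative join.
Proof.
move=> g h k; rewrite /join /= !filter_cat -!filter_predI !catA.
congr (_, _ ++ _); first congr (_ ++ _).
- by apply: eq_filter => l /=; rewrite andbb.
- by apply: eq_filter => l /=; rewrite andbC.
- by apply: eq_filter => l /=; rewrite andbb.
Qed.

Lemma swap_nonvec n (ls : seq ('I_n * label)) :
  [seq h <- [seq (h.1, swap_label h.2) | h <- ls] | ~~ is_vec h.2] =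
  [seq (h.1, swap_label h.2) | h <- ls & ~~ is_vec h.2].
Proof.
by rewrite filter_map; congr map; apply: eq_filter => -[i [b|v]].
Qed.

Lemma swap_tree n (g : graph label n) : is_tree g -> is_tree (swap g).
Proof.
case/and4P=> /forallP adm con rk /existsP[d hd].
apply/and4P; split=> //; last first.
  apply/existsP; exists d; rewrite swap_nonvec.
  rewrite (perm_trans (perm_map _ hd)) //=.
  by apply/seq.permP => p /=; rewrite addnCA.
apply/forallP => i; apply: leq_trans (adm i) _.
by rewrite /valence /= count_map.
Qed.

Lemma swap_map_vertices m n (f : 'I_m -> 'I_n) (g : graph label m) :
  swap (map_vertices f g) = map_vertices f (swap g).
Proof. by rewrite /swap /map_vertices /= -!map_comp. Qed.

Lemma free_swapD n (x y : free n) : free_swap (x + y) = free_swap x + free_swap y.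
Proof. exact: linearD. Qed.
Lemma free_swapB n (x y : free n) : free_swap (x - y) = free_swap x - free_swap y.
Proof. exact: linearB. Qed.
Lemma free_swapZ n a (x : free n) : free_swap (a *: x) = a *: free_swap x.
Proof. exact: linearZ. Qed.

Lemma swap_relation n (x : free n) :
  graph_relation (@inr bool V) x ->
  linspan (@graph_relation label F V inr n) (free_swap x).
Proof.
case=> [es es' ls E|es ls ls' E|s g|es1 i j es2 ls|es ls1 i c u v ls2];
  rewrite !(free_swapB, free_swapD, free_swapZ) !free_swap1; apply: span_gen.
- exact: GraphEdges.
- by apply: GraphLeaves; apply: perm_map.
- by rewrite swap_map_vertices; apply: GraphVertices.
- exact: GraphReverse.
- by rewrite /swap /= !map_cat /=; apply: GraphLabels.
Qed.

Lemma swap_rel0 x : rel0 x -> rel0 (free_swap x).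
Proof.
elim=> [|a g z Rg _ IH]; first by rewrite linear0; apply: subspace0.
by rewrite linearP; apply: (subspaceP rel0).2 => //; apply: swap_relation.
Qed.

Lemma swap_boundary (x : free 2) : bnd1 (free_swap x) = free_swap (bnd1 x).
Proof.
elim/free_module_ind: x => [g||a x y IHx IHy]; last 2 first.
- by rewrite !linear0.
- by rewrite !linearP /= IHx IHy.
rewrite free_swap1 !fglift1 /= linear_sum /=; apply: eq_bigr => e _.
by rewrite linearZ /= free_swap1 swap_map_vertices.
Qed.

Lemma chains_ind k (W : subspace (free k.+1)) :
  (forall g, is_tree g -> W << g >>) ->
  forall x, @chains F (tree_complex V) (fun _ g => is_tree g) k x -> W x.
Proof. by move=> hW; apply: span_min => _ [g gT ->]; apply: hW. Qed.

Lemma chains_tree k (g : graph label k.+1) : is_tree g ->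
  @chains F (tree_complex V) (fun _ g => is_tree g) k << g >>.
Proof. by move=> gT; apply: span_gen; exists g. Qed.

Lemma swap_chains k x :
  @chains F (tree_complex V) (fun _ g => is_tree g) k x ->
  @chains F (tree_complex V) (fun _ g => is_tree g) k (free_swap x).
Proof.
elim=> [|a g z [h hT ->] _ IH]; first by rewrite linear0; apply: subspace0.
rewrite linearP /= free_swap1.
apply: (subspaceP (@chains F (tree_complex V) (fun _ g => is_tree g) k)).2 => //.
exact/chains_tree/swap_tree.
Qed.

Definition is_bounding (x : free 1) : Prop :=
  exists2 y, trees1 y & rel0 (x - bnd1 y).

Lemma is_bounding_closed : subspace_closed is_bounding.
Proof.
split=> [|a x y [u Au Ru] [v Av Rv]].
  by exists 0; [exact: subspace0 | rewrite !linear0 addr0; exact: subspace0].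
exists (a *: u + v); first exact: (subspaceP _).2.
have -> : a *: x + y - bnd1 (a *: u + v) = a *: (x - bnd1 u) + (y - bnd1 v).
  by rewrite linearP opprD addrACA -scalerBr.
exact: (subspaceP _).2.
Qed.

Definition bounding : subspace (free 1) := Subspace is_bounding_closed.

Lemma bounding_rel x : rel0 x -> bounding x.
Proof. by exists 0; [exact: subspace0 | rewrite linear0 subr0]. Qed.

Lemma bounding_boundary y : trees1 y -> bounding (bnd1 y).
Proof. by exists y; rewrite ?subrr //; apply: subspace0. Qed.

Lemma swap_bounding x : bounding x -> bounding (free_swap x).
Proof.
case=> y Ty Rxy; exists (free_swap y); first exact: swap_chains.
by rewrite swap_boundary -linearB; apply: swap_rel0.
Qed.

Lemma tree_leaves n (ls : seq ('I_n * label)) d b :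
  perm_eq [seq h <- ls | ~~ is_vec h.2] [:: (d, inl false); (d, inl true)] ->
  perm_eq ls ((d, inl b) :: [seq h <- ls | h.2 != inl b]).
Proof.
move=> hd; set p := fun h : 'I_n * label => h.2 == inl b.
have hp : perm_eq [seq h <- ls | p h] [:: (d, inl b)].
  have -> : [seq h <- ls | p h] = [seq h <- [seq h <- ls | ~~ is_vec h.2] | p h].
    rewrite -filter_predI; apply: eq_filter => -[i [c|v]] //=.
    by rewrite /p /= andbT.
  by apply: (perm_trans (perm_filter _ hd)); rewrite /p; case: b {p}.
rewrite perm_sym; apply: perm_trans (permEl (perm_filterC p ls)).
by rewrite -cat1s; apply: perm_cat; rewrite 1?perm_sym.
Qed.

Lemma tree1_edges (g : graph label 1) : is_tree g -> edges g = [::].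
Proof. by case/and4P=> _ _; rewrite /has_rank addn0 eqSS size_eq0 => /eqP. Qed.

Lemma tree1_leaves (g : graph label 1) : is_tree g -> (2 < size (leaves g))%N.
Proof.
move=> gT; case/and4P: (gT) => /forallP /(_ ord0) + _ _ _.
rewrite /valence tree1_edges //= => /leq_trans; apply; exact: count_size.
Qed.

(* Attaching the leaves of h, except for leaf ~~ b, to the vertex d of g and
   removing leaf b of g. *)
Definition attach b n (d : 'I_n) (g : graph label n) (h : graph label 1) :
    graph label n :=
  (edges g, [seq l <- leaves g | l.2 != inl b] ++
            [seq (d, l.2) | l <- leaves h & l.2 != inl (~~ b)]).

Lemma attach_tree b n d (g : graph label n) h :
  perm_eq [seq h <- leaves g | ~~ is_vec h.2] [:: (d, inl false); (d, inl true)] ->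
  is_tree g -> is_tree h -> is_tree (attach b d g h).
Proof.
move=> hd /and4P[/forallP adm con rk _] hT.
have hsz := tree1_leaves hT; case/and4P: hT => _ _ _ /existsP[d' hd'].
apply/and4P; split=> //.
  apply/forallP => i; apply: leq_trans (adm i) _; rewrite /valence leq_add2l /=.
  rewrite (seq.permP (tree_leaves b hd)) /= count_cat addnC leq_add2l.
  have := perm_size (tree_leaves (~~ b) hd') => /= hs.
  rewrite hs in hsz; case: (eqVneq d i) => [->|_] //=.
  rewrite count_map (eq_count (a2 := predT)) ?count_predT => [|l /=]; last exact: eqxx.
  by rewrite ltnS in hsz; exact: ltn_trans hsz.
apply/existsP; exists d; rewrite filter_cat.
have nv m (c : bool) (e : 'I_m) ls :
    perm_eq [seq h <- ls | ~~ is_vec h.2] [:: (e, inl false); (e, inl true)] ->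
    perm_eq [seq l <- [seq l <- ls | l.2 != inl c] | ~~ is_vec l.2]
            [:: (e, (inl (~~ c) : label))].
  move=> H; rewrite -filter_predI.
  rewrite (eq_filter (a2 := predI (fun l => l.2 != inl c) (fun l => ~~ is_vec l.2))).
    by rewrite filter_predI; apply: (perm_trans (perm_filter _ H)); case: (c).
  by move=> l /=; rewrite andbC.
have p1 := nv _ b _ _ hd; have p2 := nv _ (~~ b) _ _ hd'.
have -> : [seq k <- [seq (d, l.2) | l <- leaves h & l.2 != inl (~~ b)]
            | ~~ is_vec k.2] =
          [seq (d, l.2) | l <- [seq l <- [seq l <- leaves h | l.2 != inl (~~ b)]
                                | ~~ is_vec l.2]].
  by rewrite filter_map.
apply: (perm_trans (perm_cat p1 (perm_map _ p2))).
by rewrite negbK; case: (b) => /=; apply/seq.permP => p /=; rewrite 1?addnCA.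
Qed.

Lemma attach_join g h : is_tree h -> attach false ord0 g h = join g h.
Proof.
move=> hT; rewrite /attach /join (tree1_edges hT) cats0; congr (_, _ ++ _).
rewrite -[RHS]map_id; apply: eq_map => -[i l] /=.
by congr (_, _); apply/val_inj; case: i => -[].
Qed.

Lemma join_tree g h : is_tree g -> is_tree h -> is_tree (join g h).
Proof.
move=> gT hT; rewrite -attach_join //; apply: attach_tree => //.
case/and4P: gT => _ _ _ /existsP[d]; suff -> : d = ord0 by [].
by apply/val_inj; case: d => -[].
Qed.

Lemma join_chains x y : trees0 x -> trees0 y -> trees0 (free_join x y).
Proof.
elim=> [|a g z [g' gT ->] _ IH] Ty; first by rewrite /free_join linear0; apply: subspace0.
rewrite free_joinl_linear; apply: (subspaceP trees0).2; last exact: IH.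
elim: Ty => [|b h u [h' hT ->] _ IH']; first by rewrite linear0; apply: subspace0.
rewrite linearP; apply: (subspaceP trees0).2 => //.
by rewrite /= free_join1; apply/chains_tree/join_tree.
Qed.

Lemma free_joinDl x y z : free_join (x + y) z = free_join x z + free_join y z.
Proof. by have := free_joinl_linear z 1 x y; rewrite !scale1r. Qed.
Lemma free_joinZl a x z : free_join (a *: x) z = a *: free_join x z.
Proof. by rewrite /free_join linearZ. Qed.
Lemma free_joinBl x y z : free_join (x - y) z = free_join x z - free_join y z.
Proof. by rewrite -scaleN1r free_joinDl free_joinZl scaleN1r. Qed.

Lemma join_rel x h : rel0 x -> rel0 (free_join x << h >>).
Proof.
elim=> [|a g z Rg _ IH]; first by rewrite /free_join linear0; apply: subspace0.
rewrite free_joinl_linear; apply: (subspaceP rel0).2 => //.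
case: Rg => [es es' ls E|es ls ls' E|s g'|es1 i j es2 ls|es ls1 i c u v ls2];
  rewrite !(free_joinBl, free_joinDl, free_joinZl) !free_join1;
  apply: span_gen.
- by apply: GraphEdges; rewrite perm_cat2r.
- by apply: GraphLeaves; rewrite perm_cat2r perm_filter.
- have mvE (g1 : graph label 1) : map_vertices s g1 = g1.
    case: g1 => es ls; rewrite /map_vertices /=.
    by congr (_, _); rewrite -[RHS]map_id; apply: eq_map => -[u v] /=;
      rewrite ?(ord1 u) ?(ord1 v) ?(ord1 (s _)).
  have := GraphVertices (@inr bool V) s (join g' h).
  by rewrite !mvE.
- by rewrite /join /= -!catA /=; apply: GraphReverse.
- by rewrite /join /= !filter_cat /= -!catA; apply: GraphLabels.
Qed.

Lemma free_join0l y : free_join 0 y = 0.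
Proof. by rewrite /free_join linear0. Qed.
Lemma free_join0r x : free_join x 0 = 0.
Proof. exact: linear0. Qed.
Lemma free_swap0 n : free_swap (0 : free n) = 0.
Proof. exact: linear0. Qed.

Lemma join_boundary (T : graph label 2) h : is_tree T -> is_tree h ->
  bounding (free_join (bnd1 << T >>) << h >>).
Proof.
move=> TT hT; case/and4P: (TT) => _ _ _ /existsP[d hd].
have -> : free_join (bnd1 << T >>) << h >> = bnd1 << attach false d T h >>.
  rewrite !fglift1 /= -big_filter -[RHS]big_filter.
  elim: [seq _ <- _ | _] => [|e es IH]; first by rewrite !big_nil /free_join linear0.
  rewrite !big_cons free_joinDl free_joinZl free_join1 IH.
  congr (_ *: << _ >> + _); rewrite -attach_join // /attach /map_vertices /=.
  congr (_, _); rewrite map_cat filter_map -map_comp.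
  by congr (_ ++ _); apply: eq_map => l /=; rewrite [contract_vertex _ _ _]ord1.
by apply/bounding_boundary/chains_tree/attach_tree.
Qed.

Lemma join_bounding x y : bounding x -> trees0 y -> bounding (free_join x y).
Proof.
case=> u Tu Rxu; elim=> [|a g z [h hT ->] _ IH].
  by rewrite linear0; apply: subspace0.
rewrite linearP; apply: (subspaceP bounding).2 => //=.
rewrite -(subrK (bnd1 u) x) free_joinDl; apply: (@subspaceD _ _ bounding).
  exact/bounding_rel/join_rel.
elim: Tu => [|b t v [T TT ->] _ IHv].
  by rewrite linear0 /free_join linear0; apply: subspace0.
rewrite linearP free_joinl_linear; apply: (subspaceP bounding).2 => //.
exact: join_boundary.
Qed.

Lemma filter_swap n b (ls : seq ('I_n * label)) :
  [seq l <- [seq (l.1, swap_label l.2) | l <- ls] | l.2 != inl b] =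
  [seq (l.1, swap_label l.2) | l <- ls & l.2 != inl (~~ b)].
Proof.
by rewrite filter_map; congr map; apply: eq_filter => -[i [[]|v]]; case: b.
Qed.

Lemma swap_join x y :
  rel0 (free_swap (free_join x y) - free_join (free_swap y) (free_swap x)).
Proof.
elim/free_module_ind: x => [g||a x1 x2 IH1 IH2].
- elim/free_module_ind: y => [h||a y1 y2 IH1 IH2].
  + rewrite free_join1 !free_swap1 free_join1.
    set s := swap _; set t := join _ _.
    rewrite -[_ - _](subrKA << (edges s, leaves t) : graph label 1 >>).
    apply: (@subspaceD _ _ rel0); apply: span_gen.
    * apply: GraphLeaves; rewrite /s /t /swap /join /= map_cat !filter_swap.
      exact/permEl/perm_catC.
    * by apply: GraphEdges; apply/permEl/perm_catC.
  + by rewrite free_join0r free_swap0 free_join0l subrr; apply: subspace0.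
  + rewrite free_joinr_linear !free_swap_linear free_joinl_linear opprD addrACA.
    by rewrite -scalerBr; apply: (subspaceP rel0).2.
- by rewrite free_join0l free_swap0 free_join0r subrr; apply: subspace0.
- rewrite free_joinl_linear !free_swap_linear free_joinr_linear opprD addrACA.
  by rewrite -scalerBr; apply: (subspaceP rel0).2.
Qed.

Lemma join_boundingr x y : trees0 x -> bounding y -> bounding (free_join x y).
Proof.
move=> Tx By; rewrite -[free_join x y]free_swapK; apply: swap_bounding.
rewrite -(subrK (free_join (free_swap y) (free_swap x)) (free_swap _)).
apply: (@subspaceD _ _ bounding); first exact/bounding_rel/swap_join.
by apply: join_bounding; [apply: swap_bounding | apply: swap_chains].
Qed.

Lemma free_joinA : associative free_join.
Proof.
move=> x y z; elim/free_module_ind: x => [g||a x1 x2 IH1 IH2].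
- elim/free_module_ind: y => [h||a y1 y2 IH1 IH2].
  + elim/free_module_ind: z => [k||a z1 z2 IH1 IH2].
    * by rewrite !free_join1 joinA.
    * by rewrite !free_join0r.
    * by rewrite !free_joinr_linear IH1 IH2.
  + by rewrite free_join0l free_join0r free_join0l.
  + by rewrite free_joinl_linear !free_joinr_linear free_joinl_linear IH1 IH2.
- by rewrite !free_join0l.
- by rewrite !free_joinl_linear IH1 IH2.
Qed.

(** The algebra structure on I Comm_V = H_0. *)

Local Notation ICV := (tree_homology V 0).

(* Tree complex in degree 0: every chain is a cycle. *)
Definition I_class x (Tx : trees0 x) : ICV :=
  @homology_class F (tree_complex V) (fun _ g => is_tree g) 0 x Tx.

Lemma I_classP (P : ICV -> Prop) :
  (forall x (Tx : trees0 x), P (I_class Tx)) -> forall a, P a.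
Proof. by move=> hP; elim/homology_classP => x Zx; apply: hP. Qed.

Lemma I_class_eq x y (Tx : trees0 x) (Ty : trees0 y) :
  I_class Tx = I_class Ty <-> bounding (x - y).
Proof. exact: homology_class_eq. Qed.

Lemma I_class_linear a x y (Tx : trees0 x) (Ty : trees0 y) (T : trees0 (a *: x + y)) :
  a *: I_class Tx + I_class Ty = I_class T.
Proof.
by rewrite /I_class /homology_class -linearP; congr quotient_class; apply: val_inj.
Qed.

Definition I_mul (a b : ICV) : ICV :=
  I_class (join_chains (subspace_typeP (repr a)) (subspace_typeP (repr b))).

Definition I_bar (a : ICV) : ICV :=
  I_class (swap_chains (subspace_typeP (repr a))).

Lemma I_repr x (Tx : trees0 x) : bounding (val (repr (I_class Tx)) - x).
Proof.
apply/(I_class_eq (subspace_typeP (repr (I_class Tx))) Tx).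
rewrite -[RHS]reprK; congr quotient_class; exact: val_inj.
Qed.

Lemma I_mulE x y (Tx : trees0 x) (Ty : trees0 y) :
  I_mul (I_class Tx) (I_class Ty) = I_class (join_chains Tx Ty).
Proof.
apply/I_class_eq; set x' := val _; set y' := val _.
have -> : free_join x' y' - free_join x y =
    free_join (x' - x) y' + free_join x (y' - y).
  by rewrite free_joinBl linearB /= addrA subrK.
apply: (@subspaceD _ _ bounding).
  by apply: join_bounding; [apply: I_repr | apply: subspace_typeP].
by apply: join_boundingr => //; apply: I_repr.
Qed.

Lemma I_barE x (Tx : trees0 x) : I_bar (I_class Tx) = I_class (swap_chains Tx).
Proof.
apply/I_class_eq; rewrite -free_swapB; exact/swap_bounding/I_repr.
Qed.

Lemma I_mul_linearl b : linear (I_mul^~ b).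
Proof.
move=> c; elim/I_classP=> x Tx; elim/I_classP=> y Ty; elim/I_classP: b => z Tz.
have T := (subspaceP trees0).2 c x y Tx Ty.
rewrite (I_class_linear Tx Ty T) /= !I_mulE; have J := join_chains T Tz.
have J' := J; rewrite free_joinl_linear in J'; rewrite (I_class_linear _ _ J').
by apply/I_class_eq; rewrite free_joinl_linear subrr; apply: subspace0.
Qed.

Lemma I_mul_linearr a : linear (I_mul a).
Proof.
move=> c; elim/I_classP=> x Tx; elim/I_classP=> y Ty; elim/I_classP: a => z Tz.
have T := (subspaceP trees0).2 c x y Tx Ty.
rewrite (I_class_linear Tx Ty T) /= !I_mulE; have J := join_chains Tz T.
have J' := J; rewrite free_joinr_linear in J'; rewrite (I_class_linear _ _ J').
by apply/I_class_eq; rewrite free_joinr_linear subrr; apply: subspace0.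
Qed.

Lemma I_mulA : associative I_mul.
Proof.
elim/I_classP=> x Tx; elim/I_classP=> y Ty; elim/I_classP => z Tz.
by rewrite !I_mulE; apply/I_class_eq; rewrite free_joinA subrr; apply: subspace0.
Qed.

Lemma I_bar_linear : linear I_bar.
Proof.
move=> c; elim/I_classP=> x Tx; elim/I_classP=> y Ty.
have T := (subspaceP trees0).2 c x y Tx Ty.
rewrite (I_class_linear Tx Ty T) /= !I_barE; have J := swap_chains T.
have J' := J; rewrite free_swap_linear in J'; rewrite (I_class_linear _ _ J').
by apply/I_class_eq; rewrite free_swap_linear subrr; apply: subspace0.
Qed.

Lemma I_barK : involutive I_bar.
Proof.
elim/I_classP=> x Tx; rewrite !I_barE; apply/I_class_eq.
by rewrite free_swapK subrr; apply: subspace0.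
Qed.

Lemma I_barM a b : I_bar (I_mul a b) = I_mul (I_bar b) (I_bar a).
Proof.
elim/I_classP: a => x Tx; elim/I_classP: b => y Ty.
rewrite I_mulE !I_barE I_mulE; apply/I_class_eq.
exact/bounding_rel/swap_join.
Qed.

Definition I_algebra : involutive_algebra F :=
  InvolutiveAlgebra I_mul_linearl I_mul_linearr I_mulA I_bar_linear I_barK I_barM.

End JoinTrees.

(* Main.v *)
From HB Require Import structures.
Require Import Defs.
From mathcomp.multinomials Require Import freeg.
From mathcomp Require Import all_boot all_algebra perm.
From mathcomp Require Import boolp zify ring.

Set Implicit Arguments.
Unset Strict Implicit.
Unset Printing Implicit Defensive.

Import GRing.Theory.
Local Open Scope ring_scope.

(* Contracting the edge between the distinguished vertex, carrying only 0 and 1,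
   and a vertex carrying all other leaves kills every corolla with at least two
   labels in V, so I Comm_V is V, the value of a one-label corolla; joining two
   corollas yields at least two labels, hence the zero multiplication.  All
   Hochschild boundaries then vanish, and dihedral homology is the space of
   coinvariants.

   For graphs, let the core be the 2-core.  Let h be the sum, over the core
   vertices x carrying more than one hair or tree, of the graphs in which
   everything outside the core at x is moved to a new vertex joined to x.  For
   the boundary d, the contractions of edges that are not core edges give
   d h + h d = N + R, where N counts the core vertices carrying anything but a
   single hair and R is a combination of graphs with fewer core vertices.  Since
   N > 0 unless all vertices lie on the core and carry at most one hair, a cycle
   spanned by the graphs with N > 0 is a boundary, by induction on the core size
   and N.  A graph of rank one with N = 0 is a polygon with one hair at each
   vertex.  No contraction has as few hairs as vertices, so taking the polygon
   part of a chain is well defined on homology; it is injective by the above,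
   and surjective because the boundary of a polygon is a cycle with N > 0, so
   that a polygon can be corrected to a cycle. *)

(** * Linear maps on presented spaces and on homology *)

(** Homology is defined upstairs in free modules, while signs make sense only modulo the orientation
    relations. So [d] and [h] are first shown to descend to graph classes, as [dQ] and [hQ], and
    chains are lifted back at the very end. The 2-core is defined through degrees alone, which
    covers loops and double edges and commutes with renumbering. For an edge outside the core,
    contracting it before and after an expansion gives opposite classes. What survives is the
    contraction of the new edge and the case of an edge that is the sole branch of its core vertex,
    where contracting and expanding restores the graph. These two contributions add up to N. N takes
    several values, so one division does not suffice. For a fixed core size and N at most c + 1, the
    operator d h + h d - (c + 1) lands in N at most c or in smaller cores, and d d = 0 ensures that
    it sends cycles to cycles. Characteristic 0 serves to divide by N, to deduce x = 0 from x = -x,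
    and to invert the number of matchings of a polygon with itself. *)

Section LinearAlgebra.
Variable F : fieldType.

Lemma free_ind (K : choiceType) (P : free_module F K -> Prop) :
  (forall g, P << g >>) -> P 0 ->
  (forall a x y, P x -> P y -> P (a *: x + y)) -> forall x, P x.
Proof.
move=> Pg P0 PD x; rewrite -[x]freeg_sumE.
elim: (dom x) => [|z s IH]; first by rewrite big_nil.
rewrite big_cons.
have -> : << coeff z x *g z >> = coeff z x *: << z >> :> free_module F K.
  by apply/eqP/freeg_eqP => u; rewrite coeffZ !coeffU mul1r.
exact: PD.
Qed.

Lemma linear_free_ext (K : choiceType) (M : lmodType F)
    (f g : {linear free_module F K -> M}) :
  (forall k, f << k >> = g << k >>) -> forall x, f x = g x.
Proof.
move=> fg; apply: free_ind => [k||a x y fx fy]; first exact: fg.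
  by rewrite !linear0.
by rewrite !linearP fx fy.
Qed.

Lemma span_kills (M N : lmodType F) (f : {linear M -> N}) (G : M -> Prop) :
  (forall x, G x -> f x = 0) -> forall x, linspan G x -> f x = 0.
Proof.
move=> fG x; elim=> [|a g y Gg _ IH]; first exact: linear0.
by rewrite linearP fG // IH scaler0 addr0.
Qed.

Lemma span_sub (M : lmodType F) (G G' : M -> Prop) :
  (forall x, G x -> G' x) -> forall x, linspan G x -> linspan G' x.
Proof. by move=> GG' x; apply: span_min => g /GG'; apply: span_gen. Qed.

Lemma span_image (M N : lmodType F) (f : {linear M -> N}) (G : M -> Prop)
    (W : subspace N) :
  (forall x, G x -> W (f x)) -> forall x, linspan G x -> W (f x).
Proof.
move=> fG x; elim=> [|a g y Gg _ IH]; first by rewrite linear0; apply: subspace0.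
by rewrite linearP; apply: (subspaceP W).2 => //; apply: fG.
Qed.

Lemma subspace_sum (M : lmodType F) (W : subspace M) (I : Type) (r : seq I)
    (P : pred I) (f : I -> M) :
  (forall i, P i -> W (f i)) -> W (\sum_(i <- r | P i) f i).
Proof.
move=> Wf; elim/big_ind: _ => //; first exact: subspace0.
exact: subspaceD.
Qed.

Lemma subspace_sum_in (M : lmodType F) (W : subspace M) (I : eqType) (r : seq I)
    (P : pred I) (f : I -> M) :
  (forall i, i \in r -> P i -> W (f i)) -> W (\sum_(i <- r | P i) f i).
Proof.
by move=> Wf; rewrite big_seq_cond; apply: subspace_sum => i /andP[]; apply: Wf.
Qed.

Section QuotientLift.
Variables (M N : lmodType F) (S : subspace M) (f : {linear M -> N}).
Hypothesis fS : forall x, S x -> f x = 0.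

(** The proof that the map vanishes on [S] is carried as an argument so that the linear structure
    can be inferred from the term itself. *)
Definition quot_lift of (forall x, S x -> f x = 0) :=
  fun q : quotient S => f (repr q).

Lemma quotient_class_eq x y :
  quotient_class S x = quotient_class S y <-> S (x - y).
Proof. exact: quotient_eq. Qed.

Lemma quotient_class_eq0 x : quotient_class S x = 0 <-> S x.
Proof.
rewrite -(linear0 (quotient_class S)) quotient_class_eq subr0.
by [].
Qed.

Lemma quot_liftE x : quot_lift fS (quotient_class S x) = f x.
Proof.
apply/eqP; rewrite -subr_eq0 -linearB; apply/eqP/fS.
by apply/quotient_class_eq; rewrite /quotient_class reprK.
Qed.

Lemma quot_lift_linear : linear (quot_lift fS).
Proof.
move=> a; elim/quotientW=> x; elim/quotientW=> y.
by rewrite -[X in quot_lift _ X](linearP (quotient_class S)) !quot_liftE linearP.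
Qed.

End QuotientLift.

HB.instance Definition _ (M N : lmodType F) (S : subspace M)
    (f : {linear M -> N}) (fS : forall x, S x -> f x = 0) :=
  GRing.isLinear.Build F (quotient S) N _ (quot_lift fS) (quot_lift_linear fS).

Section PresentedMap.
Variables (K : choiceType) (R : free_module F K -> Prop) (N : lmodType F) (h : K -> N).
Hypothesis hR : forall x, R x -> fglift h x = 0.

Definition presented_map : {linear quotient (linspan R) -> N} :=
  quot_lift (f := fglift h) (span_kills (f := fglift h) hR).

Lemma presented_mapE k : presented_map (quotient_class (linspan R) << k >>) = h k.
Proof. by apply: (etrans (quot_liftE _ _)); apply: fglift1. Qed.

Lemma presented_map_class x : presented_map (quotient_class (linspan R) x) = fglift h x.
Proof. exact: quot_liftE. Qed.

End PresentedMap.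

Lemma presented_ext (K : choiceType) (R : free_module F K -> Prop) (N : lmodType F)
    (f g : {linear quotient (linspan R) -> N}) :
  (forall k, f (quotient_class _ << k >>) = g (quotient_class _ << k >>)) ->
  forall x, f x = g x.
Proof.
move=> fg; elim/quotientW => x; rewrite -/(quotient_class _ x).
apply: (linear_free_ext (f := f \o quotient_class (linspan R))
  (g := g \o quotient_class (linspan R))); exact: fg.
Qed.

Lemma inj_surj_bij (M N : lmodType F) (f : {linear M -> N}) :
  (forall x, f x = 0 -> x = 0) -> (forall y, exists x, f x = y) -> bijective f.
Proof.
move=> f0 fs.
have fs' y : exists x, f x == y by have [x <-] := fs y; exists x.
exists (fun y => xchoose (fs' y)) => x; last exact/eqP/(xchooseP (fs' x)).
apply/eqP; rewrite -subr_eq0; apply/eqP/f0.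
by rewrite linearB; apply/eqP; rewrite subr_eq0; apply: (xchooseP (fs' (f x))).
Qed.

Lemma linearly_isomorphic_sym (M N : lmodType F) :
  linearly_isomorphic M N -> linearly_isomorphic N M.
Proof.
case=> f [g fK gK].
have gl : linear g by move=> a x y; apply: (can_inj fK); rewrite linearP !gK.
pose g' := GRing.isLinear.Build F N M _ g gl.
pose gL : {linear N -> M} := HB.pack g g'.
by exists gL, f.
Qed.

Lemma linearly_isomorphic_trans (M N R : lmodType F) :
  linearly_isomorphic M N -> linearly_isomorphic N R -> linearly_isomorphic M R.
Proof. by case=> f bf [g bg]; exists (g \o f); apply: bij_comp. Qed.

Section HomologyMap.
Variables (C : presented_complex F) (A : forall k, pred (generator C k)) (k : nat).
Variables (N : lmodType F) (f : generator C k -> N).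
Hypothesis f_rel : forall x, relation (p := C) (k := k) x -> fglift f x = 0.
Hypothesis f_bnd : forall g, A (k := k.+1) g -> fglift f (boundary g) = 0.

Lemma homology_map_kills (x : subspace_type (cycles A k)) :
  boundaries A k x -> fglift f (val x) = 0.
Proof.
case=> y Ay /(span_kills (f := fglift f) f_rel); rewrite linearB => /eqP.
rewrite subr_eq0 => /eqP ->.
have: linspan (fun x => exists2 g, A g & x = << g >>) y by [].
elim=> [|a _ z [g Ag ->] _ IH]; first by rewrite !linear0.
by rewrite !linearP IH /= fglift1 f_bnd // scaler0 addr0.
Qed.

Definition cycle_map : {linear subspace_type (cycles A k) -> N} :=
  fglift f \o val.

Definition homology_map : {linear homology A k -> N} :=
  quot_lift (f := cycle_map) homology_map_kills.

Lemma homology_mapE x (Zx : cycles A k x) :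
  homology_map (homology_class Zx) = fglift f x.
Proof. exact: (quot_liftE (f := cycle_map)). Qed.

Lemma homology_map_bij :
  (forall x, cycles A k x -> fglift f x = 0 ->
     exists2 y, chains A k.+1 y & relations C k (x - fglift (@boundary F C k) y)) ->
  (forall v, exists2 x, cycles A k x & fglift f x = v) ->
  bijective homology_map.
Proof.
move=> f_inj f_surj; apply: inj_surj_bij => [h|v].
  elim/homology_classP: h => x Zx; rewrite homology_mapE => /(f_inj _ Zx) xB.
  exact/quotient_class_eq0.
by have [x Zx <-] := f_surj v; exists (homology_class Zx); rewrite homology_mapE.
Qed.

End HomologyMap.

Lemma natr_neq0 n : [pchar F] =i pred0 -> (0 < n)%N -> n%:R != 0 :> F.
Proof. by move=> /pcharf0P -> ; rewrite lt0n. Qed.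

End LinearAlgebra.

(** * Dihedral homology of an algebra with zero multiplication *)

Section TrivialDihedral.
Variable F : fieldType.

Definition tensor_class (W : lmodType F) k (v : {ffun 'I_k.+1 -> W}) :
  tensor_coinvariants W k := quotient_class (linspan (@coinvariant_relation F W k)) << v >>.

Lemma sgrM2 (M : lmodType F) n (x : M) : (-1) ^+ n *: ((-1) ^+ n *: x) = x.
Proof. by rewrite scalerA -expr2 sqrr_sign scale1r. Qed.

Lemma multilinear_class (W M : lmodType F) n (h : {linear free_module F {ffun 'I_n -> W} -> M}) :
  (forall x, multilinear_relation x -> h x = 0) ->
  forall (a : {ffun 'I_n -> W}) i c x y,
  h << subst_at a i (c *: x + y) >> = c *: h << subst_at a i x >> + h << subst_at a i y >>.
Proof.
move=> h0 a i c x y; apply/eqP; rewrite -subr_eq0 opprD addrA -linearZ -!linearB.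
by apply/eqP/h0.
Qed.

(** Linearity in the entry [i] at [1 *: 0 + 0] reads a - a - a, so -a is itself a relation. *)
Lemma multilinear_zero (W : lmodType F) n (a : {ffun 'I_n -> W}) i :
  a i = 0 -> linspan (@multilinear_relation F W n) << a >>.
Proof.
move=> ai; have aE : subst_at a i (1 *: 0 + 0) = a.
  by rewrite scaler0 addr0; apply/ffunP => j; rewrite ffunE; case: eqP => // ->.
have aE' : subst_at a i 0 = a by rewrite -{2}aE scaler0 addr0.
rewrite -[<< a >>]opprK; apply: subspaceN.
have -> : - << a >> = << subst_at a i (1 *: 0 + 0) >> - 1 *: << subst_at a i 0 >>
    - << subst_at a i 0 >> :> free_module F {ffun 'I_n -> W}.
  by rewrite aE aE' scale1r subrr sub0r.
exact/span_gen/MultilinearRelation.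
Qed.

Section TensorClass.
Variables (W : lmodType F) (k : nat).
Implicit Type v : {ffun 'I_k.+1 -> W}.

Lemma tensor_class_multilinear v i c x y :
  tensor_class (subst_at v i (c *: x + y)) =
    c *: tensor_class (subst_at v i x) + tensor_class (subst_at v i y).
Proof.
apply: multilinear_class => z Rz; apply/quotient_class_eq0/span_gen.
exact: CoinvariantMultilinear.
Qed.

Lemma tensor_class_rotate v : tensor_class (rotate v) = (-1) ^+ k *: tensor_class v.
Proof.
apply: (scalerI (a := (-1) ^+ k)); first by rewrite signr_eq0.
rewrite sgrM2 /tensor_class -linearZ; symmetry.
by apply/quotient_class_eq/span_gen/CoinvariantT.
Qed.

Lemma tensor_class_reverse v :
  tensor_class (reverse v) = (-1) ^+ (k.+1 + 'C(k.+1, 2)) *: tensor_class v.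
Proof.
apply: (scalerI (a := (-1) ^+ (k.+1 + 'C(k.+1, 2)))); first by rewrite signr_eq0.
rewrite sgrM2 /tensor_class -linearZ; symmetry.
by apply/quotient_class_eq/span_gen/CoinvariantY.
Qed.

End TensorClass.

Section Iso.
Variables (A : involutive_algebra F) (W : lmodType F).
Variables (f : {linear A -> W}) (g : W -> A).
Hypotheses (fK : cancel f g) (gK : cancel g f).
Hypothesis mul0 : forall a b : A, ia_mul a b = 0.
Hypothesis barE : forall a : A, ia_bar a = a.
(** Every face, the last one included, has an entry that is a product, hence a zero entry. *)
Lemma hochschild_boundary0 k (a : {ffun 'I_k.+2 -> A}) :
  linspan (@dihedral_relation F A true k) (hochschild_boundary a).
Proof.
have z0 (b : {ffun 'I_k.+1 -> A}) j :
    b j = 0 -> linspan (@dihedral_relation F A true k) << b >>.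
  by move=> /multilinear_zero; apply: span_sub => x; apply: DihedralMultilinear.
apply: subspaceD; last by apply/subspaceZ/(z0 _ ord0); rewrite ffunE eqxx mul0.
apply: subspace_sum => i _; apply: subspaceZ; apply: (z0 _ i).
by rewrite ffunE ltnn eqxx mul0.
Qed.

Lemma hochschild_boundary_rel k x :
  linspan (@dihedral_relation F A true k) (fglift (@hochschild_boundary F A k) x).
Proof.
elim/free_ind: x => [a||c u v Ru Rv].
- by rewrite fglift1; apply: hochschild_boundary0.
- by rewrite linear0; apply: subspace0.
- by rewrite linearP; apply: (subspaceP (linspan _)).2.
Qed.

Variable k : nat.

Local Notation rel := (linspan (@dihedral_relation F A true k)).
Local Notation acls a := (quotient_class rel << a >>).

Let g_linear : linear g.
Proof. by move=> a x y; apply: (can_inj fK); rewrite linearP !gK. Qed.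

Lemma ffun_subst (U U' : lmodType F) (h : U -> U') n (a : {ffun 'I_n -> U}) i x :
  [ffun j => h (subst_at a i x j)] = subst_at [ffun j => h (a j)] i (h x).
Proof. by apply/ffunP => j; rewrite !ffunE; case: eqP. Qed.

Let fmap (a : {ffun 'I_k.+1 -> A}) := tensor_class [ffun j => f (a j)].
Let gmap (v : {ffun 'I_k.+1 -> W}) := acls [ffun j => g (v j)].

(** Modulo k+1 the predecessor of -j is k-j. Thus [omega] applied after [tau] is the plain reversal,
    which links the two conventions for the reflection. *)
Lemma tau_neg (j : 'I_k.+1) : ord_pred (- j) = rev_ord j.
Proof.
apply/val_inj => /=; case: j => j jk /=; rewrite subSS.
case: j jk => [|j] jk.
  by rewrite !subn0 modnn add0n /= modn_small.
rewrite (@modn_small (k.+1 - j.+1)); last by lia.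
have -> : (k.+1 - j.+1 + k.+1).-1 = (k - j.+1 + k.+1)%N by lia.
by rewrite modnDr modn_small; lia.
Qed.

Lemma fmap_rel x : dihedral_relation true x -> fglift fmap x = 0.
Proof.
case=> [y [a i c u v]|a|a]; rewrite ?linearB ?linearZ /= ?scalerN ?fglift1 /fmap.
- rewrite !ffun_subst linearP tensor_class_multilinear.
  by rewrite -addrA -opprD subrr.
- have -> : [ffun j => f (a j)] = rotate [ffun j => f (tau a j)].
    by apply/ffunP => j; rewrite !ffunE ordSK.
  by rewrite tensor_class_rotate subrr.
- set b := [ffun j => f (a (ordS j))] : {ffun 'I_k.+1 -> W}.
  have -> : [ffun j => f (omega a j)] = reverse b.
    by apply/ffunP => j; rewrite !ffunE barE -tau_neg ord_predK.
  have -> : b = rotate [ffun j => f (a j)] by apply/ffunP => j; rewrite !ffunE.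
  rewrite tensor_class_reverse tensor_class_rotate !scalerA -!exprD.
  (* As k(k+1)/2 = C(k+1,2), the signs of [omega], the reversal and the rotation have an even total
     exponent; the 1 contributed by [true], the skew sign, is what makes it even. *)
  have -> : (true + (k * k.+1)./2 + (k.+1 + 'C(k.+1, 2) + k))%N =
            ((k.+1 + 'C(k.+1, 2)).*2)%N.
    by rewrite bin2 /= mulnC; lia.
  by rewrite -muln2 exprM sqrr_sign scale1r subrr.
Qed.

Lemma gmap_rel x : coinvariant_relation x -> fglift gmap x = 0.
Proof.
have clsE (y : free_module F _) : dihedral_relation true y -> quotient_class rel y = 0.
  by move=> Ry; apply/quotient_class_eq0/span_gen.
have tauE a : acls a = (-1) ^+ k *: acls (tau a).
  have := clsE _ (DihedralTau true a).
  by rewrite linearB linearZ ?scalerN => /eqP; rewrite subr_eq0 => /eqP.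
case=> [y [a i c u v]|v|v]; rewrite ?linearB ?linearZ /= ?scalerN ?fglift1 /gmap.
- rewrite !ffun_subst g_linear (multilinear_class (h := quotient_class rel)).
    by rewrite -addrA -opprD subrr.
  by move=> z Rz; apply/clsE/DihedralMultilinear.
- rewrite [X in _ - _ *: X]tauE sgrM2; apply/eqP; rewrite subr_eq0; apply/eqP.
  by congr (quotient_class rel << _ >>); apply/ffunP => j; rewrite !ffunE ord_predK.
- set a := [ffun j => g (v j)] : {ffun 'I_k.+1 -> A}.
  (* [omega] fixes place 0; only after a rotation does it become the full reversal, and the rotation
     contributes (-1)^k. *)
  have := clsE _ (DihedralOmega true (tau a)).
  have -> : omega (tau a) = [ffun j => g (reverse v j)].
    by apply/ffunP => j; rewrite !ffunE barE tau_neg.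
  rewrite linearB linearZ ?scalerN => /eqP; rewrite subr_eq0 => /eqP /= tE.
  rewrite tauE [acls (tau a)]tE scalerA -scalerBl -exprD.
  have -> : (k + (1 + (k * k.+1)./2))%N = (k.+1 + 'C(k.+1, 2))%N.
    by rewrite bin2 /= mulnC; lia.
  by rewrite subrr scale0r.
Qed.

Lemma zero_mul_dihedral :
  linearly_isomorphic (skew_dihedral_homology A k) (tensor_coinvariants W k).
Proof.
have all_chains j (x : free_module F {ffun 'I_j.+1 -> A}) :
    @chains F (dihedral_complex A true) (fun _ _ => true) j x.
  elim/free_ind: x => [a||c u v Cu Cv]; first by apply: span_gen; exists a.
    exact: subspace0.
  exact: (subspaceP (@chains F (dihedral_complex A true) (fun _ _ => true) j)).2.
have all_cycles x : cycles (C := dihedral_complex A true) (fun _ _ => true) k x.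
  rewrite /=; case: (k) x => [|j] x /=; first exact: all_chains.
  by split; [exact: all_chains | exact: hochschild_boundary_rel].
have gfmap (a : {ffun 'I_k.+1 -> A}) : gmap [ffun j => f (a j)] = acls a.
  by congr (quotient_class rel << _ >>); apply/ffunP => j; rewrite !ffunE fK.
have GE (a : {ffun 'I_k.+1 -> A}) : presented_map gmap_rel (fmap a) = acls a.
  by rewrite [LHS]presented_mapE; apply: gfmap.
have fmap_bnd (a : {ffun 'I_k.+2 -> A}) : fglift fmap (hochschild_boundary a) = 0.
  by apply: (span_kills fmap_rel); apply: hochschild_boundary0.
exists (homology_map (C := dihedral_complex A true) (A := fun _ _ => true)
  fmap_rel (fun a _ => fmap_bnd a)).
apply: homology_map_bij => [x _ fx0|v].
  (* Boundaries vanish modulo relations, so a cycle with value 0 has to be a relation itself; the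
     inverse map on coinvariants shows that it is. *)
  exists 0; first exact: subspace0.
  rewrite linear0 subr0; apply/quotient_class_eq0.
  have <- : presented_map gmap_rel (fglift fmap x) = quotient_class rel x.
    apply: (linear_free_ext (f := presented_map gmap_rel \o fglift fmap)) => a /=.
    by rewrite fglift1; apply: GE.
  by rewrite fx0 linear0.
elim/quotientW: v => z.
pose lift_tensor (v : {ffun 'I_k.+1 -> W}) : free_module F {ffun 'I_k.+1 -> A} :=
  << [ffun j => g (v j)] >>.
exists (fglift (K := {ffun 'I_k.+1 -> W}) lift_tensor z) => //.
apply: (linear_free_ext (f := fglift fmap \o fglift lift_tensor)
  (g := quotient_class (linspan (@coinvariant_relation F W k)))) => v /=.
rewrite !fglift1; congr (quotient_class _ << _ >>).
by apply/ffunP => j; rewrite !ffunE gK.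
Qed.

End Iso.
End TrivialDihedral.

(** * The algebra of corollas *)

(** Induction along paths, used with [R] equality, inheritance of core membership, and connectivity
    of images under a map. *)
Lemma connect_min (T : finType) (e : rel T) (R : T -> T -> Prop) :
  (forall x, R x x) -> (forall y x z, R x y -> R y z -> R x z) ->
  (forall x y, e x y -> R x y) -> forall x y, connect e x y -> R x y.
Proof.
move=> Rxx Rtr eR x y /connectP[p]; elim: p x => [|z p IH] x /=; first by move=> _ ->.
by case/andP=> /eR xz zp yE; apply: Rtr xz _; apply: IH.
Qed.

Section CorollaAlgebra.
Variables (F : fieldType) (V : lmodType F).

Local Notation label := (tree_label V).
Local Notation free n := (free_module F (graph label n)).
Local Notation rel0 := (@relations F (tree_complex V) 0).
Local Notation trees k := (@chains F (tree_complex V) (fun _ g => is_tree g) k).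

Definition vecs n (ls : seq ('I_n * label)) : seq V :=
  pmap (fun l => if l.2 is inr v then Some v else None) ls.

Lemma size_vecs n (ls : seq ('I_n * label)) : size (vecs ls) = count (fun l => is_vec l.2) ls.
Proof. by rewrite size_pmap; apply: eq_count => -[i [b|v]]. Qed.

Lemma vecs_map m n (f : 'I_m -> 'I_n) (ls : seq ('I_m * label)) :
  vecs [seq (f l.1, l.2) | l <- ls] = vecs ls.
Proof. by rewrite /vecs; elim: ls => //= -[i [b|v]] ls /= ->. Qed.

Lemma vecs_filter n b (ls : seq ('I_n * label)) :
  vecs [seq l <- ls | l.2 != inl b] = vecs ls.
Proof.
elim: ls => //= -[i [c|v]] ls IH /=; last by rewrite IH.
by case: ifP => _; rewrite /= IH.
Qed.

(** Contractions keep all vectors, and a tree with two internal vertices has at least two of them;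
    admitting exactly one vector therefore makes the value vanish on boundaries. The sum then has a
    single term. *)
Definition corolla_value (g : graph label 1) : V :=
  if (edges g == [::]) && (size (vecs (leaves g)) == 1)%N
  then \sum_(v <- vecs (leaves g)) v else 0.

Lemma map_vertices1 (f : 'I_1 -> 'I_1) (g : graph label 1) : map_vertices f g = g.
Proof.
case: g => es ls; congr (_, _); rewrite -[RHS]map_id; apply: eq_map => -[i j] /=.
  by rewrite (ord1 (f i)) (ord1 (f j)) (ord1 i) (ord1 j).
by rewrite (ord1 (f i)) (ord1 i).
Qed.

Lemma corolla_value_rel x : graph_relation inr x -> fglift corolla_value x = 0.
Proof.
case=> [es es' ls E|es ls ls' E|s g|es1 i j es2 ls|es ls1 i c u v ls2];
  rewrite ?linearB ?linearD ?linearZ /= ?scalerN !fglift1.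
- by rewrite /corolla_value /= -!size_eq0 (perm_size E) subrr.
- have E' : perm_eq (vecs ls) (vecs ls') by apply: perm_pmap.
  by rewrite /corolla_value /= (perm_size E') (perm_big _ E') subrr.
- rewrite map_vertices1 (_ : s = 1%g) ?odd_perm1 ?scale1r ?subrr //.
  by apply/permP => i; rewrite perm1 [RHS]ord1 ord1.
- by rewrite /corolla_value; case: es1 => [|e es1]; rewrite /= addr0.
- rewrite /corolla_value /vecs /= !pmap_cat /= !size_cat /= !addnS.
  rewrite -[pmap _ ls1]/(vecs ls1) -[pmap _ ls2]/(vecs ls2).
  case: (es == [::]); last by rewrite /= scaler0 !subr0.
  rewrite /= eqSS addn_eq0 !size_eq0; case: andP => [[/eqP-> /eqP->]|_].
    by rewrite /= !big_seq1 addrAC addrK subrr.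
  by rewrite scaler0 !subr0.
Qed.

(** The vertex other than the distinguished one has valence at least 3, meets the single edge once
    and carries neither leaf 0 nor leaf 1, which leaves at least two vectors. *)
Lemma tree2_vecs (T : graph label 2) : is_tree T -> (1 < size (vecs (leaves T)))%N.
Proof.
case/and4P=> /forallP adm /andP[_ /forallP con] rk /existsP[d hd].
pose u : 'I_2 := lift d ord0.
have du : d != u := neq_lift _ _.
have [[a b] esE] : exists e, edges T = [:: e].
  by move: rk; rewrite /has_rank; case: (edges T) => [|e []] //; exists e.
have ab : a != b.
  apply/eqP => ab; move: (du) (con d) => /eqP du' /forallP /(_ u).
  move/(@connect_min _ _ (fun x y => x = y)) => dE; apply/du'/dE => //.
    by move=> y x z -> ->.
  by move=> x y; rewrite /adjacent /= esE !inE ab !xpair_eqE => /orP[] /andP[/eqP-> /eqP->].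
have cu : (1 < count (fun h => h.1 == u) (leaves T))%N.
  have := adm u; rewrite /valence esE /= !addn0.
  case: (a =P u) (b =P u) => [au|_] [bu|_]; rewrite ?addn0 ?add0n ?addSn ?ltnS //.
    by rewrite au bu eqxx in ab.
  by move/ltnW.
apply: leq_trans cu _; rewrite size_vecs.
rewrite -(seq.permP (permEl (perm_filterC (fun h => is_vec h.2) (leaves T)))).
rewrite count_cat (seq.permP hd) /= (negPf du) !addn0.
rewrite -[X in (_ <= X)%N]size_filter.
exact: count_size.
Qed.

Lemma corolla_value_boundary (T : graph label 2) :
  is_tree T -> fglift corolla_value (graph_boundary F T) = 0.
Proof.
move=> /tree2_vecs vT; rewrite linear_sum big1 //= => e _.
rewrite linearZ /= fglift1 /corolla_value /= vecs_map.
by rewrite (gtn_eqF vT) andbF scaler0.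
Qed.

Definition corolla_map : {linear tree_homology V 0 -> V} :=
  homology_map (C := tree_complex V) (A := fun _ g => is_tree g) (k := 0)
    corolla_value_rel corolla_value_boundary.

Definition corolla (v : V) : graph label 1 :=
  ([::], [:: (ord0, inl false); (ord0, inl true); (ord0, inr v)]).

Lemma corolla_tree v : is_tree (corolla v).
Proof.
apply/and4P; split=> //.
- by apply/forallP => i; rewrite (ord1 i).
- by apply/andP; split=> //; apply/forallP => i; apply/forallP => j; rewrite (ord1 i) (ord1 j).
- by apply/existsP; exists ord0.
Qed.

Lemma tree1_perm (g : graph label 1) : is_tree g ->
  perm_eq (leaves g) [:: (ord0, inl false), (ord0, inl true) &
                         [seq (ord0, inr v) | v <- vecs (leaves g)]].
Proof.
case/and4P=> _ _ _ /existsP[d]; have -> : d = ord0 by apply: ord1.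
move=> hd; rewrite perm_sym.
apply: perm_trans (permEl (perm_filterC (fun h => ~~ is_vec h.2) (leaves g))).
rewrite -[_ :: _]cat1s -[_ :: map _ _]cat1s catA; apply: perm_cat.
  by rewrite perm_sym.
apply/permPl; move=> ?; congr perm_eq.
elim: (leaves g) => //= -[i [b|v]] ls IH //=; by rewrite IH (ord1 i).
Qed.

Lemma tree1_vecs (g : graph label 1) : is_tree g -> (0 < size (vecs (leaves g)))%N.
Proof.
move=> gT; have := tree1_leaves gT; rewrite (perm_size (tree1_perm gT)) /=.
by rewrite size_map.
Qed.

Lemma corolla_linear a u v :
  rel0 (<< corolla (a *: u + v) >> - a *: << corolla u >> - << corolla v >>).
Proof.
exact/span_gen/(@GraphLabels _ F V inr 1 [::]
  [:: (ord0, inl false); (ord0, inl true)] ord0 a u v [::]).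
Qed.

Lemma corolla0 : rel0 << corolla 0 >>.
Proof.
have := corolla_linear 1 0 0; rewrite scale1r scale1r addr0 subrr sub0r.
by move/subspaceN; rewrite opprK.
Qed.

Lemma tree1_bounding (g : graph label 1) : is_tree g ->
  bounding V (<< g >> - << corolla (corolla_value g) >>).
Proof.
move=> gT; have gE := tree1_perm gT; have := tree1_vecs gT.
case: g gT gE => es ls gT; rewrite /corolla_value (tree1_edges gT) /=.
have -> : es = [::] by exact: tree1_edges gT.
case: (vecs ls) => [|v [|w vs]] // gE _.
  by rewrite /= big_seq1; apply/bounding_rel/span_gen/GraphLeaves.
set us := [:: v, w & vs] in gE *.
pose T : graph label 2 := ([:: (ord0, lift ord0 ord0)],
  [:: (ord0, inl false), (ord0, inl true) & [seq (lift ord0 ord0, inr u) | u <- us]]).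
have TT : is_tree T.
  apply/and4P; split=> //.
  - apply/forallP => i; rewrite /valence /= count_map.
    by case: i => -[|[|[]]].
  - apply/andP; split=> //; apply/forallP => i; apply/forallP => j.
    case: (i =P j) => [->|ij]; first exact: connect0.
    apply: connect1; rewrite /adjacent /= !inE.
    by case: i j ij => -[|[|[]]] // hi [[|[|[]]]] // hj; case; apply/val_inj.
  - apply/existsP; exists ord0; rewrite /=.
    by elim: vs {us gE T} => //=.
have bE : graph_boundary F T = << ([::], [:: (ord0, inl false), (ord0, inl true) &
    [seq (ord0, inr u) | u <- us]]) : graph label 1 >>.
  rewrite /graph_boundary /= big_cons /= big_nil addr0.
  rewrite /contract_sign /= expr2 mulrNN mulr1 scale1r.
  congr (<< (_, _) >>).
  transitivity [seq ((ord0 : 'I_1), h.2) | h <- leaves T].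
    by apply: eq_map => h; congr (_, _); apply: ord1.
  by rewrite /= -map_comp.
(* With two or more vectors the value is 0, and [corolla 0] is already a relation; it remains to
   bound the graph itself by [T]. *)
apply: (@subspaceB _ _ (bounding V)); last exact/bounding_rel/corolla0.
rewrite -(subrK (graph_boundary F T) (<< _ >>)); apply: (@subspaceD _ _ (bounding V)).
  by apply/bounding_rel; rewrite bE; apply/span_gen/GraphLeaves.
by rewrite -[graph_boundary F T]fglift1; apply/bounding_boundary/chains_tree.
Qed.

(** [corolla] is linear modulo relations, so a combination of corollas collapses to one. This is the
    injectivity of [corolla_map]. *)
Lemma corolla_value_bounding x : trees 0 x ->
  bounding V (x - << corolla (fglift corolla_value x) >>).
Proof.
elim=> [|a _ y [g gT ->] _ IH].
  by rewrite linear0 sub0r; apply/(@subspaceN _ _ (bounding V))/bounding_rel/corolla0.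
rewrite linearP /= fglift1.
set u := corolla_value g; set v := fglift corolla_value y in IH *.
have -> : a *: << g >> + y - << corolla (a *: u + v) >> =
    a *: (<< g >> - << corolla u >>) + (y - << corolla v >>)
    - (<< corolla (a *: u + v) >> - a *: << corolla u >> - << corolla v >>) :> free 1.
  rewrite scalerBr -[_ - _ - << corolla v >>]addrA -!opprD addrACA -opprD.
  by rewrite opprB addrA subrK.
apply: (@subspaceB _ _ (bounding V)); last exact/bounding_rel/corolla_linear.
by apply: (subspaceP (bounding V)).2 => //; apply: tree1_bounding.
Qed.

Lemma corolla_value_corolla v : corolla_value (corolla v) = v.
Proof. by rewrite /corolla_value /= big_seq1. Qed.

Lemma corolla_map_bij : bijective corolla_map.
Proof.
apply: homology_map_bij => [x /corolla_value_bounding xB x0|v].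
  apply: (_ : bounding V x); rewrite -(subrK (<< corolla 0 >>) x).
  by apply: (@subspaceD _ _ (bounding V)); [rewrite -x0 | apply/bounding_rel/corolla0].
exists (<< corolla v >>); first exact/chains_tree/corolla_tree.
by rewrite fglift1 corolla_value_corolla.
Qed.

Lemma corolla_value_join x y : trees 0 x -> trees 0 y ->
  fglift corolla_value (free_join x y) = 0.
Proof.
move=> Tx Ty; elim: Tx => [|a _ x1 [g gT ->] _ IH].
  by rewrite /free_join linear0 linear0.
rewrite free_joinl_linear linearP /= IH addr0 {x1 IH x}.
elim: Ty => [|b _ y1 [h hT ->] _ IH]; first by rewrite linear0 linear0 scaler0.
rewrite linearP linearP /= scalerDr IH addr0 free_join1 fglift1.
rewrite /corolla_value /= size_vecs count_cat -!size_vecs !vecs_filter.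
have := tree1_vecs gT; have := tree1_vecs hT.
case: (size _) => // m _; case: (size _) => // m' _.
by rewrite addnS addSn andbF !scaler0.
Qed.

Lemma corolla_value_swap x : fglift corolla_value (free_swap x) = fglift corolla_value x.
Proof.
apply: (linear_free_ext (f := fglift corolla_value \o @free_swap F V 1)) => g /=.
rewrite free_swap1 !fglift1 /corolla_value /=.
suff -> : vecs [seq (h.1, swap_label h.2) | h <- leaves g] = vecs (leaves g) by [].
by rewrite /vecs; elim: (leaves g) => //= -[i [b|v]] ls /= ->.
Qed.

Lemma corolla_mapE x (Tx : trees 0 x) :
  corolla_map (I_class Tx) = fglift corolla_value x.
Proof. exact: homology_mapE. Qed.

Lemma I_algebra_mul (a b : I_algebra V) : corolla_map (ia_mul a b) = 0.
Proof.
change (corolla_map (I_mul a b) = 0).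
elim/I_classP: a => x Tx; elim/I_classP: b => y Ty.
by rewrite I_mulE corolla_mapE; apply: corolla_value_join.
Qed.

Lemma I_algebra_bar (a : I_algebra V) : corolla_map (ia_bar a) = corolla_map a.
Proof.
change (corolla_map (I_bar a) = corolla_map a); elim/I_classP: a => x Tx.
by rewrite I_barE !corolla_mapE; apply: corolla_value_swap.
Qed.

Lemma I_algebra_trivial :
  involutive_algebra_isomorphic (I_algebra V) (trivial_algebra V).
Proof.
exists corolla_map; split; first exact: corolla_map_bij.
  exact: I_algebra_mul.
exact: I_algebra_bar.
Qed.

Lemma I_algebra_dihedral k :
  linearly_isomorphic (skew_dihedral_homology (I_algebra V) k) (tensor_coinvariants V k).
Proof.
have fi := bij_inj corolla_map_bij; case: corolla_map_bij => g fK gK.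
have mul0 (a b : I_algebra V) : ia_mul a b = 0.
  by apply: fi; rewrite [RHS]linear0; apply: I_algebra_mul.
have barE (a : I_algebra V) : ia_bar a = a by apply: fi; apply: I_algebra_bar.
exact: (@zero_mul_dihedral F (I_algebra V) V corolla_map g fK gK mul0 barE k).
Qed.

End CorollaAlgebra.

(** * Graph classes and edge contraction *)

Lemma perm_fix0 n (s : 'S_n.+1) : s ord0 = ord0 ->
  exists s' : 'S_n, s = lift_perm ord0 ord0 s'.
Proof.
move=> s0; pose f k := odflt k (unlift ord0 (s (lift ord0 k))).
have fE k : lift ord0 (f k) = s (lift ord0 k).
  rewrite /f; case: unliftP => [j ->|] //= sk.
  by have := neq_lift ord0 k; rewrite -(inj_eq (@perm_inj _ s)) s0 sk eqxx.
have f_inj : injective f.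
  by move=> a b fab; apply/(@lift_inj _ ord0)/(@perm_inj _ s); rewrite -!fE fab.
exists (perm f_inj); apply/permP => k.
by case: (unliftP ord0 k) => [j|] ->; rewrite ?lift_perm_id // lift_perm_lift permE fE.
Qed.

Section GraphClasses.
Variables (F : fieldType) (V : lmodType F).
Local Notation gr n := (graph V n).

Definition graph_space n := quotient (linspan (@graph_relation V F V id n)).

Definition graph_class n (g : gr n) : graph_space n :=
  quotient_class (linspan (@graph_relation V F V id n)) << g >>.


(** The reversal and label relations act in the middle of a list; invariance under permuting the
    lists reduces them to the head. All functions on graph classes below are obtained from this
    criterion. *)
Lemma graph_fun_kills n (N : lmodType F) (h : gr n -> N) :
  (forall es es' ls ls', perm_eq es es' -> perm_eq ls ls' -> h (es, ls) = h (es', ls')) ->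
  (forall (s : 'S_n) g, h (map_vertices s g) = (-1) ^+ s *: h g) ->
  (forall i j es ls, h ((j, i) :: es, ls) = - h ((i, j) :: es, ls)) ->
  (forall es i c x y ls, h (es, (i, c *: x + y) :: ls) =
     c *: h (es, (i, x) :: ls) + h (es, (i, y) :: ls)) ->
  forall x, @graph_relation V F V id n x -> fglift h x = 0.
Proof.
move=> hp hs hr hl x.
have mid (T : eqType) (s1 s2 : seq T) z : perm_eq (s1 ++ z :: s2) (z :: (s1 ++ s2)).
  exact: permEl (perm_catCA s1 [:: z] s2).
case=> [es es' ls E|es ls ls' E|s g|es1 i j es2 ls|es ls1 i c u v ls2];
  rewrite ?linearB ?linearD ?linearZ /= ?scalerN !fglift1.
- by rewrite (hp _ _ _ _ E (perm_refl _)) subrr.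
- by rewrite (hp _ _ _ _ (perm_refl _) E) subrr.
- by rewrite hs scalerA -expr2 sqrr_sign scale1r subrr.
- rewrite (hp _ _ _ _ (mid _ _ _ _) (perm_refl _)).
  by rewrite (hp _ _ _ _ (mid _ _ _ (j, i)) (perm_refl _)) (hr i j) subrr.
- rewrite !(hp _ _ _ _ (perm_refl _) (mid _ _ _ _)) hl.
  by rewrite -addrA -opprD subrr.
Qed.

Section Class.
Variable n : nat.
Implicit Types (es : seq ('I_n * 'I_n)) (ls : seq ('I_n * V)).

Lemma graph_class_eq (x y : free_module F (gr n)) : graph_relation id (x - y) ->
  quotient_class (linspan (@graph_relation V F V id n)) x = quotient_class _ y.
Proof. by move=> R; apply/quotient_class_eq/span_gen. Qed.

Lemma graph_class_perm es es' ls ls' : perm_eq es es' -> perm_eq ls ls' ->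
  graph_class (es, ls) = graph_class (es', ls').
Proof.
move=> E L; transitivity (graph_class (es', ls)); apply: graph_class_eq.
  exact: GraphEdges.
exact: GraphLeaves.
Qed.

Lemma graph_class_map (s : 'S_n) g : graph_class (map_vertices s g) = (-1) ^+ s *: graph_class g.
Proof.
have := graph_class_eq (GraphVertices id s g); rewrite linearZ => gE.
by rewrite /graph_class gE sgrM2.
Qed.

Lemma graph_class_reverse i j es ls :
  graph_class ((j, i) :: es, ls) = - graph_class ((i, j) :: es, ls).
Proof.
rewrite /graph_class -linearN; apply: graph_class_eq; rewrite opprK.
exact: (GraphReverse _ [::]).
Qed.

Lemma graph_class_label es i c x y ls :
  graph_class (es, (i, c *: x + y) :: ls) =
    c *: graph_class (es, (i, x) :: ls) + graph_class (es, (i, y) :: ls).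
Proof.
rewrite /graph_class -linearP; apply: graph_class_eq; rewrite opprD addrA.
exact: (GraphLabels id es [::]).
Qed.

End Class.

Lemma map_vertices_comp m n p (f : 'I_m -> 'I_n) (h : 'I_n -> 'I_p) (g : gr m) :
  map_vertices h (map_vertices f g) = map_vertices (h \o f) g.
Proof. by rewrite /map_vertices /= -!map_comp. Qed.

Lemma eq_map_vertices m n (f h : 'I_m -> 'I_n) (g : gr m) :
  f =1 h -> map_vertices f g = map_vertices h g.
Proof.
by move=> fh; congr (_, _); apply: eq_map => x; rewrite !fh.
Qed.

Definition ord1S n : 'I_n.+2 := lift ord0 ord0.

(** Contraction of the edge from 0 to 1: both go to 0 and every later number drops by one. *)
Definition lower n (v : 'I_n.+2) : 'I_n.+1 := odflt ord0 (unlift ord0 v).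

Lemma lower0 n : lower (ord0 : 'I_n.+2) = ord0.
Proof. by rewrite /lower unlift_none. Qed.

Lemma lower_lift n (k : 'I_n.+1) : lower (lift ord0 k) = k.
Proof. by rewrite /lower liftK. Qed.

(** [g] is the graph from which the edge from [i] to [j] has already been removed. *)
Definition contraction n (i j : 'I_n.+2) (g : gr n.+2) : graph_space n.+1 :=
  (-1) ^+ contract_sign i j *: graph_class (map_vertices (contract_vertex i j) g).

Arguments contraction : simpl never.

(** Moves [i] and [lift i j] to the places 0 and 1 and keeps the order of the others: the
    permutation whose parity is [contract_sign]. *)
Definition front n (i : 'I_n.+2) (j : 'I_n.+1) : 'S_n.+2 :=
  lift_perm i ord0 (lift_perm j ord0 1).

Lemma front_contract n i j (v : 'I_n.+2) :
  contract_vertex i (lift i j) v = lower (front i j v).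
Proof.
rewrite /contract_vertex /front.
case: (unliftP i v) => [w|] ->; last by rewrite eqxx lift_perm_id lower0.
rewrite lift_perm_lift lower_lift eq_sym (negPf (neq_lift _ _)) (inj_eq (@lift_inj _ i)).
case: (unliftP j w) => [k|] ->; last by rewrite eqxx lift_perm_id.
rewrite eq_sym (negPf (neq_lift _ _)) lift_perm_lift perm1 /=.
have vE : (bump i (bump j k) - (i < bump i (bump j k)) - (bump i j < bump i (bump j k)))%N = k.
  rewrite /bump; case: (leqP j k) => jk; case: (leqP i j) => ij; case: (leqP i _) => ik;
  by case: ltnP => ?; case: ltnP => ?; lia.
by apply/val_inj; rewrite /= vE inordK //=; apply: ltn_ord.
Qed.

Lemma front_sign n (i : 'I_n.+2) j :
  (-1) ^+ contract_sign i (lift i j) = (-1) ^+ front i j :> F.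
Proof.
rewrite -signr_odd; congr (_ ^+ _); rewrite /front !odd_lift_perm odd_perm1 /contract_sign.
rewrite /= /bump !oddD !oddb; case: (leqP i j) => ij.
  by rewrite add1n ltnS ij; case: (odd i); case: (odd j).
by rewrite add0n ltnNge (ltnW ij); case: (odd i); case: (odd j).
Qed.

(** [s] and [front] differ by a permutation fixing 0 and 1. Such a permutation passes through
    [lower] and becomes the renumbering [r] of the contracted graph, with the same sign. *)
Lemma contract_renumber n (i j : 'I_n.+2) (s : 'S_n.+2) :
  s i = ord0 -> s j = ord1S n ->
  exists2 r : 'S_n.+1, forall v, contract_vertex i j v = r (lower (s v)) &
    (-1) ^+ contract_sign i j = (-1) ^+ s * (-1) ^+ r :> F.
Proof.
move=> si sj; have: i != j.
  by apply/eqP => ij; move: sj; rewrite -ij si => /eqP; rewrite (negPf (neq_lift _ _)).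
move=> ij; case: (unliftP i j) ij sj => [k ->|->]; last by rewrite eqxx.
move=> _ sk; pose t := (s^-1 * front i k)%g.
have fE : front i k = (s * t)%g by rewrite mulgA mulgV mul1g.
have f0 : front i k i = ord0 by rewrite /front lift_perm_id.
have f1 : front i k (lift i k) = ord1S n by rewrite /front lift_perm_lift lift_perm_id.
have t0 : t ord0 = ord0 by rewrite -{1}si permM permK f0.
have : t (ord1S n) = ord1S n by rewrite -{1}sk permM permK f1.
have [r tE] := perm_fix0 t0; rewrite tE /ord1S lift_perm_lift => /lift_inj r0.
exists r => [v|]; last by rewrite front_sign fE odd_permM signr_addb tE odd_lift_perm.
rewrite front_contract fE permM tE; case: (unliftP ord0 (s v)) => [w|] ->.
  by rewrite lift_perm_lift !lower_lift.
by rewrite lift_perm_id lower0 r0.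
Qed.

(** The edge may thus be brought to the places 0 and 1 by any permutation; most sign computations
    below choose a convenient one. *)
Lemma contractionE n (i j : 'I_n.+2) (s : 'S_n.+2) g :
  s i = ord0 -> s j = ord1S n ->
  contraction i j g = (-1) ^+ s *: graph_class (map_vertices (@lower n) (map_vertices s g)).
Proof.
move=> si sj; have [r cE signE] := contract_renumber si sj.
rewrite /contraction signE (eq_map_vertices _ cE).
have -> : map_vertices (fun v => r (lower (s v))) g =
    map_vertices r (map_vertices (@lower n) (map_vertices s g)).
  by rewrite !map_vertices_comp.
by rewrite graph_class_map scalerA -mulrA -expr2 sqrr_sign mulr1.
Qed.

Lemma place_first n (i j : 'I_n.+2) : i != j ->
  exists2 s : 'S_n.+2, s i = ord0 & s j = ord1S n.
Proof.
case: (unliftP i j) => [k ->|->]; last by rewrite eqxx.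
exists (front i k); first by rewrite /front lift_perm_id.
by rewrite /front lift_perm_lift lift_perm_id.
Qed.

Lemma contraction_map n (s : 'S_n.+2) i j g : i != j ->
  contraction (s i) (s j) (map_vertices s g) = (-1) ^+ s *: contraction i j g.
Proof.
rewrite -(inj_eq (@perm_inj _ s)) => /place_first[t ti tj].
rewrite (contractionE _ ti tj) (@contractionE _ i j (s * t)%g) ?permM //.
rewrite scalerA -signr_addb odd_permM addbA addbb addFb.
congr (_ *: graph_class (map_vertices _ _)); rewrite map_vertices_comp.
by apply: eq_map_vertices => v; rewrite permM.
Qed.

(** Exchanging 0 and 1 once the edge is in front costs a sign and is invisible to [lower], which
    merges the two. *)
Lemma contractionC n i j (g : gr n.+2) : i != j ->
  contraction j i g = - contraction i j g.
Proof.
move=> /place_first[t ti tj].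
pose u := tperm (ord0 : 'I_n.+2) (ord1S n).
have u01 : u = true :> bool by rewrite odd_tperm neq_lift.
rewrite (contractionE _ ti tj) (@contractionE _ j i (t * u)%g); last 2 first.
- by rewrite permM tj tpermR.
- by rewrite permM ti tpermL.
rewrite odd_permM u01 addbT signrN scaleNr; congr (- (_ *: graph_class _)).
rewrite !map_vertices_comp; apply: eq_map_vertices => v /=; rewrite permM /u.
by case: tpermP => // ->; rewrite /ord1S lower_lift lower0.
Qed.

Lemma contraction_perm n (i j : 'I_n.+2) es es' ls ls' :
  perm_eq es es' -> perm_eq ls ls' ->
  contraction i j (es, ls) = contraction i j (es', ls').
Proof. by move=> E L; congr (_ *: _); apply: graph_class_perm; apply: perm_map. Qed.

Lemma contraction_reverse n (i j a b : 'I_n.+2) es ls :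
  contraction i j ((b, a) :: es, ls) = - contraction i j ((a, b) :: es, ls).
Proof. by rewrite /contraction -scalerN -graph_class_reverse. Qed.

Lemma contraction_label n (i j a : 'I_n.+2) es c x y ls :
  contraction i j (es, (a, c *: x + y) :: ls) =
    c *: contraction i j (es, (a, x) :: ls) + contraction i j (es, (a, y) :: ls).
Proof. by rewrite /contraction [X in _ *: X]graph_class_label scalerDr !scalerA mulrC. Qed.

Lemma perm_rem (T : eqType) (x : T) s1 s2 :
  perm_eq s1 s2 -> perm_eq (rem x s1) (rem x s2).
Proof.
move=> E; have := perm_mem E x; case: (boolP (x \in s1)) => x1 x2; last first.
  by rewrite !rem_id // -x2.
by rewrite -(perm_cons x) -(permPl (perm_to_rem x1)) (permPl E); apply: perm_to_rem; rewrite -x2.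
Qed.

Definition boundary_fun n (g : gr n.+2) : graph_space n.+1 :=
  \sum_(e <- edges g | e.1 != e.2) contraction e.1 e.2 (rem e (edges g), leaves g).

Lemma boundary_fun_cons n (e0 : 'I_n.+2 * 'I_n.+2) es ls :
  boundary_fun (e0 :: es, ls) =
    (if e0.1 != e0.2 then contraction e0.1 e0.2 (es, ls) else 0) +
    \sum_(e <- es | e.1 != e.2) contraction e.1 e.2 (e0 :: rem e es, ls).
Proof.
rewrite /boundary_fun /= big_cons eqxx.
have -> : \sum_(e <- es | e.1 != e.2)
    contraction e.1 e.2 (if e0 == e then es else e0 :: rem e es, ls) =
    \sum_(e <- es | e.1 != e.2) contraction e.1 e.2 (e0 :: rem e es, ls).
  rewrite big_seq_cond [RHS]big_seq_cond; apply: eq_bigr => e /andP[ees _].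
  apply: contraction_perm; rewrite ?perm_refl //.
  (* For an edge parallel to the head and equal to it, [rem] deletes the head instead of the copy;
     the two lists agree up to order. *)
  by case: eqP => // ->; rewrite perm_sym -perm_sym; apply: perm_to_rem.
by case: ifP => _; rewrite ?add0r.
Qed.

Lemma boundary_fun_perm n (es es' : seq ('I_n.+2 * 'I_n.+2)) ls ls' :
  perm_eq es es' -> perm_eq ls ls' -> boundary_fun (es, ls) = boundary_fun (es', ls').
Proof.
move=> E L; rewrite /boundary_fun /= (perm_big _ E); apply: eq_bigr => e _.
by apply: contraction_perm; rewrite ?perm_rem.
Qed.

Lemma rem_map (T U : eqType) (f : T -> U) x s :
  x \in s -> perm_eq (rem (f x) (map f s)) (map f (rem x s)).
Proof.
move=> xs; rewrite -(perm_cons (f x)) perm_sym -[_ :: map _ _]/(map f (_ :: _)).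
rewrite -(permPr (perm_to_rem (map_f f xs))) perm_sym; apply: perm_map.
exact: perm_to_rem.
Qed.

Lemma boundary_fun_map n (s : 'S_n.+2) (g : gr n.+2) :
  boundary_fun (map_vertices s g) = (-1) ^+ s *: boundary_fun g.
Proof.
case: g => es ls; rewrite /boundary_fun /= big_map /= scaler_sumr.
under eq_bigl => e do rewrite (inj_eq (@perm_inj _ s)).
rewrite big_seq_cond [RHS]big_seq_cond; apply: eq_bigr => e /andP[ees ne].
rewrite -(contraction_map s _ ne); apply: contraction_perm => //.
exact: (rem_map (fun e => (s e.1, s e.2))).
Qed.

Definition class_boundary n (g : gr n.+1) : graph_space n :=
  quotient_class _ (graph_boundary F g).

Lemma class_boundaryE n (g : gr n.+2) : class_boundary g = boundary_fun g.
Proof.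
by rewrite /class_boundary linear_sum; apply: eq_bigr => e _; rewrite linearZ.
Qed.

(** Reversing an edge changes the sign of every term: of its own contraction by [contractionC], and
    of the others because the reversed edge survives in them. *)
Lemma class_boundary_kills n x :
  @graph_relation V F V id n.+1 x -> fglift (@class_boundary n) x = 0.
Proof.
move: x; case: n => [|n] x Rx.
  have c0 g : class_boundary g = 0 :> graph_space 0 by exact: linear0.
  by move: Rx; apply: graph_fun_kills => *; rewrite !c0 ?scaler0 ?oppr0 ?addr0.
move: Rx; apply: graph_fun_kills => *; rewrite !class_boundaryE.
- exact: boundary_fun_perm.
- exact: boundary_fun_map.
- rewrite !boundary_fun_cons /= opprD eq_sym -sumrN; congr (_ + _).
    by case: ifP => ij; rewrite ?oppr0 // contractionC // eq_sym.
  by apply: eq_bigr => e _; apply: contraction_reverse.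
- rewrite /boundary_fun scaler_sumr -big_split; apply: eq_bigr => e _.
  exact: contraction_label.
Qed.

Definition dQ n (x : graph_space n.+1) : graph_space n :=
  presented_map (@class_boundary_kills n) x.

Arguments dQ : simpl never.

HB.instance Definition _ n := GRing.isLinear.Build F (graph_space n.+1) (graph_space n)
  _ (@dQ n) (linearP (presented_map (@class_boundary_kills n))).

Lemma dQ_class n (g : gr n.+1) : dQ (graph_class g) = class_boundary g.
Proof. exact: presented_mapE. Qed.

Lemma dQE n (g : gr n.+2) : dQ (graph_class g) = boundary_fun g.
Proof. by rewrite dQ_class class_boundaryE. Qed.

Lemma dQ0 (x : graph_space 1) : dQ x = 0.
Proof.
apply: (presented_ext (f := @dQ 0) (g := \0)) => g.
by rewrite [LHS]dQ_class /class_boundary linear0.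
Qed.

End GraphClasses.

(** * The 2-core *)

Section Core.
Local Open Scope nat_scope.

(* A loop counts twice. *)
Definition edge_degree (T : finType) (U : {set T}) (v : T) (e : T * T) : nat :=
  ((e.1 == v) && (e.2 \in U)) + ((e.2 == v) && (e.1 \in U)).

Definition degree_in (T : finType) (es : seq (T * T)) (U : {set T}) (v : T) : nat :=
  \sum_(e <- es) edge_degree U v e.

Definition core_set (T : finType) (es : seq (T * T)) (U : {set T}) :=
  [forall v in U, 1 < degree_in es U v].

(* The vertex set of the 2-core. *)
Definition core (T : finType) (es : seq (T * T)) : {set T} :=
  \bigcup_(U : {set T} | core_set es U) U.

Section OneGraph.
Variable T : finType.
Implicit Types (es : seq (T * T)) (U W : {set T}) (u v : T) (e : T * T).

Lemma edge_degreeS U W v e : U \subset W -> edge_degree U v e <= edge_degree W v e.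
Proof.
move/subsetP => UW; rewrite /edge_degree; apply: leq_add.
  by case: eqP => //= _; case: (boolP (_ \in U)) => // /UW ->.
by case: eqP => //= _; case: (boolP (_ \in U)) => // /UW ->.
Qed.

Lemma degree_inS es U W v : U \subset W -> degree_in es U v <= degree_in es W v.
Proof. by move=> UW; apply: leq_sum => e _; apply: edge_degreeS. Qed.

Lemma degree_in_cons e es U v : degree_in (e :: es) U v = edge_degree U v e + degree_in es U v.
Proof. exact: big_cons. Qed.

Lemma core_setP es U : reflect (forall v, v \in U -> 1 < degree_in es U v) (core_set es U).
Proof. by apply: (iffP forall_inP). Qed.

Lemma core_max es U : core_set es U -> U \subset core es.
Proof. exact: bigcup_sup. Qed.

(** Degrees grow with the set in which they are counted, so core sets are closed under union and
    [core] is the largest of them. *)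
Lemma core_core_set es : core_set es (core es).
Proof.
apply/core_setP => v /bigcupP[U cU vU].
by apply: leq_trans (degree_inS _ _ (core_max cU)); apply: (core_setP _ _ cU).
Qed.

Lemma core_degree es v : v \in core es -> 1 < degree_in es (core es) v.
Proof. exact/core_setP/core_core_set. Qed.

Lemma core_eq es es' :
  (forall U v, degree_in es U v = degree_in es' U v) -> core es = core es'.
Proof.
move=> E; have cE U : core_set es U = core_set es' U.
  by apply/core_setP/core_setP => h v /h; rewrite E.
exact: eq_bigl.
Qed.

Lemma degree_in_perm es es' U v : perm_eq es es' -> degree_in es U v = degree_in es' U v.
Proof. exact: perm_big. Qed.

Lemma core_perm es es' : perm_eq es es' -> core es = core es'.
Proof. by move=> E; apply: core_eq => U v; apply: degree_in_perm. Qed.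

Lemma degree_in_reverse es U v a b :
  degree_in ((b, a) :: es) U v = degree_in ((a, b) :: es) U v.
Proof. by rewrite !degree_in_cons /edge_degree /= [X in X + _]addnC. Qed.

Lemma core_reverse es a b : core ((b, a) :: es) = core ((a, b) :: es).
Proof. by apply: core_eq => U v; apply: degree_in_reverse. Qed.

(** The handshake lemma, loops being counted twice at their vertex. *)
Lemma sum_degree es : \sum_v degree_in es setT v = (size es).*2.
Proof.
rewrite exchange_big /= (eq_bigr (fun _ => 2)) => [|e _].
  by rewrite big_const_seq count_predT iter_addn_0 mul2n.
rewrite big_split /= /edge_degree.
under eq_bigr do rewrite inE andbT.
under [X in _ + X]eq_bigr do rewrite inE andbT.
rewrite (bigD1 e.1) //= eqxx [X in _ + X](bigD1 e.2) //= eqxx !big1 //.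
  by move=> v /negPf; rewrite eq_sym => ->.
by move=> v /negPf; rewrite eq_sym => ->.
Qed.

End OneGraph.

Definition map_edges (T T' : finType) (f : T -> T') (es : seq (T * T)) :=
  [seq (f e.1, f e.2) | e <- es].

Lemma degree_in_map (T T' : finType) (f : T -> T') es (U : {set T'}) w :
  degree_in (map_edges f es) U w = \sum_(v | f v == w) degree_in es (f @^-1: U) v.
Proof.
rewrite /degree_in big_map exchange_big; apply: eq_bigr => e _.
rewrite /edge_degree /= big_split /=; congr (_ + _).
  case: (f e.1 =P w) => [fe|fe] /=.
    rewrite (bigD1 e.1) ?fe //= eqxx inE big1 ?addn0 // => v /andP[_ /negPf].
    by rewrite eq_sym => ->.
  by rewrite big1 // => v /eqP fv; case: eqP => // ve; case: fe; rewrite ve.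
case: (f e.2 =P w) => [fe|fe] /=.
  rewrite (bigD1 e.2) ?fe //= eqxx inE big1 ?addn0 // => v /andP[_ /negPf].
  by rewrite eq_sym => ->.
by rewrite big1 // => v /eqP fv; case: eqP => // ve; case: fe; rewrite ve.
Qed.

Lemma degree_in_map_fiber1 (T T' : finType) (f : T -> T') es (U : {set T'}) v :
  (forall u, f u = f v -> u = v) ->
  degree_in (map_edges f es) U (f v) = degree_in es (f @^-1: U) v.
Proof.
move=> fv; rewrite degree_in_map (bigD1 v) //= big1 ?addn0 // => u /andP[/eqP /fv -> /eqP].
by [].
Qed.

Lemma degree_in_map_ge (T T' : finType) (f : T -> T') es (U : {set T'}) v :
  degree_in es (f @^-1: U) v <= degree_in (map_edges f es) U (f v).
Proof. by rewrite degree_in_map (bigD1 v) //= leq_addr. Qed.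

Lemma preim_imset_inj (T T' : finType) (f : T -> T') (A : {set T}) :
  injective f -> f @^-1: (f @: A) = A.
Proof. by move=> fi; apply/setP => v; rewrite inE mem_imset. Qed.

(** A vertex outside the image of [f] meets no edge of [map_edges f es]. *)
Lemma core_set_image (T T' : finType) (f : T -> T') es (U : {set T'}) w :
  core_set (map_edges f es) U -> w \in U -> exists2 v, f v \in U & w = f v.
Proof.
move=> /core_setP cU wU; move: (cU _ wU); rewrite degree_in_map.
case: (pickP (fun v => f v == w)) => [v /eqP fv _|f0]; first by exists v; rewrite ?fv.
by rewrite big_pred0.
Qed.

Lemma core_map_inj (T T' : finType) (f : T -> T') es :
  injective f -> core (map_edges f es) = f @: core es.
Proof.
move=> fi; have f1 v u : f u = f v -> u = v by move/fi.
apply/eqP; rewrite eqEsubset; apply/andP; split.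
  apply/subsetP => w wU; have [v fvU ->] := core_set_image (core_core_set _) wU.
  rewrite imset_f //; apply: (subsetP (core_max _) _ (_ : v \in f @^-1: core (map_edges f es))).
    apply/core_setP => u; rewrite inE => fu.
    by rewrite -degree_in_map_fiber1 //; [apply: core_degree | apply: f1].
  by rewrite inE.
apply: core_max; apply/core_setP => _ /imsetP[v vU ->].
rewrite degree_in_map_fiber1; last exact: f1.
by rewrite preim_imset_inj //; apply: core_degree.
Qed.

(** * The core under contraction of one edge *)

Section Contraction.
Variables (T T' : finType) (f : T -> T') (i j : T) (es : seq (T * T)).
Hypothesis ij : i != j.
Hypothesis fE : forall u v, f u = f v -> u = v \/ (u \in [set i; j]) && (v \in [set i; j]).
Hypothesis fij : f i = f j.
Local Notation E := ((i, j) :: es).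
Local Notation E' := (map_edges f es).

Let fiber1 v : v \notin [set i; j] -> forall u, f u = f v -> u = v.
Proof. by move=> vij u /fE[//|/andP[_]]; rewrite (negPf vij). Qed.

Let degree_out U v : v \notin [set i; j] -> degree_in E U v = degree_in es U v.
Proof.
rewrite !inE negb_or degree_in_cons /edge_degree /= => /andP[vi vj].
by rewrite eq_sym (negPf vi) eq_sym (negPf vj).
Qed.

Let degree_le U v : degree_in es U v <= degree_in E U v.
Proof. by rewrite degree_in_cons leq_addl. Qed.

Lemma degree_in_merge U : 
  degree_in E' U (f i) = degree_in es (f @^-1: U) i + degree_in es (f @^-1: U) j.
Proof.
rewrite degree_in_map (bigD1 i) //= (bigD1 j) ?fij ?eqxx 1?eq_sym //=.
rewrite big1 ?addn0 // => v /andP[/andP[/eqP fv vi] vj].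
have [vE|/andP[]] := fE fv; first by rewrite vE eqxx in vj.
by rewrite !inE (negPf vi) (negPf vj).
Qed.

(** The preimage of the new core, enlarged by the old core, is a core set: a vertex of it outside
    the old core is neither [i] nor [j], so its degree is read off in the contracted graph. *)
Lemma core_contract_sub : i \in core E -> j \in core E -> core E' \subset f @: core E.
Proof.
move=> ci cj; pose W := f @^-1: core E' :|: core E.
have cW : core_set E W.
  apply/core_setP => v; case: (boolP (v \in core E)) => [vc _|vc].
    by apply: leq_trans (core_degree vc) (degree_inS _ _ _); apply: subsetUr.
  rewrite inE (negPf vc) orbF inE => fv.
  have vij : v \notin [set i; j].
    by apply: contra vc; rewrite !inE => /orP[] /eqP->.
  apply: leq_trans (core_degree fv) _; rewrite degree_in_map_fiber1; last exact: fiber1.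
  apply: leq_trans (degree_le _ _); apply: degree_inS; exact: subsetUl.
apply/subsetP => w wU; have [v fvU ->] := core_set_image (core_core_set _) wU.
by apply/imset_f/(subsetP (core_max cW)); rewrite !inE fvU.
Qed.

(** The new core lies in the image of the old one, on which [f] identifies [i] and [j]. *)
Lemma card_core_contract : i \in core E -> j \in core E -> #|core E'| < #|core E|.
Proof.
move=> ci cj; apply: leq_ltn_trans (subset_leq_card (core_contract_sub ci cj)) _.
rewrite ltn_neqAle leq_imset_card andbT; apply/imset_injP => f_inj.
by case/eqP: ij; apply: f_inj.
Qed.

(** An edge from [v] to [u] would count at [u], since [v] lies in [U]; so no edge counted at [v]
    ends in [u]. *)
Let degree_drop (U : {set T}) u v : degree_in es U u = 0 -> v \in U ->
  degree_in es U v <= degree_in es (U :\ u) v.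
Proof.
move/eqP; rewrite sum_nat_seq_eq0 => /allP u0 vU.
rewrite /degree_in [X in X <= _]big_seq [X in _ <= X]big_seq.
apply: leq_sum => e /u0; rewrite /edge_degree addn_eq0 !eqb0 !inE.
case: (e.1 =P v) => [->|_] /=; case: (e.2 =P v) => [->|_] //=; rewrite ?vU ?andbT;
  by case: eqP => //= _; rewrite ?andbF ?andbT //; case: eqP => //= _; rewrite ?andbF.
Qed.

Lemma core_contract : j \notin core E -> core E' = f @: core E.
Proof.
move=> cj; apply/eqP; rewrite eqEsubset; apply/andP; split; last first.
  apply: core_max; apply/core_setP => _ /imsetP[v vc ->].
  apply: leq_trans (degree_in_map_ge _ _ _ _).
  apply: leq_trans (degree_inS _ _ (_ : core E \subset _)); last first.
    by apply/subsetP => u uc; rewrite inE imset_f.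
  apply: leq_trans (core_degree vc) _; rewrite degree_in_cons /edge_degree /= (negPf cj) andbF.
  by case: eqP => [jv|//]; rewrite -jv (negPf cj) in vc.
set U := f @^-1: core E'.
have big_deg v : v \notin [set i; j] -> v \in U -> 1 < degree_in es U v.
  move=> vij; rewrite inE => /core_degree; rewrite degree_in_map_fiber1 //; exact: fiber1.
suff [W [cW UW]] : exists W, core_set E W /\ core E' \subset f @: W.
  by apply: subset_trans UW _; apply/imsetS/core_max.
have imU : core E' \subset f @: U.
  apply/subsetP => w wU; have [v fvU ->] := core_set_image (core_core_set _) wU.
  by apply: imset_f; rewrite inE.
case: (boolP (f i \in core E')) => [fi|fi]; last first.
  exists U; split=> //; apply/core_setP => v vU.
  apply: leq_trans (degree_le _ _); apply: big_deg => //.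
  apply: contra fi; rewrite !inE in vU *.
  by case/orP => /eqP vE; rewrite vE -?fij in vU.
have iU : i \in U by rewrite inE.
have jU : j \in U by rewrite inE -fij.
have := core_degree fi; rewrite degree_in_merge -/U => d2.
have dropP u u' : degree_in es U u = 0 -> (u, u') \in [:: (i, j); (j, i)] ->
    core_set E (U :\ u) /\ u' \in U :\ u.
  move=> u0 uu'; have u'U : u' \in U :\ u.
    by move: uu'; rewrite !inE => /orP[] /eqP[-> ->]; rewrite -?fij fi andbT // eq_sym.
  split=> //; apply/core_setP => v; rewrite 2!inE => /andP[vu vU].
  apply: leq_trans (degree_le _ _); apply: leq_trans (degree_drop u0 vU).
  case: (v =P u') => [->|/eqP vu'].
    by move: uu' u0 d2; rewrite !inE => /orP[] /eqP[-> ->] ->; rewrite ?addn0.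
  apply: big_deg => //; move: uu'; rewrite !inE negb_or => /orP[] /eqP[<- <-];
    by rewrite vu vu'.
case: (posnP (degree_in es U j)) => [j0|jp].
  exists (U :\ j); split; first by case: (dropP j i j0) => //; rewrite !inE eqxx orbT.
  apply: subset_trans imU _; apply/subsetP => _ /imsetP[v vU ->].
  case: (v =P j) => [->|/eqP vj]; last by apply: imset_f; rewrite 2!inE vj.
  by rewrite -fij; apply: imset_f; rewrite 2!inE ij iU.
case: (posnP (degree_in es U i)) => [i0|ip].
  case: (dropP i j i0) => [|/core_max /subsetP cU /cU]; first by rewrite !inE eqxx.
  by rewrite (negPf cj).
(* Both ends have a further edge in [U]; the edge from [i] to [j] raises their degrees to two, so
   [U] would be a core set containing [j]. *)
case/negP: cj; apply: (subsetP (core_max (_ : core_set E U))) => //.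
apply/core_setP => v vU; case: (boolP (v \in [set i; j])) => [|vij]; last first.
  exact: leq_trans (big_deg _ vij vU) (degree_le _ _).
rewrite !inE degree_in_cons /edge_degree /= => /orP[] /eqP->; rewrite eqxx ?iU ?jU /=.
  by rewrite -addnA ltnS addnC; apply: leq_trans ip (leq_addr _ _).
by rewrite addnC addnA addn1 ltnS; apply: leq_trans jp (leq_addr _ _).
Qed.

End Contraction.

End Core.

(** * Expansion of core vertices *)

Lemma leq_bool (a b : bool) : (a -> b) -> (a <= b)%N.
Proof. by case: a => // ->. Qed.

Section Expansion.
Variables (F : fieldType) (V : lmodType F).
Local Notation gr n := (graph V n).

(** New number of the end at [a] of an edge whose other end is [b]: it moves to the new vertex
    exactly if it starts a tree at [x]. Core edges and loops at [x] stay. *)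
Definition expand_end n (c : {set 'I_n}) (x a b : 'I_n) : 'I_n.+1 :=
  if (a == x) && (b \notin c) then ord0 else lift ord0 a.

Definition expand_edge n (c : {set 'I_n}) (x : 'I_n) (e : 'I_n * 'I_n) :=
  (expand_end c x e.1 e.2, expand_end c x e.2 e.1).

Definition expand_leaf n (x : 'I_n) (l : 'I_n * V) : 'I_n.+1 * V :=
  (if l.1 == x then ord0 else lift ord0 l.1, l.2).

(* The hairs and trees at the core vertex x are moved to a new vertex 0, joined
   to x by a new edge. *)
Definition expand n (x : 'I_n) (g : gr n) : gr n.+1 :=
  ((ord0, lift ord0 x) :: map (expand_edge (core (edges g)) x) (edges g),
   map (expand_leaf x) (leaves g)).

Definition branches n (g : gr n) (x : 'I_n) : nat :=
  (degree_in (edges g) (~: core (edges g)) x + count (fun l => l.1 == x) (leaves g))%N.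

(** The new vertex has valence one more than the number of branches, so two branches are what
    admissibility of the expansion demands. *)
Definition expandable n (g : gr n) : {set 'I_n} :=
  [set x in core (edges g) | (1 < branches g x)%N].

(** The contraction of the new edge of an expansion at [x], with the original numbers restored. *)
Definition collapse n (x : 'I_n) (v : 'I_n.+1) : 'I_n := odflt x (unlift ord0 v).

Lemma collapse0 n (x : 'I_n) : collapse x ord0 = x.
Proof. by rewrite /collapse unlift_none. Qed.

Lemma collapse_lift n (x v : 'I_n) : collapse x (lift ord0 v) = v.
Proof. by rewrite /collapse liftK. Qed.

Lemma collapse_expand_end n c (x a b : 'I_n) : collapse x (expand_end c x a b) = a.
Proof.
by rewrite /expand_end; case: eqP => [->|_] /=; [case: ifP|]; rewrite ?collapse0 ?collapse_lift.
Qed.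

Lemma expand_end_lift n (c : {set 'I_n}) x a b v :
  expand_end c x a b = lift ord0 v -> a = v.
Proof. by move=> /(congr1 (collapse x)); rewrite collapse_expand_end collapse_lift. Qed.

Lemma lift0_neq n (v : 'I_n) : (lift ord0 v == ord0) = false.
Proof. by rewrite eq_sym (negPf (neq_lift _ _)). Qed.

Lemma expand_end0 n (c : {set 'I_n}) x a b :
  (expand_end c x a b == ord0) = (a == x) && (b \notin c).
Proof. by rewrite /expand_end; case: ifP => _; rewrite ?eqxx ?lift0_neq. Qed.

Lemma expand_end_eq_lift n (c : {set 'I_n}) x a b v :
  (expand_end c x a b == lift ord0 v) = (a == v) && ~~ ((a == x) && (b \notin c)).
Proof.
rewrite /expand_end; case: ifP => _ /=; first by rewrite eq_sym lift0_neq andbF.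
by rewrite (inj_eq (@lift_inj _ _)) andbT.
Qed.

(** Collapsing the core of the expansion and adding the old core yields a core set, hence nothing
    new. The new vertex is excluded because its only neighbour in the core is [x], through a single
    edge. *)
Lemma core_expand n (x : 'I_n) (g : gr n) : x \in core (edges g) ->
  core (edges (expand x g)) = lift ord0 @: core (edges g).
Proof.
case: g => es ls /= xc; set c := core es; set X := _ :: _.
have liftc v : (lift ord0 v \in lift ord0 @: c) = (v \in c).
  by rewrite mem_imset //; apply: lift_inj.
set U := core X; pose W := collapse x @: U :|: c.
have cW : core_set es W.
  apply/core_setP => v; case: (boolP (v \in c)) => [vc _|vc].
    by apply: leq_trans (core_degree vc) (degree_inS _ _ _); apply: subsetUr.
  rewrite inE (negPf vc) orbF => /imsetP[u uU vE].
  have uE : u = lift ord0 v.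
    case: (unliftP ord0 u) vE => [w ->|->]; first by rewrite collapse_lift => ->.
    by rewrite collapse0 => vx; rewrite vx xc in vc.
  rewrite uE in uU; apply: leq_trans (core_degree uU) _.
  have vx : (x == v) = false by apply: contraNF vc => /eqP <-.
  rewrite /X degree_in_cons {1}/edge_degree /= (inj_eq (@lift_inj _ _)).
  rewrite vx /= ?add0n /degree_in big_map; apply: leq_sum => e _.
  apply: leq_add; apply: leq_bool => /andP[/eqP/expand_end_lift -> eU]; rewrite eqxx inE.
    by rewrite -(collapse_expand_end c x e.2 e.1) imset_f.
  by rewrite -(collapse_expand_end c x e.1 e.2) imset_f.
have Uc : collapse x @: U \subset c.
  exact: subset_trans (subsetUl _ _) (core_max cW).
have Ucol u : u \in U -> collapse x u \in c.
  by move=> uU; apply: (subsetP Uc); apply: imset_f.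
have U0 : ord0 \notin U.
  apply/negP => /core_degree; rewrite -/U /X degree_in_cons {1}/edge_degree /=.
  rewrite ?addn0 /degree_in big_map big1 => [|e _]; first by case: (_ \in U).
  rewrite /edge_degree /expand_edge /= !expand_end0.
  apply/eqP; rewrite addn_eq0 !eqb0; apply/andP; split; apply/negP => /andP[/andP[_ ec]].
    by move/Ucol; rewrite collapse_expand_end (negPf ec).
  by move/Ucol; rewrite collapse_expand_end (negPf ec).
apply/eqP; rewrite eqEsubset; apply/andP; split.
  apply/subsetP => u uU; case: (unliftP ord0 u) uU => [v ->|->]; last first.
    by rewrite -/U (negPf U0).
  by move/Ucol; rewrite collapse_lift => vc; apply: imset_f.
apply: core_max; apply/core_setP => _ /imsetP[v vc ->].
apply: leq_trans (core_degree vc) _; rewrite degree_in_cons.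
apply: leq_trans (leq_addl _ _); rewrite /degree_in big_map; apply: leq_sum => e _.
apply: leq_add; apply: leq_bool => /andP[/eqP ev ec].
  rewrite expand_end_eq_lift ev eqxx -/c ec andbF /=.
  by rewrite /expand_end ev vc andbF liftc.
rewrite expand_end_eq_lift ev eqxx -/c ec andbF /=.
by rewrite /expand_end ev vc andbF liftc.
Qed.

Lemma expand_perm n (x : 'I_n) es es' ls ls' : perm_eq es es' -> perm_eq ls ls' ->
  graph_class (expand x (es, ls)) = graph_class (expand x (es', ls')).
Proof.
move=> E L; apply: graph_class_perm; last exact: perm_map.
by rewrite perm_cons /= (core_perm E); apply: perm_map.
Qed.

Lemma expand_edge_map m n (f : 'I_m -> 'I_n) (f' : 'I_m.+1 -> 'I_n.+1)
    (c : {set 'I_m}) (c' : {set 'I_n}) x e :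
  f' ord0 = ord0 -> (forall v, f' (lift ord0 v) = lift ord0 (f v)) ->
  (f e.1 == f x) = (e.1 == x) -> (f e.2 == f x) = (e.2 == x) ->
  (f e.1 \in c') = (e.1 \in c) -> (f e.2 \in c') = (e.2 \in c) ->
  expand_edge c' (f x) (f e.1, f e.2) =
    (f' (expand_edge c x e).1, f' (expand_edge c x e).2).
Proof.
move=> f0 fl x1 x2 c1 c2; rewrite /expand_edge /expand_end /= x1 x2 c1 c2.
by congr (_, _); case: ifP.
Qed.

Lemma expand_map n (s : 'S_n) x (g : gr n) :
  expand (s x) (map_vertices s g) = map_vertices (lift_perm ord0 ord0 s) (expand x g).
Proof.
case: g => es ls; have s_inj := @perm_inj _ s.
have cE : core (map_edges s es) = s @: core es by apply: core_map_inj.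
have s0 : lift_perm ord0 ord0 s ord0 = ord0 by rewrite lift_perm_id.
have sl v : lift_perm ord0 ord0 s (lift ord0 v) = lift ord0 (s v) by rewrite lift_perm_lift.
rewrite /expand /map_vertices /= -[map _ es]/(map_edges s es) cE s0 sl.
congr (_ :: _, _); rewrite -!map_comp; apply: eq_map => e /=.
  by apply: expand_edge_map; rewrite ?(inj_eq s_inj) ?mem_imset.
by rewrite /expand_leaf /= (inj_eq s_inj); case: ifP => _; rewrite ?s0 ?sl.
Qed.

Lemma branches_map n (s : 'S_n) x (g : gr n) :
  branches (map_vertices s g) (s x) = branches g x.
Proof.
case: g => es ls; have s_inj := @perm_inj _ s.
have cE : core (map_edges s es) = s @: core es by apply: core_map_inj.
rewrite /branches /= -[map _ es]/(map_edges s es) cE; congr (_ + _)%N.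
  rewrite degree_in_map_fiber1; last by move=> u /s_inj.
  by congr degree_in; apply/setP => v; rewrite !inE mem_imset.
by rewrite count_map; apply: eq_count => l /=; rewrite (inj_eq s_inj).
Qed.

Lemma expandable_map n (s : 'S_n) x (g : gr n) :
  (s x \in expandable (map_vertices s g)) = (x \in expandable g).
Proof.
rewrite !inE branches_map; congr andb; case: g => es ls /=.
rewrite -[map _ es]/(map_edges s es) (core_map_inj _ (@perm_inj _ s)).
by rewrite mem_imset //; apply: perm_inj.
Qed.

Lemma expand_reverse n (x : 'I_n) i j es ls :
  graph_class (expand x ((j, i) :: es, ls)) = - graph_class (expand x ((i, j) :: es, ls)).
Proof.
rewrite /expand /= core_reverse; set c := core _; set e0 := (ord0, _).
set es' := map _ es; set ls' := map _ ls.
have swap2 e : perm_eq [:: e0, e & es'] [:: e, e0 & es'].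
  exact: permEl (perm_catCA [:: e0] [:: e] es').
rewrite (graph_class_perm (swap2 _) (perm_refl _)) graph_class_reverse.
by rewrite (graph_class_perm (swap2 _) (perm_refl _)).
Qed.

Lemma branches_perm n (x : 'I_n) es es' (ls ls' : seq ('I_n * V)) :
  perm_eq es es' -> perm_eq ls ls' ->
  branches (es, ls) x = branches (es', ls') x.
Proof.
move=> E L; rewrite /branches /= (core_perm E) (degree_in_perm _ _ E).
by rewrite (seq.permP L).
Qed.

Definition expansion n (g : gr n) : graph_space V n.+1 :=
  \sum_(x in expandable g) graph_class (expand x g).

(** Core and branch numbers are invariant under all relations. Placing the new vertex first and
    directing the new edge away from it fixes the orientation, so a renumbering extends with the
    same parity. *)
Lemma expansion_kills n r :
  @graph_relation V F V id n r -> fglift (@expansion n) r = 0.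
Proof.
apply: graph_fun_kills.
- move=> es es' ls ls' E L; apply: eq_big => [x|x _]; last exact: expand_perm.
  by rewrite !inE (branches_perm x E L) /= (core_perm E).
- move=> s g; rewrite /expansion (reindex_inj (@perm_inj _ s)) scaler_sumr.
  apply: eq_big => [x|x _]; first exact: expandable_map.
  by rewrite expand_map graph_class_map odd_lift_perm.
- move=> i j es ls; rewrite -sumrN; apply: eq_big => [x|x _]; last exact: expand_reverse.
  by rewrite !inE /branches /= core_reverse degree_in_reverse.
- move=> es i c u v ls.
  have wE w : expansion (es, (i, w) :: ls) =
      \sum_(x in expandable (es, (i, u) :: ls)) graph_class (expand x (es, (i, w) :: ls)).
    by apply: eq_bigl => x; rewrite !inE.
  rewrite !wE scaler_sumr -big_split; apply: eq_bigr => x _.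
  exact: graph_class_label.
Qed.

Definition hQ n (x : graph_space V n) : graph_space V n.+1 :=
  presented_map (@expansion_kills n) x.

Arguments hQ : simpl never.

HB.instance Definition _ n := GRing.isLinear.Build F (graph_space V n) (graph_space V n.+1)
  _ (@hQ n) (linearP (presented_map (@expansion_kills n))).

Lemma hQE n (g : gr n) : hQ (graph_class g) = expansion g.
Proof. exact: presented_mapE. Qed.

End Expansion.

(** * Expansion and contraction *)

Section ExpansionContraction.
Variables (F : fieldType) (V : lmodType F).
Local Notation gr n := (graph V n).

(** [g] lacks the edge from [i] to [j], whereas [c] stands for the core of the whole graph; deleting
    the edge might change the core, so [c] is a separate argument. *)
Definition expanded_contraction n (c : {set 'I_n.+1}) (x i j : 'I_n.+1)
    (g : gr n.+1) : graph_space V n.+1 :=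
  contraction (expand_end c x i j) (expand_end c x j i)
    ((ord0, lift ord0 x) :: map (expand_edge c x) (edges g), map (expand_leaf x) (leaves g)).

Lemma valenceE n (g : gr n) v :
  valence g v = (degree_in (edges g) setT v + count (fun h => h.1 == v) (leaves g))%N.
Proof.
rewrite /valence; congr (_ + _)%N; rewrite /degree_in big_split /= -!sum1_count.
congr (_ + _)%N; rewrite big_mkcond; apply: eq_bigr => e _; rewrite inE andbT.
  by case: eqP.
by case: eqP.
Qed.

Lemma map_vertices_id n (g : gr n) : map_vertices id g = g.
Proof.
by case: g => es ls; congr (_, _); rewrite -[RHS]map_id; apply: eq_map => -[].
Qed.

(** * A non-core edge placed from vertex 0 to vertex 1 *)

Section FirstEdge.
Variables (n : nat) (es : seq ('I_n.+2 * 'I_n.+2)) (ls : seq ('I_n.+2 * V)).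
Local Notation one := (ord1S n).
Local Notation E := ((ord0, one) :: es).
Local Notation c := (core E).
Hypothesis c1 : one \notin c.
Local Notation es' := (map_edges (@lower n) es).
Local Notation g' := (map_vertices (@lower n) (es, ls)).
Local Notation c' := (core es').

Lemma lower1 : lower one = ord0.
Proof. by rewrite /ord1S lower_lift. Qed.

Lemma lower_cases (v : 'I_n.+2) :
  [\/ v = ord0, v = one | exists k, v = lift ord0 (lift ord0 k)].
Proof.
case: (unliftP ord0 v) => [w ->|->]; last by constructor 1.
by case: (unliftP ord0 w) => [k ->|->]; [constructor 3; exists k | constructor 2].
Qed.

Lemma lower_inj (u v : 'I_n.+2) : lower u = lower v ->
  u = v \/ (u \in [set ord0; one]) && (v \in [set ord0; one]).
Proof.
case: (lower_cases u) => [->|->|[k ->]]; case: (lower_cases v) => [->|->|[k' ->]];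
  rewrite ?lower0 ?lower1 ?lower_lift !inE ?eqxx ?orbT; auto.
- by move/eqP; rewrite (negPf (neq_lift _ _)).
- by move/eqP; rewrite (negPf (neq_lift _ _)).
- by move/eqP; rewrite eq_sym (negPf (neq_lift _ _)).
- by move/eqP; rewrite eq_sym (negPf (neq_lift _ _)).
- by move=> ->; left.
Qed.

Lemma core_lower : c' = @lower n @: c.
Proof.
by apply: core_contract => //; [exact: lower_inj | rewrite lower0 lower1].
Qed.

Lemma lower_core v : v != one -> (lower v \in c') = (v \in c).
Proof.
move=> v1; rewrite core_lower; apply/imsetP/idP => [[u uc /lower_inj[->//|]]|vc]; last by exists v.
rewrite !inE (negPf v1) orbF => /andP[/eqP vE /orP[] /eqP uE]; first by rewrite vE; rewrite uE in uc.
by rewrite uE (negPf c1) in uc.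
Qed.

(** A second edge from 1 to the core, or a loop at 1, would make the core together with 1 a core
    set, as the edge from 0 already gives 1 one core neighbour. *)
Lemma edge_at_one (e : 'I_n.+2 * 'I_n.+2) : ord0 \in c -> e \in es ->
  (e.1 = one -> e.2 \notin one |: c) /\ (e.2 = one -> e.1 \notin one |: c).
Proof.
move=> c0 ees; have : degree_in es (one |: c) one = 0%N.
  apply/eqP; rewrite -leqn0 leqNgt; apply: contra c1 => d1.
  apply: (subsetP (core_max (_ : core_set E (one |: c)))); last by rewrite !inE eqxx.
  apply/core_setP => v; case/setU1P => [->|vc]; last first.
    exact: leq_trans (core_degree vc) (degree_inS _ _ (subsetUr _ _)).
  rewrite degree_in_cons /edge_degree /=.
  by rewrite in_setU c0 orbT addSn ltnS add0n.
move/eqP; rewrite sum_nat_seq_eq0 => /allP /(_ e ees).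
rewrite /edge_degree addn_eq0 !eqb0 !negb_and => /andP[e1 e2].
by split=> e1E; [move: e1 | move: e2]; rewrite e1E eqxx.
Qed.

(** Only [b = one] could change status, by being merged with a core vertex 0; then [edge_at_one]
    forbids the edge to [a]. *)
Lemma lower_core_edge a b : a \in c -> ((a, b) \in es) || ((b, a) \in es) ->
  (lower b \in c') = (b \in c).
Proof.
move=> ac abE; case: (b =P one) => [bE|/eqP]; last exact: lower_core.
rewrite bE lower1 -lower0 lower_core ?neq_lift // (negPf c1).
apply/negP => c0; case/orP: abE => /(edge_at_one c0)[/= h1 h2].
  by have := h2 bE; rewrite inE ac orbT.
by have := h1 bE; rewrite inE ac orbT.
Qed.

Lemma lower_fiber1 x : x != ord0 -> x != one -> forall u, lower u = lower x -> u = x.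
Proof.
by move=> x0 x1 u /lower_inj[//|/andP[_]]; rewrite !inE (negPf x0) (negPf x1).
Qed.

Lemma lower_eq x v : x != ord0 -> x != one -> (lower v == lower x) = (v == x).
Proof.
by move=> x0 x1; apply/eqP/eqP => [/lower_fiber1 ->|->].
Qed.

Lemma core_neq1 x : x \in c -> x != one.
Proof. by apply: contraTneq => ->. Qed.

Lemma branches_lower x : x \in c -> x != ord0 -> branches g' (lower x) = branches (E, ls) x.
Proof.
move=> xc x0; have x1 := core_neq1 xc.
rewrite /branches /=; congr (_ + _)%N; last first.
  by rewrite count_map; apply: eq_count => l /=; rewrite lower_eq.
rewrite degree_in_map_fiber1; last exact: lower_fiber1.
rewrite degree_in_cons {1}/edge_degree /= ![_ == x]eq_sym (negPf x0) (negPf x1) add0n.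
rewrite /degree_in big_seq [RHS]big_seq; apply: eq_bigr => e ees.
rewrite /edge_degree; congr (_ + _)%N; case: eqP => //= ex; congr nat_of_bool; rewrite !inE.
  by rewrite (@lower_core_edge e.1) ?ex // -ex -surjective_pairing ees.
by rewrite (@lower_core_edge e.2) ?ex // -ex -surjective_pairing ees orbT.
Qed.

(** Vertex 1 has at least two half-edges besides the contracted edge, and none of them leads to the
    core, so all become branches of the merged vertex. The merged vertex is therefore expandable
    whenever 0 is in the core. *)
Lemma branches_lower0 : (2 < valence (E, ls) one)%N -> ord0 \in c ->
  (1 < branches g' ord0)%N.
Proof.
rewrite valenceE /= degree_in_cons /edge_degree /= inE /= ?add0n ?add1n ?addSn ltnS ?add0n => v1 c0.
have l01 : lower ord0 = lower one by rewrite lower0 lower1.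
rewrite /branches /= -lower0 (degree_in_merge _ _ lower_inj l01) ?neq_lift //.
rewrite -addnA; apply: leq_trans (leq_addl _ _); apply: leq_trans v1 _.
apply: leq_add; last first.
  rewrite count_map; apply: sub_count => l /= /eqP ->.
  by rewrite lower0 lower1.
rewrite /degree_in [X in (X <= _)%N]big_seq [X in (_ <= X)%N]big_seq.
apply: leq_sum => e /(edge_at_one c0)[h1 h2].
have out v : v \notin one |: c -> lower v \notin c'.
  by rewrite !inE negb_or => /andP[v1' vc]; rewrite lower_core.
rewrite /edge_degree; apply: leq_add; case: eqP => //= e1; rewrite !inE out //.
  exact: h1.
exact: h2.
Qed.

Lemma contraction_first : contraction ord0 one (es, ls) = graph_class g'.
Proof.
rewrite (@contractionE _ _ _ _ _ 1%g) ?perm1 // odd_perm1 scale1r.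
congr (graph_class (map_vertices _ _)).
rewrite (eq_map_vertices (h := id)) => [|v]; last by rewrite perm1.
exact: map_vertices_id.
Qed.

Lemma map_expand m p q (f : 'I_m -> 'I_p) (h : 'I_m.+1 -> 'I_q) (k : 'I_p.+1 -> 'I_q)
    (b : {set 'I_m}) (b' : {set 'I_p}) x y (es0 : seq ('I_m * 'I_m)) (ls0 : seq ('I_m * V)) :
  h ord0 = k ord0 -> h (lift ord0 x) = k (lift ord0 y) ->
  (forall e, e \in es0 ->
     h (expand_end b x e.1 e.2) = k (expand_end b' y (f e.1) (f e.2)) /\
     h (expand_end b x e.2 e.1) = k (expand_end b' y (f e.2) (f e.1))) ->
  (forall v, h (if v == x then ord0 else lift ord0 v) =
             k (if f v == y then ord0 else lift ord0 (f v))) ->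
  map_vertices h ((ord0, lift ord0 x) :: map (expand_edge b x) es0, map (expand_leaf x) ls0) =
  map_vertices k ((ord0, lift ord0 y) :: map (expand_edge b' y) (map_edges f es0),
                  map (expand_leaf y) [seq (f l.1, l.2) | l <- ls0]).
Proof.
move=> h0 hx he hl; congr (_, _); rewrite /= -?h0 -?hx.
  congr (_ :: _); rewrite -!map_comp; apply/eq_in_map => e ees /=.
  by have [-> ->] := he e ees.
by rewrite -!map_comp; apply: eq_map => l /=; rewrite hl.
Qed.

Lemma contractionE1 m (i j : 'I_m.+2) (s : 'S_m.+2) (h : 'I_m.+2 -> 'I_m.+1) (g : gr m.+2) :
  s i = ord0 -> s j = ord1S m -> (forall v, lower (s v) = h v) ->
  contraction i j g = (-1) ^+ s *: graph_class (map_vertices h g).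
Proof.
move=> si sj sh; rewrite (contractionE _ si sj) map_vertices_comp.
by congr (_ *: graph_class _); apply: eq_map_vertices.
Qed.

(* Expanding at x and contracting the first edge numbers the new vertex 1 and the
   merged vertex 0; in the other order the numbers are exchanged. *)
Lemma expanded_contraction_away x : x \in c -> x != ord0 ->
  expanded_contraction c x ord0 one (es, ls) = - graph_class (expand (lower x) g').
Proof.
move=> xc x0; have x1 := core_neq1 xc; rewrite /expanded_contraction /=.
have ee0 b : expand_end c x ord0 b = lift ord0 ord0 by rewrite /expand_end eq_sym (negPf x0).
have ee1 b : expand_end c x one b = lift ord0 one by rewrite /expand_end eq_sym (negPf x1).
rewrite ee0 ee1.
pose a0 : 'I_n.+3 := ord0; pose a1 := lift ord0 (ord0 : 'I_n.+2); pose a2 := lift ord0 one.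
have a01 : a0 != a1 by []. have a02 : a0 != a2 by []. have a12 : a1 != a2 by [].
(* In the expanded graph [a0] is the new vertex and [a1], [a2] are the ends of the edge to be
   contracted; this even 3-cycle brings the ends to the front and the new vertex to the third
   place. *)
pose s := (tperm a0 a1 * tperm a1 a2)%g.
pose u := tperm (ord0 : 'I_n.+2) one.
pose h v := lower (s v).
have u1 : u = true :> bool by rewrite odd_tperm neq_lift.
have s1 : s a1 = ord0 by rewrite permM tpermR tpermD // eq_sym.
have s2 : s a2 = ord1S n.+1 by rewrite permM [tperm a0 a1 a2]tpermD // tpermR.
rewrite (@contractionE1 _ _ _ s h _ s1 s2) //.
have -> : s = false :> bool by rewrite odd_permM !odd_tperm.
rewrite scale1r -[RHS]scaleN1r -[-1]/((-1) ^+ true) -u1 -graph_class_map.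
congr graph_class.
have s0 : s ord0 = a2 by rewrite permM tpermL tpermL.
have sk k : s (lift ord0 (lift ord0 (lift ord0 k))) = lift ord0 (lift ord0 (lift ord0 k)).
  by rewrite permM [tperm a0 a1 _]tpermD // tpermD.
have h0 : h ord0 = u ord0 by rewrite /h s0 lower_lift tpermL.
have hl v : h (lift ord0 v) = u (lift ord0 (lower v)).
  case: (lower_cases v) => [->|->|[k ->]]; rewrite /h ?lower0 ?lower1 ?lower_lift.
  - by rewrite [s _]s1 lower0 tpermR.
  - by rewrite [s _]s2 lower_lift tpermR.
  - by rewrite sk lower_lift tpermD.
have key v b : (v == x -> (lower b \in c') = (b \in c)) ->
    h (expand_end c x v b) = u (expand_end c' (lower x) (lower v) (lower b)).
  rewrite /expand_end lower_eq //; case: eqP => [->|_] /=; last by rewrite hl.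
  by move=> /(_ isT) ->; case: ifP; rewrite ?h0 ?hl.
rewrite /expand /=; apply: map_expand => // [e ees|v]; last first.
  by rewrite lower_eq //; case: ifP => _; rewrite ?h0 ?hl.
split; apply: key => /eqP ex.
  by rewrite (@lower_core_edge e.1) ?ex // -ex -surjective_pairing ees.
by rewrite (@lower_core_edge e.2) ?ex // -ex -surjective_pairing ees orbT.
Qed.

Lemma lower_at_one v b : ord0 \in c -> ((one, b) \in es) || ((b, one) \in es) ->
  v = one -> lower b \notin c'.
Proof.
move=> c0 H _; have : b \notin one |: c.
  by case/orP: H => /(edge_at_one c0)[/= h1 h2]; [apply: h1|apply: h2].
by rewrite !inE negb_or => /andP[b1 bc]; rewrite lower_core.
Qed.

Lemma lower_eq0 v : (lower v == ord0) = (v == ord0) || (v == one).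
Proof.
case: (lower_cases v) => [->|->|[k ->]]; rewrite ?lower0 ?lower1 ?lower_lift ?eqxx ?orbT //.
Qed.

(** Expanding at 0 moves the edge to the new vertex, so that contracting it merges vertex 1 into the
    new vertex. This is the expansion of the merged vertex, since everything at 1 lies outside the
    core; the sign is that of the transposition moving 1 past the old vertex 0. *)
Lemma expanded_contraction_at : ord0 \in c ->
  expanded_contraction c ord0 ord0 one (es, ls) = - graph_class (expand ord0 g').
Proof.
move=> c0; rewrite /expanded_contraction /=.
have -> : expand_end c ord0 ord0 one = ord0 by rewrite /expand_end eqxx (negPf c1).
have -> : expand_end c ord0 one ord0 = lift ord0 one by [].
pose a1 := lift ord0 (ord0 : 'I_n.+2); pose a2 := lift ord0 one.
pose s := tperm a1 a2; pose h v := lower (s v).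
have s0 : s ord0 = ord0 by rewrite tpermD.
have s2 : s (lift ord0 one) = ord1S n.+1 by rewrite tpermR.
rewrite (@contractionE1 _ _ _ s h _ s0 s2) //.
  have -> : s = true :> bool by rewrite odd_tperm.
  rewrite scaleN1r; congr (- graph_class _).
  have h0 : h ord0 = ord0 by rewrite /h tpermD // lower0.
  have h1 : h (lift ord0 one) = ord0 by rewrite /h tpermR lower_lift.
  have hl v : v != one -> h (lift ord0 v) = lift ord0 (lower v).
    case: (lower_cases v) => [->|->|[k ->]] // _; rewrite /h ?lower0 ?lower_lift.
      by rewrite tpermL lower_lift.
    by rewrite tpermD // lower_lift.
  have key v b : ((v, b) \in es) || ((b, v) \in es) ->
      h (expand_end c ord0 v b) = expand_end c' ord0 (lower v) (lower b).
    move=> vb; rewrite /expand_end lower_eq0.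
    case: (v =P one) => [v1|/eqP v1].
      by rewrite v1 /= h1 (@lower_at_one v) // -v1.
    rewrite orbF; case: (v =P ord0) => [v0|_]; last by rewrite hl.
    rewrite v0 in vb v1 *; rewrite (lower_core_edge c0 vb) /=.
    by case: ifP => _; rewrite ?h0 ?hl.
  rewrite -[RHS]map_vertices_id; apply: map_expand => //.
  - by rewrite hl // lower0.
  - by move=> e ees; split; apply: key; rewrite -surjective_pairing ees ?orbT.
  - move=> v; rewrite lower_eq0; case: (v =P ord0) => //= /eqP v0.
    by case: (v =P one) => [->|/eqP v1]; rewrite ?h1 ?hl.
Qed.

(** If the edge to 1 is the only branch at 0, the expansion of the merged vertex recreates vertex 1.
    The numbers 0 and 1 are exchanged and the edge is reversed, and the two signs cancel. *)
Lemma expand_first_branch : ord0 \in c -> (branches (E, ls) ord0 <= 1)%N ->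
  graph_class (expand ord0 g') = graph_class (E, ls).
Proof.
move=> c0; rewrite /branches /= degree_in_cons {1}/edge_degree /= !inE c1 /= addn0 -addnA add1n.
rewrite ltnS leqn0 addn_eq0 => /andP[/eqP d0 /eqP l0].
have nol l : l \in ls -> (l.1 == ord0) = false.
  by move: l0 => /eqP; rewrite -leqn0 leqNgt -has_count => /hasPn h /h /negPf.
have noe e : e \in es -> (e.1 = ord0 -> e.2 \in c) /\ (e.2 = ord0 -> e.1 \in c).
  move: d0 => /eqP; rewrite sum_nat_seq_eq0 => /allP h /h.
  rewrite /edge_degree addn_eq0 !eqb0 !inE !negb_and !negbK => /andP[/orP e1 /orP e2].
  by split=> ev; [case: e1|case: e2] => //; rewrite ev eqxx.
pose u := tperm (ord0 : 'I_n.+2) one.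
have u1 : u = true :> bool by rewrite odd_tperm neq_lift.
transitivity (graph_class (map_vertices u ((one, ord0) :: es, ls))); last first.
  by rewrite graph_class_map u1 scaleN1r graph_class_reverse opprK.
congr graph_class; rewrite /expand /map_vertices /= tpermL tpermR; congr (_ :: _, _).
  rewrite -map_comp; apply/eq_in_map => e ees /=.
  have key v b : ((v, b) \in es) || ((b, v) \in es) -> (v = ord0 -> b \in c) ->
      expand_end c' ord0 (lower v) (lower b) = u v.
    move=> vb vc; rewrite /expand_end lower_eq0.
    case: (v =P one) => [v1|/eqP v1].
      by rewrite orbT (@lower_at_one v b) ?v1 // ?tpermR // -v1.
    rewrite orbF; case: (v =P ord0) => [v0|/eqP v0] /=.
      by rewrite v0 in vb vc *; rewrite (lower_core_edge c0 vb) vc //= lower0 tpermL.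
    case: (lower_cases v) v0 v1 => [->|->|[k ->]]; rewrite ?eqxx // => _ _.
    by rewrite lower_lift tpermD.
  have [e1 e2] := noe e ees.
  by congr (_, _); apply: key => //; rewrite -surjective_pairing ees ?orbT.
rewrite -map_comp; apply/eq_in_map => l lls /=; congr (_, _); rewrite lower_eq0 nol //=.
case: (lower_cases l.1) (nol l lls) => [->|->|[k ->]]; rewrite ?eqxx // => _.
  by rewrite tpermR.
by rewrite lower_lift tpermD.
Qed.

(** Away from 0 the branch numbers do not change under the contraction; the merged vertex is treated
    apart because it is expandable as soon as it is in the core, whatever 0 was before. *)
Lemma sum_expandable_lower (f : 'I_n.+1 -> graph_space V n.+2) :
  (2 < valence (E, ls) one)%N ->
  \sum_(y in expandable g') f y =
    \sum_(x in expandable (E, ls) | x != ord0) f (lower x) + (if ord0 \in c then f ord0 else 0).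
Proof.
move=> val1; have inj : {in c &, injective (@lower n)}.
  move=> u v uc vc /lower_inj[//|].
  by rewrite !inE (negPf (core_neq1 uc)) (negPf (core_neq1 vc)) !orbF => /andP[/eqP-> /eqP->].
under eq_bigl => y do rewrite inE /= core_lower.
rewrite big_mkcondr big_imset //= [LHS](bigID (fun x => x == ord0)) /= addrC.
congr (_ + _).
  rewrite -big_mkcondr /=; apply: eq_bigl => x; rewrite inE /=.
  case: (boolP (x \in c)) => //= xc; case: (boolP (x == ord0)) => //= x0; rewrite ?andbF //.
  rewrite andbT branches_lower //.
case: ifP => c0.
  rewrite (big_pred1 ord0) => [|x]; first by rewrite lower0 branches_lower0.
  by rewrite /=; case: eqP => [->|]; rewrite ?c0 ?andbF.
by rewrite big1 // => x /andP[xc /eqP x0]; rewrite x0 c0 in xc.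
Qed.

(** Expansions at vertices other than 0 cancel in pairs, and so does the one at 0 if 0 is
    expandable. If 0 is in the core but not expandable, only the expansion of the merged vertex is
    present, and it equals the graph: this is the coefficient 1 on the right. *)
Lemma noncore_cancel_first : (2 < valence (E, ls) one)%N ->
  \sum_(x in expandable (E, ls)) expanded_contraction c x ord0 one (es, ls) +
    hQ (contraction ord0 one (es, ls)) =
  (\sum_(x in c | x \notin expandable (E, ls)) edge_degree (~: c) x (ord0, one))%:R
    *: graph_class (E, ls).
Proof.
move=> val1; rewrite contraction_first hQE /expansion sum_expandable_lower //.
set f := fun y => graph_class (expand y g').
set N := \sum_(x in c | _) _.
rewrite (bigID (fun x => x == ord0)) /= addrA -[_ + _ + \sum_(x in _ | _) f _]addrA.
rewrite -big_split /= [X in _ + X + _]big1 => [|x /andP[]]; last first.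
  by rewrite inE => /andP[xc _] x0; rewrite /f expanded_contraction_away // addNr.
rewrite addr0.
have ed x : x \in c -> edge_degree (~: c) x (ord0, one) = (x == ord0).
  move=> xc; rewrite /edge_degree /= !inE c1 andbT !(eq_sym _ x).
  by rewrite (negPf (core_neq1 xc)) addn0.
have NE : N = ((ord0 \in c) && (ord0 \notin expandable (E, ls)))%N.
  rewrite /N; case: (boolP (_ && _)) => [/andP[c0 ex0]|].
    rewrite (bigD1 ord0) ?c0 //= ed // big1 ?addn0 // => x /andP[/andP[xc _] /negPf x0].
    by rewrite ed // x0.
  rewrite negb_and => c0; rewrite big1 // => x /andP[xc xe]; rewrite ed //.
  by case: eqP xc xe c0 => // -> -> ->.
rewrite NE; case: (boolP (ord0 \in c)) => c0 /=; last first.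
  by rewrite scale0r addr0 big1 // => x /andP[]; rewrite inE => /andP[xc _] /eqP x0;
    rewrite x0 /= (negPf c0) in xc.
case: (boolP (ord0 \in expandable _)) => ex0 /=.
  rewrite scale0r (big_pred1 ord0) => [|x]; last by rewrite /=; case: eqP => [->|]; rewrite ?ex0 ?andbF.
  by rewrite expanded_contraction_at // addNr.
rewrite scale1r big1 => [|x /andP[xe /eqP x0]]; last by rewrite x0 (negPf ex0) in xe.
rewrite add0r; apply: expand_first_branch => //.
by move: ex0; rewrite inE /= c0 /= -leqNgt.
Qed.

End FirstEdge.
End ExpansionContraction.

(** * The anticommutator of expansion and boundary *)

Section Laplacian.
Variables (F : fieldType) (V : lmodType F).
Local Notation gr n := (graph V n).

Lemma expand_end_neq n (c : {set 'I_n}) x i j :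
  (expand_end c x i j != expand_end c x j i) = (i != j).
Proof.
apply/idP/idP; apply: contraNneq; first by move=> ->.
by move/(congr1 (collapse x)); rewrite !collapse_expand_end => ->.
Qed.

Lemma expanded_contraction_map n (s : 'S_n.+1) (c : {set 'I_n.+1}) x i j (g : gr n.+1) :
  i != j ->
  expanded_contraction (s @: c) (s x) (s i) (s j) (map_vertices s g) =
    (-1) ^+ s *: expanded_contraction c x i j g.
Proof.
move=> ij; pose t := lift_perm ord0 ord0 s; have s_inj := @perm_inj _ s.
have t0 : t ord0 = ord0 by rewrite /t lift_perm_id.
have tl v : t (lift ord0 v) = lift ord0 (s v) by rewrite /t lift_perm_lift.
have ee a b : expand_end (s @: c) (s x) (s a) (s b) = t (expand_end c x a b).
  by rewrite /expand_end (inj_eq s_inj) mem_imset //; case: ifP.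
have -> : (-1) ^+ s = (-1) ^+ t :> F by rewrite /t odd_lift_perm.
rewrite /expanded_contraction -contraction_map ?expand_end_neq // !ee; congr contraction.
rewrite -[LHS]map_vertices_id; symmetry; apply: map_expand => // v.
by rewrite (inj_eq s_inj); case: ifP.
Qed.

Lemma expanded_contractionC n (c : {set 'I_n.+1}) x i j (g : gr n.+1) : i != j ->
  expanded_contraction c x j i g = - expanded_contraction c x i j g.
Proof. by move=> ij; apply: contractionC; rewrite expand_end_neq. Qed.

(** A loop gives its vertex degree two within the singleton. *)
Lemma loop_core (T : finType) (es : seq (T * T)) v : (v, v) \in es -> v \in core es.
Proof.
move=> ve; apply: (subsetP (core_max (_ : core_set es [set v]))); last by rewrite inE.
apply/core_setP => u; rewrite inE => /eqP ->.
rewrite (degree_in_perm _ _ (perm_to_rem ve)) degree_in_cons /edge_degree /= eqxx inE eqxx.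
by [].
Qed.

Lemma degree_in_map_perm n (s : 'S_n) es (U : {set 'I_n}) v :
  degree_in (map_edges s es) (s @: U) (s v) = degree_in es U v.
Proof.
rewrite degree_in_map_fiber1 => [|u /perm_inj //].
by rewrite preim_imset_inj //; apply: perm_inj.
Qed.

Lemma valence_map n (s : 'S_n) (g : gr n) v : valence (map_vertices s g) (s v) = valence g v.
Proof.
have s_inj := @perm_inj _ s.
rewrite /valence /= !count_map; do 2?congr (_ + _)%N;
  by apply: eq_count => e /=; rewrite (inj_eq s_inj).
Qed.

Lemma valence_reverse n i j es (ls : seq ('I_n * V)) v :
  valence ((j, i) :: es, ls) v = valence ((i, j) :: es, ls) v.
Proof. by rewrite !valenceE /= degree_in_reverse. Qed.

Lemma edge_degreeC (T : finType) (U : {set T}) v i j :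
  edge_degree U v (j, i) = edge_degree U v (i, j).
Proof. by rewrite /edge_degree addnC. Qed.

Section NoncoreEdge.
Variables (n : nat).
Implicit Types (es : seq ('I_n.+2 * 'I_n.+2)) (ls : seq ('I_n.+2 * V)).

(** The contribution of one edge to d h + h d. For an edge outside the core the coefficient is 1 if
    the edge is the only branch of a core vertex, and 0 otherwise. *)
Definition noncore_identity i j es ls : Prop :=
  let g := ((i, j) :: es, ls) in let c := core (edges g) in
  \sum_(x in expandable g) expanded_contraction c x i j (es, ls) +
    hQ (contraction i j (es, ls)) =
  (\sum_(x in c | x \notin expandable g) edge_degree (~: c) x (i, j))%:R *: graph_class g.

Lemma noncore_identity_map (s : 'S_n.+2) i j es ls : i != j ->
  noncore_identity (s i) (s j) (map_edges s es) [seq (s l.1, l.2) | l <- ls] ->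
  noncore_identity i j es ls.
Proof.
move=> ij; rewrite /noncore_identity /=.
set g := ((i, j) :: es, ls); set c := core ((i, j) :: es).
have gE : ((s i, s j) :: map_edges s es, [seq (s l.1, l.2) | l <- ls]) = map_vertices s g by [].
have cE : core ((s i, s j) :: map_edges s es) = s @: c.
  exact: (core_map_inj ((i, j) :: es) (@perm_inj _ s)).
have mE : (map_edges s es, [seq (s l.1, l.2) | l <- ls]) = map_vertices s (es, ls) by [].
have nE : \sum_(x in s @: c | x \notin expandable (map_vertices s g))
    edge_degree (~: (s @: c)) x (s i, s j) =
  \sum_(x in c | x \notin expandable g) edge_degree (~: c) x (i, j).
  rewrite (reindex_inj (@perm_inj _ s)) /=; apply: eq_big => x.
    by rewrite expandable_map (mem_imset _ _ (@perm_inj _ s)).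
  move=> _; have := degree_in_map_perm s [:: (i, j)] (~: c) x.
  rewrite /degree_in !big_seq1 /= => <-; congr edge_degree.
  by apply/setP => u; rewrite -[u](permKV s) !inE !mem_imset ?inE //; apply: perm_inj.
rewrite gE cE mE nE graph_class_map (reindex_inj (@perm_inj _ s)) /=.
under eq_bigl do rewrite expandable_map.
under eq_bigr do rewrite expanded_contraction_map //.
rewrite -scaler_sumr contraction_map // [hQ (_ *: _)]linearZ -scalerDr.
rewrite scalerA mulrC -scalerA => /scalerI; apply.
by rewrite signr_eq0.
Qed.

Lemma noncore_identityC i j es ls : i != j ->
  noncore_identity j i es ls -> noncore_identity i j es ls.
Proof.
move=> ij; rewrite /noncore_identity /= core_reverse; set c := core ((i, j) :: es).
have eE : expandable ((j, i) :: es, ls) = expandable ((i, j) :: es, ls).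
  by apply/setP => x; rewrite !inE /branches /= core_reverse degree_in_reverse.
rewrite eE graph_class_reverse contractionC // linearN.
under eq_bigr do rewrite expanded_contractionC //.
under [X in X%:R]eq_bigr do rewrite edge_degreeC.
by rewrite sumrN -opprD scalerN => /oppr_inj.
Qed.

(** Both sides change by the same sign under reversal and under renumbering, so [j] may be taken
    outside the core and the edge put from 0 to 1. *)
Lemma noncore_cancel i j es ls : (forall v, 2 < valence ((i, j) :: es, ls) v)%N ->
  ~~ ((i \in core ((i, j) :: es)) && (j \in core ((i, j) :: es))) ->
  noncore_identity i j es ls.
Proof.
wlog jc : i j / j \notin core ((i, j) :: es) => [hw adm|adm _].
  rewrite negb_and orbC; case: (boolP (j \in _)) => /= jc ic; first last.
    by apply: hw => //; rewrite (negPf jc) andbF.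
  have ij : i != j by apply: contraNneq ic => ->; apply: loop_core; rewrite inE eqxx.
  apply: noncore_identityC => //; apply: hw.
  - by rewrite core_reverse.
  - by move=> v; rewrite valence_reverse.
  - by rewrite core_reverse (negPf ic) andbF.
have ij : i != j.
  by apply: contraNneq jc => ->; apply: loop_core; rewrite inE eqxx.
have [s si sj] := place_first ij.
apply: (noncore_identity_map (s := s)) => //; rewrite si sj.
have cE : core ((ord0, ord1S n) :: map_edges s es) = s @: core ((i, j) :: es).
  have := core_map_inj ((i, j) :: es) (@perm_inj _ s).
  by rewrite /map_edges /= si sj.
apply: noncore_cancel_first; first by rewrite cE -sj mem_imset //; apply: perm_inj.
have := valence_map s ((i, j) :: es, ls) j; rewrite /map_vertices /= si sj => ->.
exact: adm.
Qed.

End NoncoreEdge.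

(** The merged vertex comes first, so the result is [g] with [x] moved to the front by [t]; the sign
    of the contraction is that of [t] as well. *)
Lemma contract_new_edge n (c : {set 'I_n.+2}) (x : 'I_n.+2) (g : gr n.+2) :
  contraction ord0 (lift ord0 x)
    (map (expand_edge c x) (edges g), map (expand_leaf x) (leaves g)) = graph_class g.
Proof.
pose t : 'S_n.+2 := lift_perm x ord0 1; pose s := lift_perm ord0 ord0 t.
have s0 : s ord0 = ord0 by rewrite /s lift_perm_id.
have s1 : s (lift ord0 x) = ord1S n.+1 by rewrite /s lift_perm_lift /t lift_perm_id.
rewrite (contractionE _ s0 s1) map_vertices_comp.
have -> : (-1) ^+ s = (-1) ^+ t :> F by rewrite /s odd_lift_perm.
apply: (scalerI (a := (-1) ^+ t)); first by rewrite signr_eq0.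
rewrite sgrM2 -graph_class_map; congr graph_class.
have ltE v : lower (s v) = t (collapse x v).
  case: (unliftP ord0 v) => [w|] ->; first by rewrite /s lift_perm_lift lower_lift collapse_lift.
  by rewrite s0 lower0 collapse0 /t lift_perm_id.
congr (_, _); rewrite /= -map_comp; apply: eq_map => e /=.
  by rewrite !ltE !collapse_expand_end.
rewrite ltE; congr (t _, _); case: ifP => [/eqP ->|_]; first by rewrite collapse0.
by rewrite collapse_lift.
Qed.

Lemma boundary_expand n (x : 'I_n.+2) (g : gr n.+2) :
  boundary_fun (expand x g) = graph_class g +
    \sum_(e <- edges g | e.1 != e.2)
       expanded_contraction (core (edges g)) x e.1 e.2 (rem e (edges g), leaves g).
Proof.
case: g => es ls; rewrite boundary_fun_cons /= [contraction _ _ _](contract_new_edge _ _ (es, ls)) big_map; congr (_ + _).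
under eq_bigl do rewrite /= expand_end_neq.
rewrite big_seq_cond [RHS]big_seq_cond; apply: eq_bigr => e /andP[ees _].
by apply: contraction_perm => //; rewrite perm_cons; apply: rem_map.
Qed.

Definition core_edge n (g : gr n) (e : 'I_n * 'I_n) :=
  (e.1 \in core (edges g)) && (e.2 \in core (edges g)).

Definition edge_terms n (g : gr n.+2) (e : 'I_n.+2 * 'I_n.+2) : graph_space V n.+2 :=
  \sum_(x in expandable g)
     expanded_contraction (core (edges g)) x e.1 e.2 (rem e (edges g), leaves g) +
  hQ (contraction e.1 e.2 (rem e (edges g), leaves g)).

(* The number of core vertices carrying anything but hairs or carrying several
   hairs, provided that g is admissible. *)
Definition tree_number n (g : gr n) : nat :=
  (#|expandable g| + \sum_(x in core (edges g) | x \notin expandable g)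
      degree_in (edges g) (~: core (edges g)) x)%N.

(** The new edges give one copy of [g] per expandable vertex. The remaining terms of d h and those
    of h d are collected by the contracted edge: non-core edges supply the rest of [tree_number],
    core edges form the remainder. *)
Lemma laplacian n (g : gr n.+2) : admissible g ->
  dQ (hQ (graph_class g)) + hQ (dQ (graph_class g)) =
  (tree_number g)%:R *: graph_class g +
    \sum_(e <- edges g | (e.1 != e.2) && core_edge g e) edge_terms g e.
Proof.
move=> /forallP adm; rewrite hQE dQE linear_sum /=.
under eq_bigr do rewrite dQE boundary_expand.
rewrite big_split /= sumr_const exchange_big /= /boundary_fun linear_sum /= -addrA -big_split /=.
rewrite (bigID (core_edge g)) /= addrCA [LHS]addrC; congr (_ + _).
rewrite /tree_number natrD scalerDl scaler_nat; congr (_ + _).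
case: g adm => es ls /= adm.
have termE e : e \in es -> ~~ core_edge (es, ls) e ->
    edge_terms (es, ls) e = (\sum_(x in core es | x \notin expandable (es, ls))
      edge_degree (~: core es) x e)%:R *: graph_class (es, ls).
  move=> ees nce; have E := perm_to_rem ees.
  have := @noncore_cancel n e.1 e.2 (rem e es) ls; rewrite /noncore_identity /=.
  rewrite -surjective_pairing -(core_perm E) -(graph_class_perm E (perm_refl ls)).
  have -> : expandable (e :: rem e es, ls) = expandable (es, ls).
    by apply/setP => x; rewrite !inE /= -(core_perm E) -(branches_perm x E (perm_refl ls)).
  apply=> // v; have := adm v; rewrite !valenceE /= (degree_in_perm _ _ E).
  by [].
(* The count may run over all edges: core edges contribute 0 to it, and loops are core edges. *)
have -> : \sum_(e <- es | (e.1 != e.2) && ~~ core_edge (es, ls) e) edge_terms (es, ls) e =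
    \sum_(e <- es) (\sum_(x in core es | x \notin expandable (es, ls))
      edge_degree (~: core es) x e)%:R *: graph_class (es, ls).
  rewrite big_mkcond big_seq [RHS]big_seq; apply: eq_bigr => e ees.
  case: (boolP (core_edge _ e)) => [/andP[/= c1 c2]|nce].
    rewrite andbF big1 ?scale0r // => x _.
    by rewrite /edge_degree !inE c1 c2 !andbF.
  rewrite andbT -termE //; case: eqP => // e12.
  case/negP: nce; rewrite /core_edge /= -e12 andbb; apply: loop_core.
  by rewrite {2}e12 -surjective_pairing.
by rewrite -scaler_suml -natr_sum exchange_big.
Qed.

End Laplacian.

(** * The square of the boundary *)

Section BoundarySquare.
Variables (F : fieldType) (V : lmodType F).
Local Notation gr n := (graph V n).

Lemma place3 n (i j k : 'I_n.+3) : i != j -> i != k -> j != k ->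
  exists s : 'S_n.+3, [/\ s i = ord0, s j = lift ord0 ord0 &
    s k = lift ord0 (lift ord0 ord0)].
Proof.
case: (unliftP i j) => [j' ->|->]; last by rewrite eqxx.
case: (unliftP i k) => [k' ->|->]; last by rewrite eqxx.
rewrite (inj_eq (@lift_inj _ i)) => _ _ /place_first[s sj sk].
by exists (lift_perm i ord0 s); rewrite lift_perm_id !lift_perm_lift sj sk.
Qed.

Lemma place4 n (i j k l : 'I_n.+4) : uniq [:: i; j; k; l] ->
  exists s : 'S_n.+4, [/\ s i = ord0, s j = lift ord0 ord0,
    s k = lift ord0 (lift ord0 ord0) & s l = lift ord0 (lift ord0 (lift ord0 ord0))].
Proof.
rewrite /= !inE !negb_or => /and4P[/and3P[ij ik il] /andP[jk jl] kl _].
case: (unliftP i j) ij jk jl => [j' ->|->]; last by rewrite eqxx.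
case: (unliftP i k) ik kl => [k' ->|->]; last by rewrite eqxx.
case: (unliftP i l) il => [l' ->|->]; last by rewrite eqxx.
rewrite !(inj_eq (@lift_inj _ i)) => _ _ kl _ jk jl.
have [s [sj sk sl]] := place3 jk jl kl.
by exists (lift_perm i ord0 s); rewrite lift_perm_id !lift_perm_lift sj sk sl.
Qed.

Lemma contract_vertex_inj n (i j u v : 'I_n.+2) : i != j ->
  contract_vertex i j u = contract_vertex i j v ->
  u = v \/ (u \in [set i; j]) && (v \in [set i; j]).
Proof.
move=> ij; case: (unliftP i j) ij => [k ->|->]; last by rewrite eqxx.
move=> _; rewrite !front_contract => /lower_inj[/perm_inj->|]; first by left.
have fi : front i k i = ord0 by rewrite /front lift_perm_id.
have fk : front i k (lift i k) = ord1S n by rewrite /front lift_perm_lift lift_perm_id.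
by rewrite !in_set2 -fi -fk !(inj_eq (@perm_inj _ _)); right.
Qed.

Lemma contract_vertexC n (i j : 'I_n.+2) : contract_vertex i j =1 contract_vertex j i.
Proof. by move=> v; rewrite /contract_vertex orbC subnAC. Qed.

Lemma contract_vertex_eq n (i j : 'I_n.+2) : contract_vertex i j i = contract_vertex i j j.
Proof. by rewrite /contract_vertex !eqxx orbT. Qed.

(** The edge from [i] to [j] is contracted first, then the image of the edge from [k] to [l]; [g]
    contains neither. *)
Definition contraction2 n (i j k l : 'I_n.+3) (g : gr n.+3) : graph_space V n.+1 :=
  (-1) ^+ contract_sign i j *:
    contraction (contract_vertex i j k) (contract_vertex i j l)
      (map_vertices (contract_vertex i j) g).

Lemma contraction2_perm n (i j k l : 'I_n.+3) es es' ls : perm_eq es es' ->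
  contraction2 i j k l (es, ls) = contraction2 i j k l (es', ls).
Proof. by move=> E; congr (_ *: _); apply: contraction_perm => //; apply: perm_map. Qed.

Lemma contraction2Cl n (i j k l : 'I_n.+3) (g : gr n.+3) : i != j ->
  contraction2 j i k l g = - contraction2 i j k l g.
Proof.
move=> ij; rewrite /contraction2 -scaleNr !(contract_vertexC j i).
rewrite (eq_map_vertices _ (contract_vertexC j i)); congr (_ *: _).
rewrite -[RHS]mulN1r -exprS -signr_odd -[RHS]signr_odd /contract_sign; congr (_ ^+ _).
rewrite /= !oddD !oddb; case: ltngtP ij => [ij|ij|/val_inj ->]; rewrite ?eqxx //.
  by case: (odd i); case: (odd j).
by case: (odd i); case: (odd j).
Qed.

Lemma contraction2Cr n (i j k l : 'I_n.+3) (g : gr n.+3) :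
  contract_vertex i j k != contract_vertex i j l ->
  contraction2 i j l k g = - contraction2 i j k l g.
Proof. by move=> kl; rewrite /contraction2 contractionC // scalerN. Qed.

Lemma contraction2E n (i j k l : 'I_n.+3) (s : 'S_n.+3) (t : 'S_n.+2) (g : gr n.+3) :
  s i = ord0 -> s j = ord1S n.+1 -> t (lower (s k)) = ord0 -> t (lower (s l)) = ord1S n ->
  contraction2 i j k l g = (-1) ^+ (s (+) t) *:
    graph_class (map_vertices (fun v => lower (t (lower (s v)))) g).
Proof.
move=> si sj tk tl; have [r cE signE] := contract_renumber F si sj.
rewrite /contraction2 signE !cE (eq_map_vertices _ cE).
have kl : lower (s k) != lower (s l).
  by apply/eqP => kl; move: tl; rewrite -kl tk => /eqP; rewrite (negPf (neq_lift _ _)).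
rewrite -(map_vertices_comp (fun v => lower (s v)) r) contraction_map // scalerA.
rewrite -mulrA -expr2 sqrr_sign mulr1 (contractionE _ tk tl) scalerA -signr_addb.
by rewrite !map_vertices_comp.
Qed.

Lemma ord_cases n (w : 'I_n.+4) :
  [\/ w \in [:: ord0; lift ord0 ord0], w \in [:: lift ord0 (lift ord0 ord0);
      lift ord0 (lift ord0 (lift ord0 ord0))]
    | exists m, w = lift ord0 (lift ord0 (lift ord0 (lift ord0 m)))].
Proof.
case: (unliftP ord0 w) => [w1|] ->; last by constructor 1; rewrite inE eqxx.
case: (unliftP ord0 w1) => [w2|] ->; last by constructor 1; rewrite !inE eqxx orbT.
case: (unliftP ord0 w2) => [w3|] ->; last by constructor 2; rewrite inE eqxx.
case: (unliftP ord0 w3) => [m|] ->; last by constructor 2; rewrite !inE eqxx orbT.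
by constructor 3; exists m.
Qed.

(** Exchanging the two edges is an even permutation of their four ends. The sign arises because the
    two merged vertices end up in the opposite order. *)
Lemma contraction2_disjoint n (i j k l : 'I_n.+3) (g : gr n.+3) :
  uniq [:: i; j; k; l] -> contraction2 k l i j g = - contraction2 i j k l g.
Proof.
case: n i j k l g => [|n] i j k l g ijkl.
  by have := uniq_leq_size ijkl (fun x _ => mem_enum 'I_3 x); rewrite size_enum_ord.
have [s [si sj sk sl]] := place4 ijkl.
pose a0 : 'I_n.+3 := ord0; pose a1 : 'I_n.+3 := ord1S n.+1.
pose a2 : 'I_n.+3 := lift ord0 (lift ord0 ord0).
pose t := (tperm a0 a1 * tperm a1 a2)%g.
have t0 : t a0 = a2 by rewrite permM tpermL tpermL.
have t1 : t a1 = a0 by rewrite permM tpermR tpermD.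
have t2 : t a2 = a1 by rewrite permM [tperm a0 a1 a2]tpermD // tpermR.
have tk m : t (lift ord0 (lift ord0 (lift ord0 m))) = lift ord0 (lift ord0 (lift ord0 m)).
  by rewrite permM [tperm a0 a1 _]tpermD // tpermD.
have todd : t = false :> bool by rewrite odd_permM !odd_tperm.
pose b0 : 'I_n.+4 := ord0; pose b1 : 'I_n.+4 := lift ord0 ord0.
pose b2 : 'I_n.+4 := lift ord0 (lift ord0 ord0).
pose b3 : 'I_n.+4 := lift ord0 (lift ord0 (lift ord0 ord0)).
pose d := (tperm b0 b2 * tperm b1 b3)%g.
have d0 : d b0 = b2 by rewrite permM tpermL tpermD.
have d1 : d b1 = b3 by rewrite permM [tperm b0 b2 b1]tpermD // tpermL.
have d2 : d b2 = b0 by rewrite permM tpermR tpermD.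
have d3 : d b3 = b1 by rewrite permM [tperm b0 b2 b3]tpermD // tpermR.
have dk m : d (lift ord0 (lift ord0 (lift ord0 (lift ord0 m)))) =
    lift ord0 (lift ord0 (lift ord0 (lift ord0 m))).
  by rewrite permM [tperm b0 b2 _]tpermD // tpermD.
have dodd : d = false :> bool by rewrite odd_permM !odd_tperm.
pose u := tperm (ord0 : 'I_n.+2) (ord1S n).
have u1 : u = true :> bool by rewrite odd_tperm neq_lift.
rewrite (@contraction2E _ i j k l s t) ?sk ?sl ?lower_lift ?[t _]t1 ?[t _]t2 //.
rewrite (@contraction2E _ k l i j (s * d)%g t) ?(permM s d) ?si ?sj ?sk ?sl ?[d _]d0
  ?[d _]d1 ?[d _]d2 ?[d _]d3 ?lower_lift ?[t _]t1 ?[t _]t2 //.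
rewrite odd_permM dodd addbF -scalerN; congr (_ *: _).
rewrite -[RHS]scaleN1r -[-1]/((-1) ^+ true) -u1 -graph_class_map map_vertices_comp.
congr graph_class; apply: eq_map_vertices => v; rewrite (permM s d) /=.
case: (ord_cases (s v)) => [|| [m ->]]; rewrite ?inE.
- case/orP => /eqP ->; first by rewrite d0 !lower_lift lower0 t0 t1 lower_lift tpermR lower0.
  by rewrite d1 !lower_lift t0 t2 !lower_lift tpermR.
- case/orP => /eqP ->; first by rewrite d2 !lower_lift lower0 t0 t1 lower_lift lower0 tpermL.
  by rewrite d3 !lower_lift t0 t2 !lower_lift tpermL.
- by rewrite dk !lower_lift tk lower_lift tpermD.
Qed.

(** The three vertices of the path are permuted cyclically, which is even. In the second order,
    however, the last edge points towards the merged vertex, which comes first, and one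
    transposition is needed. *)
Lemma contraction2_adjacent n (i j l : 'I_n.+3) (g : gr n.+3) :
  i != j -> i != l -> j != l -> contraction2 j l i j g = - contraction2 i j j l g.
Proof.
move=> ij il jl; have [s [si sj sl]] := place3 ij il jl.
pose a0 : 'I_n.+3 := ord0; pose a1 : 'I_n.+3 := ord1S n.+1.
pose a2 : 'I_n.+3 := lift ord0 (lift ord0 ord0).
pose d := (tperm a0 a1 * tperm a1 a2)%g.
have d0 : d a0 = a2 by rewrite permM tpermL tpermL.
have d1 : d a1 = a0 by rewrite permM tpermR tpermD.
have d2 : d a2 = a1 by rewrite permM [tperm a0 a1 a2]tpermD // tpermR.
have dk m : d (lift ord0 (lift ord0 (lift ord0 m))) = lift ord0 (lift ord0 (lift ord0 m)).
  by rewrite permM [tperm a0 a1 _]tpermD // tpermD.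
have dodd : d = false :> bool by rewrite odd_permM !odd_tperm.
pose u := tperm (ord0 : 'I_n.+2) (ord1S n).
have u1 : u = true :> bool by rewrite odd_tperm neq_lift.
rewrite (@contraction2E _ i j j l s 1%g) ?perm1 ?sj ?sl ?lower_lift //.
have ua0 : u ord0 = ord1S n by rewrite tpermL.
have ua1 : u (ord1S n) = ord0 by rewrite tpermR.
rewrite (@contraction2E _ j l i j (s * d)%g u) ?(permM s d) ?si ?sj ?sl ?[d _]d0 ?[d _]d1
  ?[d _]d2 ?lower_lift ?lower0 ?[u _]ua0 ?[u _]ua1 //.
rewrite odd_permM dodd addbF u1 addbT odd_perm1 addbF signrN scaleNr.
congr (- (_ *: graph_class _)); apply: eq_map_vertices => v; rewrite (permM s d) perm1 /=.
case: (unliftP ord0 (s v)) => [w|] ->; last by rewrite d0 !lower_lift lower0 tpermR !lower0.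
case: (unliftP ord0 w) => [w'|] ->; last by rewrite d1 lower0 !lower_lift tpermL lower_lift lower0.
case: (unliftP ord0 w') => [m|] ->; last by rewrite d2 !lower_lift tpermL lower_lift.
by rewrite dk !lower_lift tpermD // lower_lift.
Qed.

Lemma contract_vertex_neq n (i j k l : 'I_n.+2) : i != j ->
  (contract_vertex i j k != contract_vertex i j l) =
  (k != l) && ~~ ((k \in [set i; j]) && (l \in [set i; j])).
Proof.
move=> ij; rewrite -negb_or; congr negb; apply/eqP/orP => [/(contract_vertex_inj ij)[->|]|].
- by left.
- by right.
case=> [/eqP-> //|]; rewrite !inE => /andP[/orP[] /eqP-> /orP[] /eqP-> //];
  by rewrite contract_vertex_eq.
Qed.

(** Up to reversals of the edges, each costing the same sign on both sides, two edges that can be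
    contracted in succession are disjoint or form a path. *)
Lemma contraction2_swap n (i j k l : 'I_n.+3) (g : gr n.+3) : i != j ->
  contract_vertex i j k != contract_vertex i j l ->
  contraction2 k l i j g = - contraction2 i j k l g.
Proof.
move=> ij; have neq p q r : p != q -> p != r -> q != r ->
    contract_vertex p q p != contract_vertex p q r.
  move=> pq pr qr; rewrite contract_vertex_neq // pr !in_set2 eqxx /= !(eq_sym r).
  by rewrite (negPf pr) (negPf qr).
have common_first l' : i != l' -> j != l' -> contraction2 i l' i j g = - contraction2 i j i l' g.
  move=> il jl; rewrite -[RHS]contraction2Cl //.
  have jl' : j != l' by []; have ji : j != i by rewrite eq_sym.
  rewrite -[LHS]opprK -contraction2Cr; last by apply: neq => //; rewrite eq_sym.
  by rewrite (contraction2_adjacent _ ji jl' il) opprK.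
rewrite contract_vertex_neq // => /andP[kl]; rewrite !in_set2.
case: (k =P i) kl => [->|/eqP ki] kl /=.
  rewrite eq_sym (negPf kl) /= => lj; apply: common_first => //.
  by rewrite eq_sym.
case: (k =P j) kl => [->|/eqP kj] kl /=.
  rewrite [l == j]eq_sym (negPf kl) orbF => li.
  by apply: contraction2_adjacent => //; rewrite eq_sym.
move=> _; case: (l =P j) kl => [->|/eqP lj] kl.
  rewrite contraction2Cl 1?eq_sym // (contraction2_adjacent _ ij) 1?eq_sym // opprK.
  rewrite -contraction2Cr //.
  rewrite (contract_vertex_neq _ _ ij) kj !in_set2 (negPf ki) (negPf kj).
  by [].
case: (l =P i) kl => [->|/eqP li] kl.
  rewrite contraction2Cl 1?eq_sym // common_first 1?eq_sym // opprK -contraction2Cr //.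
  by rewrite (contract_vertex_neq _ _ ij) ki !in_set2 (negPf ki) (negPf kj).
apply: contraction2_disjoint; rewrite /= !inE !negb_or ij kl.
by rewrite (eq_sym i k) ki (eq_sym i l) li (eq_sym j k) kj (eq_sym j l) lj.
Qed.

Lemma dQ_contraction n (i j : 'I_n.+3) es ls :
  dQ (contraction i j (es, ls)) =
  \sum_(f <- es | contract_vertex i j f.1 != contract_vertex i j f.2)
     contraction2 i j f.1 f.2 (rem f es, ls).
Proof.
rewrite /contraction linearZ /= dQE /boundary_fun /= big_map scaler_sumr.
rewrite big_seq_cond [RHS]big_seq_cond; apply: eq_bigr => f /andP[fes _].
congr (_ *: _); apply: contraction_perm => //.
exact: (rem_map (fun e => (contract_vertex i j e.1, contract_vertex i j e.2))).
Qed.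

Lemma sum_rem (T : eqType) (M : zmodType) (x : T) s (f : T -> M) : x \in s ->
  \sum_(y <- rem x s) f y = \sum_(y <- s) f y - f x.
Proof. by move=> xs; rewrite [in RHS](perm_big _ (perm_to_rem xs)) big_cons addrAC subrr add0r. Qed.

(** Pairs of distinct occurrences are all pairs minus the diagonal. Occurrences are needed here
    since parallel edges may be equal as pairs. *)
Lemma exchange_big_rem (T : eqType) (M : zmodType) s (f : T -> T -> M) :
  \sum_(x <- s) \sum_(y <- rem x s) f x y = \sum_(x <- s) \sum_(y <- rem x s) f y x.
Proof.
rewrite big_seq [RHS]big_seq.
rewrite (eq_bigr (fun x => \sum_(y <- s) f x y - f x x)); last by move=> x; apply: sum_rem.
rewrite [RHS](eq_bigr (fun x => \sum_(y <- s) f y x - f x x)); last first.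
  by move=> x xs; apply: (sum_rem (fun y => f y x)).
by rewrite -!big_seq !sumrB exchange_big.
Qed.

Lemma rem_remC (T : eqType) (x y : T) s : perm_eq (rem x (rem y s)) (rem y (rem x s)).
Proof.
case: (eqVneq x y) => [-> //|xy].
have mem_rem_neq u v : u != v -> (u \in rem v s) = (u \in s).
  move=> uv; rewrite -!has_pred1 !has_count count_rem /= eq_sym (negPf uv) andbF.
  by rewrite subn0.
apply/allP => z _ /=; apply/eqP; rewrite !count_rem !mem_rem_neq //.
  by rewrite subnAC.
by rewrite eq_sym.
Qed.

Hypothesis char0 : [pchar F] =i pred0.

Lemma opp_eq0 (M : lmodType F) (x : M) : x = - x -> x = 0.
Proof.
move=> xE; have : 2%:R *: x = 0 by rewrite scaler_nat mulr2n {2}xE subrr.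
by move/eqP; rewrite scaler_eq0 (negPf (natr_neq0 char0 _)) // => /eqP.
Qed.

(** The sum over ordered pairs of edges is antisymmetric in the order of contraction, hence equal to
    its own negative. *)
Lemma dQ_dQ n (x : graph_space V n.+3) : dQ (dQ x) = 0.
Proof.
apply: (presented_ext (f := @dQ F V n.+1 \o @dQ F V n.+2) (g := \0)) => -[es ls] /=.
rewrite -/(graph_class (es, ls)) dQE /boundary_fun linear_sum /=; apply: opp_eq0.
pose T (e f : 'I_n.+3 * 'I_n.+3) : graph_space V n.+1 :=
  if (e.1 != e.2) && (contract_vertex e.1 e.2 f.1 != contract_vertex e.1 e.2 f.2)
  then contraction2 e.1 e.2 f.1 f.2 (rem f (rem e es), ls) else 0.
have -> : \sum_(e <- es | e.1 != e.2) dQ (contraction e.1 e.2 (rem e es, ls)) =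
    \sum_(e <- es) \sum_(f <- rem e es) T e f.
  rewrite big_mkcond; apply: eq_bigr => e _; rewrite /T.
  case: ifP => ne /=; last by rewrite big1.
  by rewrite dQ_contraction big_mkcond.
rewrite [LHS]exchange_big_rem -[RHS]sumrN. apply: eq_bigr => e _.
rewrite -[RHS]sumrN; apply: eq_bigr => f _; rewrite /T.
have condE (a b : 'I_n.+3 * 'I_n.+3) :
  (a.1 != a.2) && (contract_vertex a.1 a.2 b.1 != contract_vertex a.1 a.2 b.2) =
  [&& a.1 != a.2, b.1 != b.2 & ~~ ((b.1 \in [set a.1; a.2]) && (b.2 \in [set a.1; a.2]))].
  by case: (boolP (a.1 != a.2)) => //= /contract_vertex_neq ->.
(* Contractibility in succession is symmetric: neither edge is a loop and the two are not
   parallel. *)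
have -> : (f.1 != f.2) && (contract_vertex f.1 f.2 e.1 != contract_vertex f.1 f.2 e.2) =
    (e.1 != e.2) && (contract_vertex e.1 e.2 f.1 != contract_vertex e.1 e.2 f.2).
  rewrite !condE !in_set2 andbCA.
  case: (boolP (e.1 != e.2)) => //= e12; case: (boolP (f.1 != f.2)) => //= f12.
  congr negb; apply/andP/andP => -[/orP[] /eqP E1 /orP[] /eqP E2]; move: e12 f12;
    by rewrite ?E1 ?E2 ?eqxx ?orbT.
case: ifP => [/andP[ne nf]|_]; last by rewrite oppr0.
apply: (etrans (contraction2_swap _ ne nf)).
by rewrite (contraction2_perm _ _ _ _ _ (rem_remC f e es)).
Qed.

End BoundarySquare.

(** * Graphs of rank one *)

Section GoodGraphs.
Variables (F : fieldType) (V : lmodType F).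
Local Notation gr n := (graph V n).

Definition unicyclic n (g : gr n) := [&& admissible g, connected g & has_rank 1 g].

(** Stated without [tree_number] so that it can be checked directly on contractions and expansions;
    positivity of [tree_number] is derived from it for unicyclic graphs. *)
Definition bulky n (g : gr n) :=
  (core (edges g) != setT) || [exists v, 1 < count (fun l => l.1 == v) (leaves g)]%N.

Lemma valence_perm n es es' (ls : seq ('I_n * V)) v :
  perm_eq es es' -> valence (es, ls) v = valence (es', ls) v.
Proof. by move=> E; rewrite !valenceE /= (degree_in_perm _ _ E). Qed.

Lemma adjacent_sym n (g : gr n) : symmetric (adjacent g).
Proof. by move=> u v; rewrite /adjacent /= orbC. Qed.

Lemma connectedP n (g : gr n.+1) :
  reflect (forall u v, connect (adjacent g) u v) (connected g).
Proof. by apply: (iffP forallP) => h u; apply/forallP. Qed.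

Lemma unicyclic_perm n es es' (ls : seq ('I_n * V)) :
  perm_eq es es' -> unicyclic (es, ls) = unicyclic (es', ls).
Proof.
move=> E; rewrite /unicyclic /has_rank /= (perm_size E); congr [&& _, _ & _].
  by apply: eq_forallb => v; rewrite (valence_perm _ _ E).
congr (_ && _); apply: eq_forallb => u; apply: eq_forallb => v.
by apply: eq_connect => a b; rewrite /adjacent /= !(perm_mem E).
Qed.

Lemma valence_map_ge m n (f : 'I_m -> 'I_n) (g : gr m) v :
  (valence g v <= valence (map_vertices f g) (f v))%N.
Proof.
rewrite !valenceE leq_add //; first by have := degree_in_map_ge f (edges g) setT v; rewrite preimsetT.
by rewrite count_map; apply: sub_count => l /= /eqP ->.
Qed.

Lemma contract_vertex_surj n (i j : 'I_n.+2) : i != j ->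
  forall w, exists v, w = contract_vertex i j v.
Proof.
case: (unliftP i j) => [k ->|->]; last by rewrite eqxx.
move=> _ w; exists ((front i k)^-1%g (lift ord0 w)).
by rewrite front_contract permKV lower_lift.
Qed.

Lemma unicyclic_contract n (i j : 'I_n.+2) es ls : i != j ->
  unicyclic ((i, j) :: es, ls) ->
  unicyclic (map_vertices (contract_vertex i j) (es, ls)).
Proof.
move=> ij /and3P[/forallP adm /connectedP con rk].
have surj := contract_vertex_surj ij.
apply/and3P; split.
- apply/forallP => w; have [v ->] := surj w.
  have := adm v; rewrite valenceE /= degree_in_cons /edge_degree /= !inE !andbT -addnA.
  case: (boolP (v \in [set i; j])) => [vij|]; last first.
    rewrite !inE negb_or !(eq_sym v) => /andP[/negPf-> /negPf->]; rewrite !add0n => h.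
    by apply: leq_trans (valence_map_ge _ (es, ls) v); rewrite valenceE.
  have -> : contract_vertex i j v = contract_vertex i j i.
    by move: vij; rewrite !inE => /orP[] /eqP-> //; rewrite contract_vertex_eq.
  move=> _; have := adm i; have := adm j; rewrite !valenceE /= !degree_in_cons /edge_degree /=.
  rewrite !inE !andbT !eqxx (eq_sym j i) (negPf ij) -/(map_edges _ es).
  rewrite (degree_in_merge _ _ (fun u v => contract_vertex_inj ij) (contract_vertex_eq i j)) //.
  rewrite preimsetT.
  have : (count (fun l => l.1 == i) ls + count (fun l => l.1 == j) ls <=
      count (fun h => h.1 == contract_vertex i j i)
        [seq (contract_vertex i j h.1, h.2) | h <- ls])%N.
    rewrite count_map -count_predUI [X in (_ + X)%N](_ : _ = 0%N).
      rewrite addn0; apply: sub_count => l /= /orP[] /eqP -> //.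
      by rewrite contract_vertex_eq.
    apply/eqP; rewrite -leqn0 leqNgt -has_count; apply/hasPn => l _ /=.
    by case: eqP => //= ->; rewrite (negPf ij).
  (* Each end has at least two half-edges besides the contracted edge, so the merged vertex has
     valence at least four. *)
  have merge (p q d d' c : nat) : (p + q <= c -> 2 < 1 + d' + q -> 2 < 1 + d + p ->
    2 < d + d' + c)%N by lia.
  exact: merge.
- apply/connectedP => a b; have [u ->] := surj a; have [v ->] := surj b.
  apply: (connect_min (R := fun u v => connect _ (contract_vertex i j u) (contract_vertex i j v)))
    (con u v) => [x|y x z|x y]; [exact: connect0 | exact: connect_trans |].
  have edge p q : (p, q) \in es -> connect (adjacent (map_vertices (contract_vertex i j) (es, ls)))
      (contract_vertex i j p) (contract_vertex i j q).
    by move=> pq; apply: connect1; rewrite /adjacent /= (map_f _ pq).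
  have csym := sym_connect_sym (@adjacent_sym _ (map_vertices (contract_vertex i j) (es, ls))).
  rewrite /adjacent /= !inE => /orP[] /orP[/eqP[-> ->]|/edge //].
  + by rewrite contract_vertex_eq connect0.
  + by rewrite contract_vertex_eq connect0.
  + by rewrite csym.
- by move: rk; rewrite /has_rank /= size_map !addn1 eqSS.
Qed.

Lemma degree_in_expand n (c : {set 'I_n}) x es v :
  degree_in ((ord0, lift ord0 x) :: map (expand_edge c x) es) setT v =
    ((v == ord0) + (v == lift ord0 x) +
     \sum_(e <- es) edge_degree setT v (expand_edge c x e))%N.
Proof.
rewrite degree_in_cons /degree_in big_map; congr (_ + _)%N.
by rewrite /edge_degree !inE !andbT !(eq_sym v).
Qed.

Lemma count_expand_leaf n (x : 'I_n) (ls : seq ('I_n * V)) v :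
  count (fun h => h.1 == v) (map (expand_leaf x) ls) =
    (if v == ord0 then count (fun h => h.1 == x) ls
     else count (fun h => (h.1 != x) && (lift ord0 h.1 == v)) ls).
Proof.
rewrite count_map; case: eqP => [->|/eqP v0]; apply: eq_count => l /=;
  case: (l.1 == x) => //=.
by rewrite eq_sym (negPf v0).
Qed.

(** The new vertex has two branches and the new edge, and [x] keeps its core degree of at least two
    next to the new edge; all other valences are unchanged. *)
Lemma unicyclic_expand n (g : gr n.+1) x : x \in expandable g ->
  unicyclic g -> unicyclic (expand x g).
Proof.
case: g => es ls; rewrite inE => /andP[/= xc bx] /and3P[/forallP adm /connectedP con rk].
set c := core es in xc; set X := expand x (es, ls).
apply/and3P; split.
- apply/forallP => v; rewrite valenceE /= degree_in_expand count_expand_leaf.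
  case: (unliftP ord0 v) => [w|] ->; last first.
    rewrite eqxx (negPf (neq_lift _ _)) addn0 -addnA ltnS.
    move: bx; rewrite /branches /degree_in /= -/c; congr (_ < _ + _)%N.
    by apply: eq_bigr => e _; rewrite /edge_degree !inE !andbT !expand_end0.
  rewrite lift0_neq (inj_eq (@lift_inj _ _)) add0n.
  case: (w =P x) => [->|/eqP wx].
    rewrite -addnA ltnS; apply: leq_trans (leq_addr _ _).
    apply: leq_trans (core_degree xc) _; rewrite leq_eqVlt; apply/orP; left; apply/eqP.
    apply: eq_bigr => e _; rewrite /edge_degree !inE !andbT !expand_end_eq_lift -/c.
    by congr (_ + _)%N; case: eqP => //= _; rewrite negbK.
  have := adm w; rewrite valenceE /= add0n; congr (_ < _ + _)%N.
    apply: eq_bigr => e _; rewrite /edge_degree !inE !andbT !expand_end_eq_lift.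
    by congr (_ + _)%N; case: eqP => //= ->; rewrite (negPf wx).
  apply: eq_count => l /=; rewrite (inj_eq (@lift_inj _ _)).
  by case: eqP => [->|_]; rewrite ?wx ?andbF.
- have csym := sym_connect_sym (@adjacent_sym _ X).
  have e0 : connect (adjacent X) ord0 (lift ord0 x).
    by apply: connect1; rewrite /adjacent /= inE eqxx.
  have eend a b : connect (adjacent X) (expand_end c x a b) (lift ord0 a).
    rewrite /expand_end; case: ifP => [/andP[/eqP-> _]|_]; first exact: e0.
    exact: connect0.
  have edge a b : (a, b) \in es -> connect (adjacent X) (lift ord0 a) (lift ord0 b).
    move=> ab; apply: connect_trans (connect_trans _ (eend b a)); first by rewrite csym; apply: (eend a b).
    by apply: connect1; rewrite /adjacent /= !inE (map_f (expand_edge c x) ab) orbT.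
  have lcon u v : connect (adjacent X) (lift ord0 u) (lift ord0 v).
    apply: (connect_min (R := fun u v => connect (adjacent X) (lift ord0 u) (lift ord0 v)))
      (con u v) => [y|y z w|y z]; [exact: connect0 | exact: connect_trans |].
    by case/orP => /edge //; rewrite csym.
  apply/connectedP => u v; case: (unliftP ord0 u) => [u'|] ->; case: (unliftP ord0 v) => [v'|] -> //.
    by rewrite csym; apply: connect_trans e0 _.
  exact: connect_trans e0 _.
- by move: rk; rewrite /has_rank /= size_map !addn1 eqSS.
Qed.

Lemma expand_core_neqT n (g : gr n) x : x \in core (edges g) ->
  core (edges (expand x g)) != setT.
Proof.
move=> xc; rewrite core_expand //; apply/eqP => /setP /(_ ord0).
by rewrite inE => /imsetP[v _ /eqP]; rewrite eq_sym lift0_neq.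
Qed.

Lemma card_core_expand n (g : gr n) x : x \in core (edges g) ->
  #|core (edges (expand x g))| = #|core (edges g)|.
Proof. by move=> xc; rewrite core_expand // card_imset //; apply: lift_inj. Qed.

(** A vertex outside the core is neither [i] nor [j], so it is alone in its fibre and stays outside
    the new core. *)
Lemma contract_core_neqT n (i j : 'I_n.+2) es : i != j ->
  i \in core ((i, j) :: es) -> j \in core ((i, j) :: es) ->
  core ((i, j) :: es) != setT ->
  core (map_edges (contract_vertex i j) es) != setT.
Proof.
move=> ij ci cj; apply: contraNneq => cT.
have := core_contract_sub (fun u v => contract_vertex_inj ij) ci cj.
rewrite cT => /subsetP sub; apply/eqP/setP => v; rewrite inE.
have /imsetP[u uc /(contract_vertex_inj ij)[-> //|/andP[+ _]]] := sub (contract_vertex i j v) (in_setT _).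
by rewrite !inE => /orP[] /eqP->.
Qed.

End GoodGraphs.

(** * Graphs of rank one as graphs of functions *)

Section UnicyclicGraphs.
Variables (F : fieldType) (V : lmodType F).
Local Notation gr n := (graph V n).

Definition joined (T : eqType) (es : seq (T * T)) : rel T :=
  [rel u v | ((u, v) \in es) || ((v, u) \in es)].

Definition orients (T : eqType) (es' es : seq (T * T)) :=
  all2 (fun a b => (a == b) || (a == (b.2, b.1))) es' es.

Lemma orients_size (T : eqType) (es' es : seq (T * T)) : orients es' es -> size es' = size es.
Proof. by rewrite /orients all2E => /andP[/eqP]. Qed.

Lemma orients_cat (T : eqType) (t1 t2 s1 s2 : seq (T * T)) : size t1 = size s1 ->
  orients (t1 ++ t2) (s1 ++ s2) = orients t1 s1 && orients t2 s2.
Proof. by elim: t1 s1 => [|a t1 IH] [|b s1] //= [/IH]; rewrite /orients /= => ->; rewrite andbA. Qed.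

Lemma orients_lift (T T' : finType) (f : T -> T') es' es :
  orients es' (map_edges f es) -> exists2 es2, orients es2 es & map_edges f es2 = es'.
Proof.
elim: es es' => [|[a b] es IH] [|e' es'] //=; first by exists [::].
case/andP=> ab /IH[es2 o2 m2].
case/orP: ab => /eqP ->; [exists ((a, b) :: es2) | exists ((b, a) :: es2)];
  by rewrite /orients /= ?eqxx ?orbT //= m2.
Qed.

Lemma orients_mem (T : eqType) (es' es : seq (T * T)) a b : orients es' es ->
  (a, b) \in es -> joined es' a b.
Proof.
elim: es es' => [|e es IH] [|e' es'] //= /andP[ee' /IH h]; rewrite inE /joined /= !inE.
case/orP => [/eqP eE|/h /orP[]->]; rewrite ?orbT //.
by case/orP: ee' => /eqP ->; rewrite -eE eqxx ?orbT.
Qed.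

Lemma orients_degree (T : finType) (es' es : seq (T * T)) U v : orients es' es ->
  degree_in es' U v = degree_in es U v.
Proof.
elim: es es' => [|e es IH] [|e' es'] //= /andP[ee' /IH h]; rewrite !degree_in_cons h.
by case/orP: ee' => /eqP ->; rewrite // edge_degreeC -surjective_pairing.
Qed.

Lemma orients_class n (es es' : seq ('I_n * 'I_n)) (ls : seq ('I_n * V)) :
  orients es' es -> exists b : bool, graph_class (es', ls) = (-1) ^+ b *: graph_class (es, ls).
Proof.
suff H pre : orients es' es -> exists b : bool,
    graph_class (pre ++ es', ls) = (-1) ^+ b *: graph_class (pre ++ es, ls) by exact: (H [::]).
elim: es es' pre => [|[i j] es IH] [|e' es'] pre //=.
  by exists false; rewrite scale1r.
case/andP=> ee' o; have [b] := IH es' (rcons pre (i, j)) o; rewrite !cat_rcons => bE.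
case/orP: ee' => /eqP ->; first by exists b.
have mid e s : perm_eq (pre ++ e :: s) (e :: (pre ++ s)) by exact: permEl (perm_catCA pre [:: e] s).
exists (~~ b); rewrite (graph_class_perm (mid _ _) (perm_refl ls)) graph_class_reverse.
by rewrite -(graph_class_perm (mid _ _) (perm_refl ls)) bE signrN scaleNr.
Qed.

Lemma joined_contract n (i j : 'I_n.+2) es : i != j ->
  (forall u v, connect (joined ((i, j) :: es)) u v) ->
  forall u v, connect (joined (map_edges (contract_vertex i j) es)) u v.
Proof.
move=> ij con a b; have [u ->] := contract_vertex_surj ij a.
have [v ->] := contract_vertex_surj ij b; set J := joined _.
have csym : connect_sym J by apply: sym_connect_sym => x y; rewrite /J /joined /= orbC.
apply: (connect_min (R := fun u v => connect J (contract_vertex i j u) (contract_vertex i j v)))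
  (con u v) => [x|y x z|x y]; [exact: connect0 | exact: connect_trans |].
have edge p q : (p, q) \in es -> connect J (contract_vertex i j p) (contract_vertex i j q).
  move=> pq; apply: connect1; rewrite /J /joined /=.
  by rewrite (map_f (fun e => (contract_vertex i j e.1, contract_vertex i j e.2)) pq).
rewrite /joined /= !inE => /orP[] /orP[/eqP[-> ->]|/edge //]; rewrite ?contract_vertex_eq ?connect0 //.
by rewrite csym.
Qed.

(* Every connected graph with as many edges as vertices is the graph of a
   function up to the directions of the edges: orient a contraction and let the
   end of the contracted edge that is left over be the source of that edge. *)
Lemma orient_unicyclic n (es : seq ('I_n.+1 * 'I_n.+1)) :
  (forall u v, connect (joined es) u v) -> size es = n.+1 ->
  exists2 es', orients es' es & uniq [seq e.1 | e <- es'].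
Proof.
elim: n es => [|n IH] es con sz.
  exists es; last by case: es sz {con} => [|e []].
  by elim: es {con sz} => //= e es; rewrite /orients /= eqxx.
have [e ees ne] : exists2 e, e \in es & e.1 != e.2.
  apply/hasP; apply/negPn/negP => /hasPn loops.
  have : (ord0 : 'I_n.+2) = ord1S n.
    apply: (connect_min (R := fun x y => x = y)) (con ord0 (ord1S n)) => // [y x z -> //|x y].
    by case/orP => /loops /negPn /eqP.
  by move/eqP; rewrite (negPf (neq_lift _ _)).
case/splitPr: ees con sz => s1 s2 con sz; case: e ne con sz => i j /= ij con sz.
have mid : perm_eq (s1 ++ (i, j) :: s2) ((i, j) :: (s1 ++ s2)).
  exact: permEl (perm_catCA s1 [:: (i, j)] s2).
have con' u v : connect (joined ((i, j) :: (s1 ++ s2))) u v.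
  rewrite (eq_connect (e' := joined (s1 ++ (i, j) :: s2))) ?con // => x y.
  by rewrite /joined /= !(perm_mem mid).
have sz' : size (map_edges (contract_vertex i j) (s1 ++ s2)) = n.+1.
  by move: sz; rewrite size_map !size_cat /= addnS => -[].
have [es2 o2 u2] := IH _ (joined_contract ij con') sz'.
have [es3 o3 m3] := orients_lift o2.
have u3 : uniq [seq contract_vertex i j e.1 | e <- es3].
  by move: u2; rewrite -m3 -map_comp.
have us3 : uniq [seq e.1 | e <- es3] by apply: (@map_uniq _ _ (contract_vertex i j)); rewrite -map_comp.
have nij : ~ (i \in [seq e.1 | e <- es3] /\ j \in [seq e.1 | e <- es3]).
  case=> i3 j3; have := count_uniq_mem (contract_vertex i j i) u3.
  rewrite map_comp count_map (seq.permP (perm_to_rem i3)) /= eqxx.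
  have j3' : j \in rem i [seq e.1 | e <- es3] by rewrite mem_rem_uniq // inE eq_sym ij.
  rewrite (seq.permP (perm_to_rem j3')) /= contract_vertex_eq eqxx.
  by case: (_ \in _).
have [w wij w3] : exists2 w, (w == (i, j)) || (w == (j, i)) & w.1 \notin [seq e.1 | e <- es3].
  case: (boolP (i \in [seq e.1 | e <- es3])) => i3.
    exists (j, i); first by rewrite eqxx orbT.
    by apply/negP => j3; apply: nij.
  by exists (i, j); rewrite ?eqxx.
pose t1 := take (size s1) es3; pose t2 := drop (size s1) es3.
have szt : size t1 = size s1.
  by rewrite size_takel // (orients_size o3) size_cat leq_addr.
move: o3; rewrite -[es3](cat_take_drop (size s1)) -/t1 -/t2 (orients_cat _ _ szt) => /andP[o1' o2'].
exists (t1 ++ w :: t2); first by rewrite orients_cat // o1' /=; apply/andP; split.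
have -> : uniq [seq e.1 | e <- t1 ++ w :: t2] = uniq (w.1 :: [seq e.1 | e <- es3]).
  apply: perm_uniq; rewrite -[es3](cat_take_drop (size s1)) -/t1 -/t2 !map_cat /=.
  exact: permEl (perm_catCA _ [:: w.1] _).
by rewrite /= w3.
Qed.

(** Serves twice: for edges listed by their sources, and for hairs when every vertex carries exactly
    one. *)
Lemma perm_graph_function (T : finType) (X : eqType) (s : seq (T * X)) (x0 : X) :
  perm_eq [seq e.1 | e <- s] (enum T) ->
  exists f : T -> X, perm_eq s [seq (v, f v) | v <- enum T].
Proof.
move=> E; have us : uniq [seq e.1 | e <- s] by rewrite (perm_uniq E) enum_uniq.
pose f v := (nth (v, x0) s (index v [seq e.1 | e <- s])).2.
exists f; apply: perm_trans (perm_map (fun v => (v, f v)) E); rewrite -map_comp.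
have -> : [seq ((fun v => (v, f v)) \o fst) e | e <- s] = s; last by [].
rewrite -[RHS]map_id; apply/eq_in_map => e es /=.
rewrite /f; have [k ks eE] := nthP e es.
have ke : index e.1 [seq e.1 | e <- s] = k.
  by rewrite -eE -(nth_map e e.1 fst) // index_uniq ?size_map.
by rewrite ke (set_nth_default e) // eE -surjective_pairing.
Qed.

Definition function_edges (T : finType) (p : T -> T) := [seq (v, p v) | v <- enum T].

Lemma degree_in_function (T : finType) (p : T -> T) (U : {set T}) v :
  degree_in (function_edges p) U v = ((p v \in U) + #|[set u in U | p u == v]|)%N.
Proof.
rewrite /degree_in big_map big_enum /edge_degree /= big_split /=; congr (_ + _)%N.
  rewrite (bigD1 v) //= eqxx big1 ?addn0 // => u /negPf uv.
  by rewrite uv.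
rewrite -sum1_card [RHS]big_mkcond; apply: eq_bigr => u _; rewrite inE andbC.
by case: andP.
Qed.

(** There are as many edges as vertices, so sources that are distinct exhaust the vertices, and [p]
    sends each vertex to the target of its edge. *)
Lemma function_form n (g : gr n.+1) : unicyclic g -> exists (p : 'I_n.+1 -> 'I_n.+1) (b : bool),
  [/\ graph_class g = (-1) ^+ b *: graph_class (function_edges p, leaves g),
      forall U v, degree_in (edges g) U v = degree_in (function_edges p) U v
    & forall u v, joined (edges g) u v -> p u = v \/ p v = u].
Proof.
case: g => es ls /and3P[_ /connectedP con rk].
have sz : size es = n.+1 by move: rk; rewrite /has_rank addn1 eqSS => /eqP.
have [es' o u] := orient_unicyclic con sz.
have E : perm_eq [seq e.1 | e <- es'] (enum 'I_n.+1).
  apply: uniq_perm; rewrite ?enum_uniq //.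
  have sz' : (size (enum 'I_n.+1) <= size [seq e.1 | e <- es'])%N.
    by rewrite size_map (orients_size o) sz size_enum_ord.
  have sub : {subset [seq e.1 | e <- es'] <= enum 'I_n.+1} by move=> x _; rewrite mem_enum.
  by have [] := uniq_min_size u sub sz'.
have [p pE] := perm_graph_function ord0 E.
have [b bE] := orients_class ls o.
exists p, b; split.
- rewrite /= -(graph_class_perm pE (perm_refl ls)) bE scalerA -signr_addb addbb.
  by rewrite scale1r.
- by move=> U v; rewrite -(orients_degree _ _ o) (degree_in_perm _ _ pE).
- have mem a b' : (a, b') \in es' -> p a = b'.
    by rewrite (perm_mem pE) => /mapP[w _ [-> ->]].
  have key a b' : (a, b') \in es -> p a = b' \/ p b' = a.
    by move=> /(orients_mem o) /orP[] /mem; [left|right].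
  by move=> u' v' /orP[] /key; [| case; [right|left]].
Qed.

(** On a minimal nonempty set stable under [p] the map is onto; each vertex there has an outgoing
    and an incoming edge within the set, hence degree at least two. *)
Lemma core_unicyclic_neq0 n (g : gr n.+1) : unicyclic g -> core (edges g) != set0.
Proof.
move=> /function_form[p [_ [_ dE _]]]; rewrite (core_eq dE).
pose closed (U : {set 'I_n.+1}) := (U != set0) && (p @: U \subset U).
have cT : closed setT by rewrite /closed subsetT andbT; apply/set0Pn; exists ord0.
case: (@arg_minnP _ setT closed (fun U => #|U|) cT) => U /andP[U0 pU] minU.
have pUU : p @: U = U.
  apply/eqP; rewrite eqEcard pU /=; apply: minU; apply/andP; split.
    by have [u uU] := set0Pn _ U0; apply/set0Pn; exists (p u); apply: imset_f.
  exact: imsetS.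
have : core_set (function_edges p) U.
  apply/core_setP => v vU; rewrite degree_in_function (subsetP pU) ?imset_f //.
  rewrite add1n ltnS card_gt0; have := vU; rewrite -{1}pUU => /imsetP[u uU vE].
  by apply/set0Pn; exists u; rewrite inE uU vE eqxx.
move/core_max => Uc; have [u uU] := set0Pn _ U0.
by apply/set0Pn; exists u; apply: (subsetP Uc).
Qed.

(** If the number is 0, no edge leaves the core, which is nonempty, so by connectedness it contains
    every vertex; as no vertex is expandable, each carries at most one hair. *)
Lemma tree_number_gt0 n (g : gr n.+1) : unicyclic g -> bulky g -> (0 < tree_number g)%N.
Proof.
move=> ug; rewrite lt0n; apply: contraL; rewrite /tree_number addn_eq0 cards_eq0 sum_nat_eq0.
case/andP=> /eqP ex0 /forallP d0.
have nex x : x \notin expandable g by rewrite ex0 inE.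
have cd x : x \in core (edges g) -> degree_in (edges g) (~: core (edges g)) x = 0%N.
  by move=> xc; have := d0 x; rewrite xc nex => /eqP.
have [v0 v0c] := set0Pn _ (core_unicyclic_neq0 ug).
case/and3P: ug => _ /connectedP con _.
have step x y : adjacent g x y -> x \in core (edges g) -> y \in core (edges g).
  move=> xy xc; apply: contraT => yc; have /eqP := cd x xc.
  rewrite sum_nat_seq_eq0 => /allP h.
  case/orP: xy => /h; rewrite /edge_degree /= !eqxx !inE yc xc //= addn_eq0.
  by rewrite andbF.
have cT v : v \in core (edges g).
  apply: (connect_min (R := fun x y => x \in core (edges g) -> y \in core (edges g)))
    (con v0 v) v0c => //.
  by move=> y x z h1 h2 /h1 /h2.
rewrite /bulky negb_or negbK; apply/andP; split; first by apply/eqP/setP => v; rewrite inE cT.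
apply/existsPn => v; rewrite -leqNgt.
have := nex v; rewrite inE cT /= -leqNgt; apply: leq_trans; exact: leq_addl.
Qed.

End UnicyclicGraphs.

(** * Cycles outside the polygons are boundaries *)

Section CyclesBound.
Variables (F : fieldType) (V : lmodType F).
Local Notation gr n := (graph V n).

Definition class_span n (A : pred (gr n)) : subspace (graph_space V n) :=
  linspan (fun x => exists2 g, A g & x = graph_class g).

Lemma class_span_gen n (A : pred (gr n)) g : A g -> class_span A (graph_class g).
Proof. by move=> Ag; apply: span_gen; exists g. Qed.

Lemma class_spanS n (A B : pred (gr n)) : (forall g, A g -> B g) ->
  forall x, class_span A x -> class_span B x.
Proof. by move=> AB; apply: span_sub => x [g /AB Bg ->]; exists g. Qed.

Definition core_below n m : pred (gr n) :=
  fun g => [&& unicyclic g, bulky g & (#|core (edges g)| < m)%N].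

Lemma contraction_below n (i j : 'I_n.+2) es (ls : seq ('I_n.+2 * V)) : i != j ->
  unicyclic ((i, j) :: es, ls) -> i \in core ((i, j) :: es) -> j \in core ((i, j) :: es) ->
  let g := map_vertices (contract_vertex i j) (es, ls) in
  unicyclic g /\ (#|core (edges g)| < #|core ((i, j) :: es)|)%N.
Proof.
move=> ij ug ci cj; split; first exact: unicyclic_contract.
exact: (card_core_contract ij (fun u v => contract_vertex_inj ij) (contract_vertex_eq i j) ci cj).
Qed.

(** The expansion keeps the core size and puts the new vertex outside the core; contracting the core
    edge then shrinks the core and leaves a vertex outside it. *)
Lemma expanded_contraction_below n (g : gr n.+2) x e : unicyclic g -> x \in expandable g ->
  e \in edges g -> e.1 != e.2 -> core_edge g e ->
  class_span (core_below #|core (edges g)|)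
    (expanded_contraction (core (edges g)) x e.1 e.2 (rem e (edges g), leaves g)).
Proof.
case: g => es ls /= ug xe ees ne /andP[/= c1 c2].
have xc : x \in core es by move: xe; rewrite inE => /andP[].
have uX := unicyclic_expand xe ug; have XT := @expand_core_neqT _ _ _ (es, ls) x xc.
have Xcard := @card_core_expand _ _ _ (es, ls) x xc; have cX := @core_expand _ _ _ x (es, ls) xc.
rewrite /expanded_contraction /=; set c := core es in c1 c2 xc *.
set i := expand_end c x e.1 e.2; set j := expand_end c x e.2 e.1.
set E0 := _ :: _; set L := map _ ls.
have E : perm_eq (edges (expand x (es, ls))) ((i, j) :: E0).
  rewrite perm_sym /E0; set e0 := (ord0, _); set rest := map _ (rem e es).
  apply: perm_trans (permEl (perm_catCA [:: (i, j)] [:: e0] rest)) _.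
  by rewrite /= perm_cons perm_sym; exact: (perm_map (expand_edge c x) (perm_to_rem ees)).
have ij : i != j by rewrite expand_end_neq.
have iE : i = lift ord0 e.1 by rewrite /i /expand_end c2 andbF.
have jE : j = lift ord0 e.2 by rewrite /j /expand_end c1 andbF.
have cE : core ((i, j) :: E0) = lift ord0 @: c by rewrite -(core_perm E) cX.
have ci : i \in core ((i, j) :: E0) by rewrite cE iE imset_f.
have cj : j \in core ((i, j) :: E0) by rewrite cE jE imset_f.
have uE : unicyclic ((i, j) :: E0, L) by rewrite -(unicyclic_perm _ E).
have [u1 lt1] := contraction_below ij uE ci cj.
rewrite /contraction; apply: (@subspaceZ _ _ (class_span _)). apply: class_span_gen.
rewrite /core_below u1 -Xcard (core_perm E) lt1 andbT /=.
apply/orP; left; apply: (contract_core_neqT ij ci cj).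
by rewrite -(core_perm E).
Qed.

Lemma hQ_unicyclic n m (g : gr n.+1) : unicyclic g -> (#|core (edges g)| < m)%N ->
  class_span (core_below m) (hQ (graph_class g)).
Proof.
move=> ug gm; rewrite hQE; apply: subspace_sum => x xe; apply: class_span_gen.
have xc : x \in core (edges g) by move: xe; rewrite inE => /andP[].
rewrite /core_below unicyclic_expand // card_core_expand // gm andbT /=.
by rewrite /bulky expand_core_neqT.
Qed.

Lemma edge_terms_below n (g : gr n.+2) e : unicyclic g ->
  e \in edges g -> e.1 != e.2 -> core_edge g e ->
  class_span (core_below #|core (edges g)|) (edge_terms g e).
Proof.
move=> ug ees ne ce; apply: (@subspaceD _ _ (class_span _)).
  by apply: subspace_sum => x xe; apply: expanded_contraction_below.
case: g e ug ees ne ce => es ls [i j] /= ug ees ij /andP[/= ci cj].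
have E := perm_to_rem ees.
rewrite (unicyclic_perm _ E) in ug; rewrite (core_perm E) in ci cj *.
have [u1 lt1] := contraction_below ij ug ci cj.
rewrite /contraction linearZ; apply: (@subspaceZ _ _ (class_span _)).
exact: hQ_unicyclic.
Qed.

Hypothesis char0 : [pchar F] =i pred0.

Definition ubulky n : pred (gr n) := fun g => unicyclic g && bulky g.

(** The lexicographic filtration by core size and [tree_number], along which the induction runs. *)
Definition level n m c : pred (gr n) := fun g =>
  [&& unicyclic g, bulky g & (#|core (edges g)| < m)%N ||
      (#|core (edges g)| == m) && (tree_number g <= c)%N].

Lemma hQ_ubulky n (x : graph_space V n.+1) :
  class_span (@ubulky _) x -> class_span (@ubulky _) (hQ x).
Proof.
apply: (span_image (f := @hQ F V n.+1)) => _ [g /andP[ug _] ->].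
apply: class_spanS (hQ_unicyclic ug (ltnSn _)) => g'.
by case/and3P=> u b _; apply/andP.
Qed.

(** Each core vertex contributes at most 1: a vertex that is not expandable has at most one branch.
    Hence every fixed core size exhausts its filtration after finitely many steps. *)
Lemma tree_number_le n (g : gr n) : (tree_number g <= n)%N.
Proof.
apply: (@leq_trans #|core (edges g)|); last by rewrite -[X in (_ <= X)%N]card_ord max_card.
rewrite /tree_number; have sub : expandable g \subset core (edges g).
  by apply/subsetP => x; rewrite inE => /andP[].
rewrite -(cardsID (expandable g) (core (edges g))) (setIidPr sub) leq_add2l -sum1_card.
rewrite [X in (_ <= X)%N](eq_bigl (fun x => (x \in core (edges g)) && (x \notin expandable g))).
  apply: leq_sum => x /andP[xc]; rewrite inE xc /= -leqNgt; apply: leq_trans; exact: leq_addr.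
by move=> x; rewrite inE andbC.
Qed.

Definition laplace n (x : graph_space V n.+2) := dQ (hQ x) + hQ (dQ x).

(** Graphs at the top, of core size m and tree number c + 1, are eigenvectors modulo smaller cores,
    and the subtraction removes them; on lower graphs it only rescales. *)
Lemma laplace_level n m c (x : graph_space V n.+2) :
  class_span (level m c.+1) x -> class_span (level m c) (laplace x - c.+1%:R *: x).
Proof.
pose f : {linear graph_space V n.+2 -> graph_space V n.+2} :=
  ((@dQ F V n.+2 \o @hQ F V n.+2) \+ (@hQ F V n.+1 \o @dQ F V n.+1)) \- (c.+1%:R \*: idfun).
apply: (span_image (f := f)) => _ [g /and3P[ug bg lev] ->]; rewrite /f /=.
have adm : admissible g by case/and3P: ug.
rewrite laplacian // addrAC -scalerBl; apply: (@subspaceD _ _ (class_span _)); last first.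
  apply: subspace_sum_in => e ees /andP[ne ce].
  apply: class_spanS (edge_terms_below ug ees ne ce) => g' /and3P[u b lt].
  apply/and3P; split=> //; apply/orP; left.
  by case/orP: lev => [|/andP[/eqP <- _]]; [apply: ltn_trans | ].
case/orP: lev => [lt|/andP[/eqP gm tn]].
  by apply/(@subspaceZ _ _ (class_span _))/class_span_gen; apply/and3P; rewrite lt.
move: tn; rewrite leq_eqVlt => /orP[/eqP ->|tn].
  by rewrite subrr scale0r; apply: subspace0.
by apply/(@subspaceZ _ _ (class_span _))/class_span_gen; apply/and3P; split=> //; rewrite gm eqxx; apply/orP; right.
Qed.

Lemma level_ubulky n m c (x : graph_space V n) :
  class_span (level m c) x -> class_span (@ubulky _) x.
Proof. by apply: class_spanS => g /and3P[u b _]; apply/andP. Qed.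

Definition level_bounded n m c := forall x : graph_space V n.+2,
  class_span (level m c) x -> dQ x = 0 ->
  exists2 y : graph_space V n.+3, class_span (@ubulky _) y & dQ y = x.

(** For a cycle x, d h x - (c + 1) x is a cycle one level lower, hence some d y with y bulky;
    solving for x gives x = d ((h x - y) / (c + 1)). *)
Lemma level_boundedS n m c : @level_bounded n m c -> @level_bounded n m c.+1.
Proof.
move=> IH x Sx dx; have lap_x : laplace x = dQ (hQ x).
  by rewrite /laplace dx linear0 addr0.
have [|y Sy yE] := IH _ (laplace_level Sx).
  by rewrite linearB linearZ lap_x /= dx dQ_dQ // scaler0 subr0.
exists (c.+1%:R^-1 *: (hQ x - y)).
  by apply/(@subspaceZ _ _ (class_span _))/(@subspaceB _ _ (class_span _)) => //; apply/hQ_ubulky/level_ubulky/Sx.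
rewrite linearZ linearB /= yE lap_x opprB addrCA subrr addr0 scalerA.
by rewrite mulVf ?scale1r // natr_neq0.
Qed.

(** As bulky graphs have positive tree number, the level (m + 1, 0) contains only cores of size at
    most m, and these lie in the level (m, n + 2) because the number of vertices bounds
    [tree_number]. The level (0, 0) is empty. *)
Lemma all_levels_bounded n m c : @level_bounded n m c.
Proof.
elim: m c => [|m IHm]; elim=> [|c IHc]; try exact: level_boundedS.
  move=> x Sx _; have -> : x = 0.
    apply: (span_kills (f := idfun) _ Sx) => y [g /and3P[u b] + _].
    by rewrite ltn0 [(tree_number g <= 0)%N]leqNgt (tree_number_gt0 u b) andbF.
  by exists 0; [apply: subspace0 | rewrite linear0].
move=> x Sx; apply: (IHm n.+2); apply: class_spanS Sx => g /and3P[u b].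
rewrite [(tree_number g <= 0)%N]leqNgt (tree_number_gt0 u b) andbF orbF ltnS leq_eqVlt => lev.
by apply/and3P; split=> //; rewrite orbC tree_number_le andbT.
Qed.

Lemma bulky_cycle_bounds n (x : graph_space V n.+2) :
  class_span (@ubulky _) x -> dQ x = 0 ->
  exists2 y : graph_space V n.+3, class_span (@ubulky _) y & dQ y = x.
Proof.
move=> Sx; apply: (@all_levels_bounded n n.+3 0%N); apply: class_spanS Sx => g /andP[u b].
by apply/and3P; split=> //; rewrite ltnS -[X in (_ <= X)%N]card_ord max_card.
Qed.

End CyclesBound.

(** * Polygons *)

Section Polygons.
Variables (F : fieldType) (V : lmodType F).
Local Notation gr n := (graph V n).

Definition rot_perm k : 'S_k.+1 := perm (@ordS_inj k.+1).
Definition rev_perm k : 'S_k := perm (@rev_ord_inj k).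

(** The rotation carries the last place to the first, past k others whose order is kept. *)
Lemma odd_rot_perm k : rot_perm k = odd k :> bool.
Proof.
suff -> : rot_perm k = lift_perm ord_max ord0 1.
  by rewrite odd_lift_perm odd_perm1 /= !addbF.
apply/permP => i; rewrite permE; case: (unliftP ord_max i) => [j|] ->.
  rewrite lift_perm_lift perm1; apply/val_inj; rewrite /= /bump leq0n add1n leqNgt ltn_ord.
  by rewrite add0n modn_small // ltnS ltn_ord.
by rewrite lift_perm_id; apply/val_inj; rewrite /= modnn.
Qed.

(** Reversing k + 1 places moves the first one past k others and reverses those; this is the
    recursion C(k+1,2) = C(k,2) + k. *)
Lemma odd_rev_perm k : rev_perm k = odd 'C(k, 2) :> bool.
Proof.
elim: k => [|k IH].
  have -> : rev_perm 0 = 1%g by apply/permP => -[].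
  by rewrite odd_perm1.
suff -> : rev_perm k.+1 = lift_perm ord0 ord_max (rev_perm k).
  by rewrite odd_lift_perm IH /= binS bin1 oddD addbC.
apply/permP => i; rewrite permE; case: (unliftP ord0 i) => [j|] ->.
  rewrite lift_perm_lift permE; apply/val_inj; rewrite /= /bump leq0n add1n subSS.
  by have := ltn_ord j; case: leqP; lia.
by rewrite lift_perm_id; apply/val_inj; rewrite /= subn1.
Qed.

Definition polygon k (v : {ffun 'I_k.+1 -> V}) : gr k.+1 :=
  (function_edges (@ordS k.+1), [seq (i, v i) | i <- enum 'I_k.+1]).

Lemma perm_enum_map (T : finType) (X : eqType) (s : {perm T}) (f : T -> X) :
  perm_eq [seq f (s v) | v <- enum T] [seq f v | v <- enum T].
Proof.
rewrite (map_comp f s); apply: perm_map; apply: uniq_perm; rewrite ?enum_uniq //.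
  by rewrite map_inj_uniq ?enum_uniq //; apply: perm_inj.
move=> x; rewrite mem_enum; apply/mapP; exists (s^-1%g x); rewrite ?mem_enum //.
by rewrite permKV.
Qed.

Lemma eq_perm_map (T X : eqType) (f g : T -> X) (s : seq T) :
  f =1 g -> perm_eq (map f s) (map g s).
Proof. by move=> fg; rewrite (eq_map fg). Qed.

Lemma reverse_all n (es : seq ('I_n * 'I_n)) ls :
  graph_class ([seq (e.2, e.1) | e <- es], ls) = (-1) ^+ size es *: graph_class (es, ls) :> graph_space V n.
Proof.
suff H pre : graph_class (pre ++ [seq (e.2, e.1) | e <- es], ls) =
    (-1) ^+ size es *: graph_class (pre ++ es, ls) by exact: (H [::]).
elim: es pre => [|[i j] es IH] pre /=; first by rewrite scale1r.
have mid e s : perm_eq (pre ++ e :: s) (e :: (pre ++ s)) by exact: permEl (perm_catCA pre [:: e] s).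
rewrite (graph_class_perm (mid _ _) (perm_refl ls)) graph_class_reverse.
rewrite -(graph_class_perm (mid _ _) (perm_refl ls)) -cat_rcons IH cat_rcons.
by rewrite exprS mulN1r scaleNr.
Qed.

Section Fixed.
Variable k : nat.
Implicit Type v : {ffun 'I_k.+1 -> V}.

Lemma polygon_rotate v :
  graph_class (polygon v) = (-1) ^+ k *: graph_class (polygon (rotate v)).
Proof.
rewrite -[(-1) ^+ k]signr_odd -odd_rot_perm -graph_class_map; apply: graph_class_perm;
  rewrite perm_sym /= -map_comp.
  apply: perm_trans (perm_enum_map (rot_perm k) (fun i => (i, ordS i))).
  by apply: eq_perm_map => i /=; rewrite !permE.
apply: perm_trans (perm_enum_map (rot_perm k) (fun i => (i, v i))).
by apply: eq_perm_map => i /=; rewrite !permE ffunE.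
Qed.

Lemma rev_ordS (i : 'I_k.+1) : ordS (rev_ord (ordS i)) = rev_ord i.
Proof.
apply/val_inj; rewrite /=; have := ltn_ord i; rewrite ltnS leq_eqVlt => /orP[/eqP->|ik].
  by rewrite modnn subn1 modnn subnn.
by rewrite (@modn_small i.+1) // (@modn_small _.+1) ?subSS; lia.
Qed.

(** Renumbering by the reversal has sign exponent C(k+1,2), and afterwards all k + 1 edges point
    backwards: this is the origin of the sign of y. *)
Lemma polygon_reverse v :
  graph_class (polygon v) = (-1) ^+ (k.+1 + 'C(k.+1, 2)) *: graph_class (polygon (reverse v)).
Proof.
rewrite exprD -scalerA -[(-1) ^+ 'C(_, _)]signr_odd -odd_rev_perm -graph_class_map.
set g := map_vertices _ _; have := reverse_all (edges g) (leaves g).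
have szE : size (edges g) = k.+1 by rewrite /= size_map /function_edges size_map size_enum_ord.
rewrite [in (-1) ^+ _]szE => <-; apply: graph_class_perm.
  rewrite perm_sym /= /function_edges -map_comp -map_comp.
  (* The edge out of i, reflected and turned around, is the polygon edge out of
     [rev_ord (ordS i)]. *)
  apply: perm_trans (perm_enum_map (rot_perm k * rev_perm k.+1)%g (fun i => (i, ordS i))).
  by apply: eq_perm_map => i /=; rewrite permM !permE rev_ordS.
rewrite perm_sym /= -map_comp.
apply: perm_trans (perm_enum_map (rev_perm k.+1) (fun i => (i, v i))).
by apply: eq_perm_map => i /=; rewrite !permE ffunE.
Qed.

Lemma polygon_label (a : {ffun 'I_k.+1 -> V}) i c x y :
  graph_class (polygon (subst_at a i (c *: x + y))) =
  c *: graph_class (polygon (subst_at a i x)) + graph_class (polygon (subst_at a i y)).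
Proof.
have pE z : graph_class (polygon (subst_at a i z)) = graph_class (function_edges (@ordS k.+1),
    (i, z) :: [seq (j, a j) | j <- rem i (enum 'I_k.+1)]).
  apply: graph_class_perm => //.
  have E : perm_eq (enum 'I_k.+1) (i :: rem i (enum 'I_k.+1)).
    by apply: perm_to_rem; rewrite mem_enum.
  apply: perm_trans (perm_map _ E) _; rewrite /= ffunE eqxx perm_cons.
  rewrite (_ : map _ _ = [seq (j, a j) | j <- rem i (enum 'I_k.+1)]) //.
  apply/eq_in_map => j; rewrite mem_rem_uniq ?enum_uniq // inE => /andP[/negPf ji _].
  by rewrite ffunE ji.
by rewrite !pE graph_class_label.
Qed.

Lemma polygon_kills (x : free_module F {ffun 'I_k.+1 -> V}) : coinvariant_relation x ->
  fglift (fun v => graph_class (polygon v) : graph_space V k.+1) x = 0.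
Proof.
case=> [y [a i c u v]|v|v]; rewrite ?linearB ?linearZ /= ?scalerN ?fglift1.
- by rewrite polygon_label -addrA -opprD subrr.
- by rewrite -polygon_rotate subrr.
- by rewrite -polygon_reverse subrr.
Qed.

Definition polygon_map (w : tensor_coinvariants V k) : graph_space V k.+1 :=
  presented_map polygon_kills w.

Arguments polygon_map : simpl never.

HB.instance Definition _ := GRing.isLinear.Build F (tensor_coinvariants V k)
  (graph_space V k.+1) _ polygon_map (linearP (presented_map polygon_kills)).

Lemma polygon_mapE v : polygon_map (tensor_class v) = graph_class (polygon v).
Proof. exact: presented_mapE. Qed.

End Fixed.

Lemma degree_in_bij n (p : 'I_n -> 'I_n) v : injective p ->
  degree_in (function_edges p) setT v = 2.
Proof.
move=> pi; rewrite degree_in_function inE add1n; congr _.+1.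
have [q pK qK] := injF_bij pi.
rewrite (_ : [set _ in _ | _] = [set q v]) ?cards1 //; apply/setP => u; rewrite !inE /=.
by apply/eqP/eqP => [<-|->].
Qed.

Lemma count_enum_fst (T : finType) (X : eqType) (f : T -> X) v :
  count (fun l => l.1 == v) [seq (i, f i) | i <- enum T] = 1%N.
Proof.
rewrite count_map (eq_count (a2 := pred1 v)) // count_uniq_mem ?enum_uniq //.
by rewrite mem_enum.
Qed.

Lemma polygon_unicyclic k (v : {ffun 'I_k.+1 -> V}) : unicyclic (polygon v).
Proof.
apply/and3P; split.
- apply/forallP => i; rewrite valenceE /= degree_in_bij; last exact: ordS_inj.
  by rewrite count_enum_fst.
- have step i : connect (adjacent (polygon v)) i (ordS i).
    apply: connect1; rewrite /adjacent /=; apply/orP; left.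
    by apply/mapP; exists i; rewrite ?mem_enum.
  have from0 m (mk : (m < k.+1)%N) : connect (adjacent (polygon v)) ord0 (Ordinal mk).
    elim: m mk => [|m IH] mk; first by rewrite (_ : Ordinal mk = ord0) ?connect0 //; apply: val_inj.
    apply: connect_trans (IH (ltnW mk)) _.
    rewrite (_ : Ordinal mk = ordS (Ordinal (ltnW mk))) //.
    by apply: val_inj; rewrite /= modn_small.
  have csym := sym_connect_sym (@adjacent_sym _ _ _ (polygon v)).
  have con0 i : connect (adjacent (polygon v)) ord0 i by case: i => m mk; apply: from0.
  apply/connectedP => i j; apply: connect_trans (con0 j); by rewrite csym.
- by rewrite /has_rank /= /function_edges size_map size_enum_ord addn1.
Qed.

(** Core degree two at every vertex makes [p] onto, hence bijective, and connectedness makes it a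
    single cycle. Edge degrees are then exactly two, so admissibility forces the one hair that is
    allowed. Numbering the vertices along the orbit of 0 produces the polygon. *)
Lemma nonbulky_polygon k (g : gr k.+1) : unicyclic g -> ~~ bulky g ->
  exists (v : {ffun 'I_k.+1 -> V}) (b : bool),
    graph_class g = (-1) ^+ b *: graph_class (polygon v).
Proof.
move=> ug; rewrite /bulky negb_or negbK => /andP[/eqP cT /existsPn lv].
have [p [b [gE dE pE]]] := function_form ug.
case/and3P: ug => /forallP adm /connectedP con _.
have deg v : degree_in (function_edges p) setT v = (1 + #|[set u | p u == v]|)%N.
  by rewrite degree_in_function inE; congr (_ + #|pred_of_set _|)%N; apply/setP => u; rewrite !inE.
have p_surj v : exists u, p u = v.
  have := @core_degree _ (edges g) v; rewrite cT inE dE deg => /(_ isT).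
  rewrite add1n ltnS card_gt0 => /set0Pn[u]; rewrite inE => /eqP <-.
  by exists u.
have p_inj : injective p.
  have /image_injP : #|image p 'I_k.+1| == #|'I_k.+1|.
    rewrite eqn_leq leq_image_card /= -[X in (_ <= X)%N]cardsE; apply: subset_leq_card.
    by apply/subsetP => v _; rewrite inE; have [u <-] := p_surj v; apply: image_f.
  by move=> h x y; apply: h.
have leaf1 v : count (fun l => l.1 == v) (leaves g) = 1%N.
  have := adm v; rewrite valenceE dE degree_in_bij // add2n !ltnS => l0.
  by apply/eqP; rewrite eqn_leq l0 andbT leqNgt; apply: lv.
have conp u v : fconnect p u v.
  have psym := fconnect_sym p_inj.
  apply: (connect_min (R := fun x y => fconnect p x y)) (con u v) => [x|x y z|x y].
  - exact: connect0.
  - exact: connect_trans.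
  - by case/pE => <-; [|rewrite psym]; apply: fconnect1.
have ordp : order p ord0 = k.+1.
  by rewrite /order (eq_card (B := 'I_k.+1)) ?card_ord // => v; rewrite !inE; apply: conp.
pose s (i : 'I_k.+1) := iter i p ord0.
have s_inj : injective s.
  move=> i j; rewrite /s => ij; apply/val_inj/eqP.
  have := orbit_uniq p ord0; rewrite /orbit ordp => u.
  have sz (l : 'I_k.+1) : (l < size (traject p ord0 k.+1))%N by rewrite size_traject.
  rewrite -(nth_uniq ord0 (sz i) (sz j) u).
  rewrite (nth_traject p (ltn_ord i)) (nth_traject p (ltn_ord j)).
  exact/eqP.
have ps i : p (s i) = s (ordS i).
  rewrite /s -iterS; have := ltn_ord i; rewrite ltnS leq_eqVlt => /orP[/eqP iE|ik]; last first.
    by rewrite /= modn_small.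
  by rewrite /= iE modnn; have := iter_order p_inj ord0; rewrite ordp.
pose t := perm s_inj.
have E : perm_eq [seq l.1 | l <- leaves g] (enum 'I_k.+1).
  apply/allP => v _ /=; rewrite count_map; apply/eqP.
  rewrite (eq_count (a2 := fun l => l.1 == v)) // leaf1.
  by rewrite count_uniq_mem ?enum_uniq // mem_enum.
have [f fE] := perm_graph_function 0 E.
exists [ffun i => f (s i)], (b (+) t).
rewrite gE signr_addb -scalerA -graph_class_map; congr (_ *: _); symmetry.
apply: graph_class_perm; rewrite /= -map_comp.
  apply: perm_trans (perm_enum_map t (fun i => (i, p i))).
  by apply: eq_perm_map => i /=; rewrite !permE ps.
rewrite perm_sym; apply: perm_trans fE _; rewrite perm_sym.
apply: perm_trans (perm_enum_map t (fun i => (i, f i))).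
by apply: eq_perm_map => i /=; rewrite !permE ffunE.
Qed.

End Polygons.

(** * The polygon part *)

Section Projection.
Variables (F : fieldType) (V : lmodType F) (k : nat).
Local Notation I := 'I_k.+1.
Local Notation gr := (graph V k.+1).

(** The weight is 1 or -1 as [e] runs from [a] to [b] or backwards. For a loop the two terms cancel,
    in agreement with a loop reversal being an isomorphism of sign -1. *)
Definition edge_weight (a b : I) (e : I * I) : F :=
  ((a == e.1) && (b == e.2))%:R - ((a == e.2) && (b == e.1))%:R.

Definition cycle_weight (es : seq (I * I)) (s : 'S_k.+1) : F :=
  \sum_(b : 'S_k.+1) \prod_i edge_weight (s i) (s (ordS i)) (nth (ord0, ord0) es (b i)).

Definition leaf_weight (ls : seq (I * V)) (s l : 'S_k.+1) : F :=
  \prod_i ((nth (ord0, 0) ls (l i)).1 == s i)%:R.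

Definition leaf_tensor (ls : seq (I * V)) (s : 'S_k.+1) : tensor_coinvariants V k :=
  \sum_(l : 'S_k.+1) leaf_weight ls s l *: tensor_class [ffun i => (nth (ord0, 0) ls (l i)).2].

(* Sum over all ways of matching the edges and the hairs of g with those of the
   standard polygon, so that it is invariant under relabelling by construction. *)
Definition polygon_part (g : gr) : tensor_coinvariants V k :=
  if (size (edges g) == k.+1) && (size (leaves g) == k.+1)
  then \sum_(s : 'S_k.+1) ((-1) ^+ s * cycle_weight (edges g) s) *: leaf_tensor (leaves g) s
  else 0.

Lemma perm_nth (T : eqType) (x0 : T) n (s t : seq T) : size s = n -> perm_eq s t ->
  exists p : 'S_n, forall i : 'I_n, nth x0 s i = nth x0 t (p i).
Proof.
move=> sz E; have szt : size t = n by rewrite -(perm_size E).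
have /tuple_permP[p pE] : perm_eq (Tuple (introT eqP sz)) (Tuple (introT eqP szt)) by [].
exists p => i; rewrite /= in pE; rewrite pE.
by rewrite (nth_map i) ?size_enum_ord // nth_ord_enum (tnth_nth x0).
Qed.

Lemma cycle_weight_perm es es' s : size es = k.+1 -> perm_eq es es' ->
  cycle_weight es s = cycle_weight es' s.
Proof.
move=> sz /(perm_nth (ord0, ord0) sz)[p pE].
rewrite [RHS](reindex_inj (mulIg p)); apply: eq_bigr => b _; apply: eq_bigr => i _.
by rewrite permM pE.
Qed.

Lemma leaf_tensor_perm ls ls' s : size ls = k.+1 -> perm_eq ls ls' ->
  leaf_tensor ls s = leaf_tensor ls' s.
Proof.
move=> sz /(perm_nth (ord0, 0) sz)[p pE].
rewrite [RHS](reindex_inj (mulIg p)); apply: eq_bigr => b _; congr (_ *: tensor_class _).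
  by apply: eq_bigr => i _; rewrite permM pE.
by apply/ffunP => i; rewrite !ffunE permM pE.
Qed.

Lemma edge_weight_reverse a b i j : edge_weight a b (j, i) = - edge_weight a b (i, j).
Proof. by rewrite /edge_weight opprB. Qed.

Lemma cycle_weight_reverse i j es s :
  cycle_weight ((j, i) :: es) s = - cycle_weight ((i, j) :: es) s.
Proof.
rewrite -sumrN; apply: eq_bigr => b _.
rewrite (bigD1 (b^-1%g ord0)) //= [in RHS](bigD1 (b^-1%g ord0)) //= permKV /=.
rewrite edge_weight_reverse mulNr; congr (- (_ * _)); apply: eq_bigr => l lb.
have : b l != ord0 by rewrite -(permKV b ord0) (inj_eq (@perm_inj _ b)).
by case: (b l) => -[].
Qed.

(** Permuting the lists reindexes the sums over matchings of edges and hairs; renumbering the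
    vertices reindexes the signed sum over [s]. *)
Lemma polygon_part_kills x :
  @graph_relation V F V id k.+1 x -> fglift polygon_part x = 0.
Proof.
apply: graph_fun_kills.
- move=> es es' ls ls' E L; rewrite /polygon_part /= (perm_size E) (perm_size L).
  case: ifP => // /andP[/eqP sE /eqP sL]; apply: eq_bigr => s _.
  by rewrite (cycle_weight_perm _ _ E) ?(leaf_tensor_perm _ _ L) ?(perm_size E) ?(perm_size L).
- move=> p [es ls]; rewrite /polygon_part /= !size_map; case: ifP; last by rewrite scaler0.
  move=> /andP[/eqP sE /eqP sL]; rewrite (reindex_inj (mulIg p)) scaler_sumr.
  apply: eq_bigr => s _; rewrite scalerA odd_permM signr_addb; congr (_ *: _).
    rewrite mulrA (mulrC ((-1) ^+ p)); congr (_ * _); apply: eq_bigr => b _.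
    apply: eq_bigr => i _; rewrite (nth_map (ord0, ord0)) ?sE // !permM.
    by rewrite /edge_weight /= !(inj_eq (@perm_inj _ p)).
  apply: eq_bigr => l _; congr (_ *: tensor_class _).
    apply: eq_bigr => i _; rewrite (nth_map (ord0, 0)) ?sL // !permM.
    by rewrite /= (inj_eq (@perm_inj _ p)).
  by apply/ffunP => i; rewrite !ffunE (nth_map (ord0, 0)) ?sL.
- move=> i j es ls; rewrite /polygon_part /=; case: ifP; last by rewrite oppr0.
  move=> _; rewrite -sumrN; apply: eq_bigr => s _.
  by rewrite cycle_weight_reverse mulrN scaleNr.
- move=> es i c u v ls; rewrite /polygon_part /=; case: ifP; last by rewrite scaler0 addr0.
  move=> _; rewrite scaler_sumr -big_split; apply: eq_bigr => s _ /=.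
  rewrite [c *: (_ *: _)]scalerA (mulrC c) -[(_ * c) *: _]scalerA -scalerDr; congr (_ *: _).
  rewrite scaler_sumr -big_split; apply: eq_bigr => l _ /=.
  have wE w : leaf_weight ((i, w) :: ls) s l = leaf_weight ((i, 0) :: ls) s l.
    by apply: eq_bigr => m _; case: (l m) => -[].
  pose a := [ffun m => (nth (ord0, 0) ((i, 0) :: ls) (l m)).2] : {ffun I -> V}.
  have tE w : [ffun m => (nth (ord0, 0) ((i, w) :: ls) (l m)).2] = subst_at a (l^-1%g ord0) w.
    apply/ffunP => m; rewrite !ffunE; case: eqP => [->|lm]; first by rewrite permKV.
    have : l m != ord0 by apply/eqP => lm0; apply: lm; rewrite -lm0 permK.
    by case: (l m) => -[].
  rewrite !wE !tE tensor_class_multilinear scalerDr !scalerA.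
  by rewrite (mulrC c).
Qed.

Definition proj (x : graph_space V k.+1) : tensor_coinvariants V k :=
  presented_map polygon_part_kills x.

Arguments proj : simpl never.

HB.instance Definition _ := GRing.isLinear.Build F (graph_space V k.+1)
  (tensor_coinvariants V k) _ proj (linearP (presented_map polygon_part_kills)).

Lemma projE g : proj (graph_class g) = polygon_part g.
Proof. exact: presented_mapE. Qed.

Lemma count_nth (T : Type) (x0 : T) (a : pred T) n (s : seq T) : size s = n ->
  count a s = (\sum_(i < n) a (nth x0 s i))%N.
Proof.
move=> <-; rewrite -sum1_count big_mkcond (big_nth x0) big_mkord.
by apply: eq_bigr => i _; case: (a _).
Qed.

Lemma edge_weight_degree a b e v : edge_weight a b e != 0 ->
  edge_degree setT v e = ((a == v) + (b == v))%N.
Proof.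
rewrite /edge_weight /edge_degree !inE !andbT; case: e => c d /=.
case: (boolP ((a == c) && _)) => [/andP[/eqP-> /eqP->] _|_] //.
by case: (boolP ((a == d) && _)) => [/andP[/eqP-> /eqP->]|_]; rewrite ?subrr ?eqxx // addnC.
Qed.

(** A nonzero term matches the edges with a closed cycle through all vertices and the hairs one to
    one with the vertices. Then all degrees are at least two, so the core is everything, and no
    vertex has two hairs. *)
Lemma polygon_part_bulky g : bulky g -> polygon_part g = 0.
Proof.
case: g => es ls bg; rewrite /polygon_part; case: ifP => //= /andP[/eqP sE /eqP sL].
apply: big1 => s _; apply/eqP; rewrite scaler_eq0 mulf_eq0 signr_eq0 /=.
apply: contraLR bg; rewrite negb_or => /andP[c0 l0]; rewrite /bulky negb_or negbK /=.
apply/andP; split.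
  have [b b0] : exists b : 'S_k.+1, \prod_i edge_weight (s i) (s (ordS i)) (nth (ord0, ord0) es (b i)) != 0.
    by apply/existsP; apply: contraR c0; rewrite negb_exists => /forallP b0;
      apply/eqP/big1 => b _; apply/eqP; rewrite -[_ == 0]negbK; apply: b0.
  rewrite eqEsubset subsetT /=; apply: core_max; apply/core_setP => v _.
  have -> : degree_in es setT v = (\sum_(i < k.+1) edge_degree setT v (nth (ord0, ord0) es i))%N.
    by rewrite /degree_in (big_nth (ord0, ord0)) sE big_mkord.
  rewrite (reindex_inj (@perm_inj _ b)) /=.
  rewrite (eq_bigr (fun i => (s i == v) + (s (ordS i) == v)))%N => [|i _]; last first.
    apply: edge_weight_degree; apply: contraNneq b0 => w0.
    by rewrite (bigD1 i) //= w0 mul0r.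
  rewrite big_split /= (bigD1 (s^-1%g v)) //= permKV eqxx.
  rewrite [X in (_ + X)%N](bigD1 (ord_pred (s^-1%g v))) //= ord_predK permKV eqxx.
  by rewrite addnACA.
apply/existsPn => v; rewrite -leqNgt.
have [l l1] : exists l : 'S_k.+1, leaf_weight ls s l != 0.
  apply/existsP; apply: contraR l0; rewrite negb_exists => /forallP h.
  by apply/eqP/big1 => l _; have := h l; rewrite negbK => /eqP ->; rewrite scale0r.
rewrite (count_nth (ord0, 0) _ sL) (reindex_inj (@perm_inj _ l)) /=.
rewrite (eq_bigr (fun i => (s i == v) : nat)) => [|i _]; last first.
  suff /eqP -> : (nth (ord0, 0) ls (l i)).1 == s i by [].
  by apply: contraNT l1 => w0; rewrite /leaf_weight (bigD1 i) //= (negPf w0) mul0r.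
rewrite (bigD1 (s^-1%g v)) //= permKV eqxx big1 // => i iv.
by rewrite -(permKV s v) (inj_eq (@perm_inj _ s)) (negPf iv).
Qed.

End Projection.

(** * The polygon part of a polygon *)

Section ProjectionPolygon.
Variables (F : fieldType) (V : lmodType F) (k : nat).
Local Notation I := 'I_k.+1.
Implicit Types (v : {ffun I -> V}) (s : 'S_k.+1).

Definition relabel v s : {ffun I -> V} := [ffun i => v (s i)].

Lemma ordS_neq (i : I) : (0 < k)%N -> ordS i != i.
Proof.
move=> k0; rewrite -val_eqE /=; have := ltn_ord i; rewrite ltnS leq_eqVlt => /orP[/eqP->|ik].
  by rewrite modnn eq_sym -lt0n.
by rewrite modn_small // gtn_eqF.
Qed.

Lemma ordS2_neq (i : I) : (1 < k)%N -> ordS (ordS i) != i.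
Proof.
move=> k1; rewrite -val_eqE /=; have := ltn_ord i; rewrite ltnS leq_eqVlt => /orP[/eqP->|ik].
  by rewrite modnn modn_small; lia.
rewrite [(i.+1 %% _)%N]modn_small //; have := ik; rewrite leq_eqVlt => /orP[/eqP ik1|ik'].
  by rewrite ik1 modnn; lia.
by rewrite modn_small; lia.
Qed.

Lemma iter_ordS (i : I) : i = iter i (@ordS k.+1) ord0.
Proof.
case: i => m mk; elim: m mk => [|m IH] mk /=; first exact: val_inj.
have := IH (ltnW mk) => /= <-; apply: val_inj => /=.
by rewrite modn_small.
Qed.

Lemma relabel_rot v m :
  (-1) ^+ (rot_perm k ^+ m)%g *: tensor_class (relabel v (rot_perm k ^+ m)%g) = tensor_class v.
Proof.
elim: m => [|m IH].
  rewrite expg0 odd_perm1 scale1r; congr tensor_class.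
  by apply/ffunP => i; rewrite ffunE perm1.
rewrite expgS; have -> : relabel v (rot_perm k * rot_perm k ^+ m)%g =
    rotate (relabel v (rot_perm k ^+ m)%g).
  by apply/ffunP => i; rewrite !ffunE permM permE.
rewrite tensor_class_rotate odd_permM signr_addb odd_rot_perm signr_odd scalerA.
by rewrite mulrAC -expr2 sqrr_sign mul1r.
Qed.

(** A permutation commuting with the successor is determined by its value at 0, hence a power of the
    rotation. *)
Lemma relabel_commute v s : (forall i, s (ordS i) = ordS (s i)) ->
  (-1) ^+ s *: tensor_class (relabel v s) = tensor_class v.
Proof.
move=> sS; suff -> : s = (rot_perm k ^+ (s ord0 : nat))%g by apply: relabel_rot.
have sit m : s (iter m (@ordS k.+1) ord0) = iter m (@ordS k.+1) (s ord0).
  by elim: m => //= m IH; rewrite sS IH.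
apply/permP => i; rewrite permX (eq_iter (f' := @ordS k.+1)) => [|j]; last by rewrite permE.
by rewrite [in LHS](iter_ordS i) sit [in LHS](iter_ordS (s ord0)) -iterD addnC iterD -iter_ordS.
Qed.

(** Composing with the reversal turns an orientation-reversing symmetry into a rotation; the sign of
    y accounts for the k + 1 reversed edges. *)
Lemma relabel_anti v s : (forall i, s i = ordS (s (ordS i))) ->
  ((-1) ^+ s * (-1) ^+ k.+1) *: tensor_class (relabel v s) = tensor_class v.
Proof.
move=> sS; pose t := (rev_perm k.+1 * s)%g.
have tS i : t (ordS i) = ordS (t i).
  by rewrite /t !permM !permE sS rev_ordS.
have sE : s = (rev_perm k.+1 * t)%g.
  by apply/permP => i; rewrite permM /t permM !permE rev_ordK.
have -> : relabel v s = reverse (relabel v t).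
  by apply/ffunP => i; rewrite !ffunE /t permM permE rev_ordK.
rewrite tensor_class_reverse -[RHS](relabel_commute v tS) scalerA; congr (_ *: _).
rewrite sE odd_permM signr_addb odd_rev_perm signr_odd exprD.
set a := (-1) ^+ 'C(_, _); set b := (-1) ^+ t; set c := (-1) ^+ k.+1.
have -> : a * b * c * (c * a) = b * (a * a) * (c * c) by ring.
by rewrite -!expr2 !sqrr_sign !mulr1.
Qed.

Lemma edge_weight_cases a b (c : I) : (0 < k)%N ->
  let w := edge_weight F a b (c, ordS c) in w != 0 ->
  [/\ a = c, b = ordS c & w = 1] \/ [/\ a = ordS c, b = c & w = -1].
Proof.
move=> k0; rewrite /edge_weight /=; have cS := ordS_neq c k0.
case: (boolP ((a == c) && _)) => [/andP[/eqP -> /eqP ->]|_] /=.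
  rewrite [c == _]eq_sym (negPf cS) /= mulr1n mulr0n subr0 => _.
  by left.
case: (boolP ((a == ordS c) && _)) => [/andP[/eqP -> /eqP ->]|_] /=.
  by rewrite mulr0n sub0r mulr1n; right.
by rewrite mulr0n subr0 eqxx.
Qed.

(** A nonzero matching is a symmetry of the polygon. With at least three vertices the direction
    cannot change from one edge to the next, since [s] is injective, so all edges are kept or all
    are reversed, and the weight records which. *)
Lemma polygon_matching s (b : 'S_k.+1) : (0 < k)%N ->
  let w := \prod_i edge_weight F (s i) (s (ordS i)) (b i, ordS (b i)) in w != 0 ->
  ((forall i, s (ordS i) = ordS (s i)) /\ w = 1) \/
  ((forall i, s i = ordS (s (ordS i))) /\ w = (-1) ^+ k.+1).
Proof.
move=> k0 w w0; have wi i : edge_weight F (s i) (s (ordS i)) (b i, ordS (b i)) != 0.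
  by apply: contraNneq w0 => wi0; rewrite /w (bigD1 i) //= wi0 mul0r.
have cases i := edge_weight_cases k0 (wi i).
have [k1|k1] := ltnP 1 k.
  have dir i : s (ordS i) = ordS (s i) \/ s i = ordS (s (ordS i)).
    by case: (cases i) => -[-> -> _]; [left | right].
  have keep i : s (ordS i) = ordS (s i) -> s (ordS (ordS i)) = ordS (s (ordS i)).
    move=> si; case: (dir (ordS i)) => // sii.
    have := ordS2_neq i k1; rewrite -(inj_eq (@perm_inj _ s)).
    by case/eqP; apply: (@ordS_inj k.+1); rewrite -sii.
  (* A property inherited by successors spreads over the whole cycle, as k + 1 steps return to the
     start. *)
  have ordS_all (Q : I -> Prop) : (forall i, Q i -> Q (ordS i)) -> forall i, Q i -> forall j, Q j.
    move=> QS i Qi j; have it m : Q (iter m (@ordS k.+1) i) by elim: m => //= m; apply: QS.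
    have := it (k.+1 - i + j)%N; rewrite {2}(iter_ordS i) -iterD.
    have -> : (k.+1 - i + j + i = k.+1 + j)%N by have := ltn_ord i; lia.
    rewrite addnC iterD; have -> : iter k.+1 (@ordS k.+1) ord0 = ord0.
      by rewrite iterS -(iter_ordS (ord_max : 'I_k.+1)); apply: val_inj; rewrite /= modnn.
    by rewrite -iter_ordS.
  have [all|/forallPn[i ni]] := altP (@forallP _ (fun i => s (ordS i) == ordS (s i))).
    left; split=> [i|]; first exact/eqP.
    apply: big1 => i _; case: (cases i) => -[h1 h2 h3] //.
    have := ordS2_neq (b i) k1; rewrite -h1 -h2; have /eqP -> := all i.
    by rewrite h1 -h2 (eqP (all i)) eqxx.
  have all i' : s i' = ordS (s (ordS i')).
    case: (dir i') => // /(ordS_all (fun i => s (ordS i) = ordS (s i)) keep) /(_ i) h.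
    by rewrite h eqxx in ni.
  right; split=> //; rewrite -[k.+1 in RHS]card_ord -prodr_const /w.
  apply: eq_bigr => j _; case: (cases j) => -[h1 h2 h3] //.
  have := ordS2_neq (b j) k1; rewrite -h2 -h1.
  by rewrite -all eqxx.
(* In a digon direction is ambiguous: every permutation commutes with the successor, and the two
   edges have equal weights, whose product is 1. *)
have k1' : k = 1%N by apply/eqP; rewrite eqn_leq k1.
have other (x y : I) : x != y -> x = ordS y.
  have mod2 m p q : m = 2 -> (p < m)%N -> (q < m)%N -> p != q -> p = (q.+1 %% m)%N.
    by move=> ->; case: p q => [|[|p]] [|[|q]].
  by move=> xy; apply/val_inj; exact: (mod2 _ _ _ (congr1 S k1') (ltn_ord x) (ltn_ord y) xy).
have otherC (x : I) : ordS (ordS x) = x.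
  by symmetry; apply: other; rewrite eq_sym ordS_neq.
have comm (p : 'S_k.+1) i : p (ordS i) = ordS (p i).
  by apply: other; rewrite (inj_eq (@perm_inj _ p)) ordS_neq.
left; split; first exact: comm.
have := wi ord0; rewrite /w (bigD1 ord0) //= (bigD1 (ordS ord0)) ?ordS_neq //= big1; last first.
  by move=> i /andP[i0 /eqP i1]; case: i1; apply: other.
rewrite mulr1 !comm otherC.
have -> : edge_weight F (ordS (s ord0)) (s ord0) (ordS (b ord0), ordS (ordS (b ord0))) =
    edge_weight F (s ord0) (ordS (s ord0)) (b ord0, ordS (b ord0)).
  by rewrite otherC /edge_weight /= andbC [in X in _ - X]andbC.
by case/(edge_weight_cases k0) => -[_ _ ->]; rewrite ?mulr1 ?mulrNN ?mulr1.
Qed.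

Lemma leaf_tensor_polygon v s :
  leaf_tensor [seq (i, v i) | i <- enum I] s = tensor_class (relabel v s).
Proof.
have nthE (i : I) : nth (ord0, 0) [seq (i, v i) | i <- enum I] i = (i, v i).
  by rewrite (nth_map ord0) ?size_enum_ord ?nth_ord_enum.
rewrite /leaf_tensor (bigD1 s) //= big1 ?addr0 => [|l ls]; last first.
  have [i li] : exists i, l i != s i.
    by apply/existsP; apply: contraR ls; rewrite negb_exists => /forallP h;
      apply/eqP/permP => i; apply/eqP; rewrite -[_ == _]negbK; apply: h.
  by rewrite /leaf_weight (bigD1 i) //= nthE /= (negPf li) mul0r scale0r.
rewrite /leaf_weight big1 ?scale1r => [|i _]; last by rewrite nthE eqxx.
by congr tensor_class; apply/ffunP => i; rewrite !ffunE nthE.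
Qed.

Hypothesis char0 : [pchar F] =i pred0.

(** For k = 0 the reflection y acts on V as -1. *)
Lemma tensor_class_k0 v : k = 0%N -> tensor_class v = 0.
Proof.
move=> k0; apply: (opp_eq0 char0); have := tensor_class_reverse v.
have -> : reverse v = v.
  apply/ffunP => i; rewrite ffunE; congr (v _); apply/val_inj => /=.
  by have := ltn_ord i; move: (nat_of_ord i) => m; rewrite k0; case: m.
have -> : (k.+1 + 'C(k.+1, 2))%N = 1%N by rewrite k0.
by rewrite expr1 scaleN1r.
Qed.

(** By [relabel_commute] and [relabel_anti] every nonzero term equals the class of [v], so c is the
    number of such terms, positive because of the identity. For k = 0 all loop weights vanish, but
    so do the coinvariants, and c = 1 will do. *)
Lemma proj_polygon : exists2 c : F, c != 0 &
  forall v, proj (graph_class (polygon v)) = c *: tensor_class v.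
Proof.
case: (posnP k) => [k0|k0].
  by exists 1; rewrite ?oner_eq0 // => v; rewrite projE scale1r -[LHS]scale1r;
    rewrite (tensor_class_k0 v k0); apply: (presented_ext (f := idfun) (g := \0)) => u;
    apply: tensor_class_k0.
pose w s (b : 'S_k.+1) := \prod_i edge_weight F (s i) (s (ordS i)) (b i, ordS (b i)).
exists (\sum_(s : 'S_k.+1) \sum_(b : 'S_k.+1) (w s b != 0)%:R).
  have w1 : w 1%g 1%g = 1; last first.
    under eq_bigr do rewrite -natr_sum.
    rewrite -natr_sum; apply: natr_neq0 => //.
    by rewrite (bigD1 (1%g : 'S_k.+1)) //= (bigD1 (1%g : 'S_k.+1)) //= w1 oner_neq0.
  apply: big1 => i _; rewrite !perm1 /edge_weight /= !eqxx /= mulr1n.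
  by rewrite [i == _]eq_sym (negPf (ordS_neq i k0)) /= mulr0n subr0.
have szE (X : Type) (f : I -> X) : size [seq f i | i <- enum I] = k.+1.
  by rewrite size_map size_enum_ord.
move=> v; rewrite projE /polygon_part /= /function_edges !szE eqxx /=.
rewrite scaler_suml; apply: eq_bigr => s _; rewrite leaf_tensor_polygon.
rewrite /cycle_weight mulr_sumr !scaler_suml; apply: eq_bigr => b _.
have -> : \prod_i edge_weight F (s i) (s (ordS i))
    (nth (ord0, ord0) [seq (j, ordS j) | j <- enum I] (b i)) = w s b.
  by apply: eq_bigr => i _; rewrite (nth_map ord0) ?size_enum_ord ?nth_ord_enum.
case: (eqVneq (w s b) 0) => [->|]; first by rewrite mulr0 scale0r scale0r.
rewrite scale1r => w0; case: (polygon_matching k0 w0) => -[sS] /=.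
  by rewrite -/(w s b) => ->; rewrite mulr1; apply: relabel_commute.
by rewrite -/(w s b) => ->; apply: relabel_anti.
Qed.

End ProjectionPolygon.

(** * Homology in rank one *)

Section HairyHomology.
Variables (F : fieldType) (V : lmodType F).
Hypothesis char0 : [pchar F] =i pred0.
Local Notation gr n := (graph V n).
Local Notation rel n := (linspan (@graph_relation V F V id n)).
Local Notation hairy_chains n :=
  (@chains F (hairy_complex V) (fun _ g => [&& admissible g, connected g & has_rank 1 g]) n).

Lemma sum_count_fst (T : finType) (X : Type) (ls : seq (T * X)) :
  (\sum_v count (fun l => l.1 == v) ls)%N = size ls.
Proof.
elim: ls => [|l ls IH] /=; first by rewrite big1.
by rewrite big_split /= IH (bigD1 l.1) //= eqxx big1 // => v /negPf; rewrite eq_sym => ->.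
Qed.

(** The valences sum to at least 3 per vertex, and the edges, as many as vertices, account for 2 per
    vertex. *)
Lemma unicyclic_leaves n (g : gr n.+1) : unicyclic g -> (n < size (leaves g))%N.
Proof.
case/and3P=> /forallP adm _ rk.
have sz : size (edges g) = n.+1 by move: rk; rewrite /has_rank addn1 eqSS => /eqP.
have : (\sum_(v < n.+1) 3 <= \sum_v valence g v)%N by apply: leq_sum => v _; apply: adm.
under [X in (_ <= X)%N]eq_bigr do rewrite valenceE.
rewrite big_split /= sum_degree sum_count_fst sz sum_nat_const card_ord => h.
by rewrite -(leq_add2l n.+1.*2); apply: leq_trans h; rewrite -muln2 -{2}[n.+1]muln1 -mulnDr.
Qed.

Lemma bulky_leaves n (g : gr n) : (n < size (leaves g))%N -> bulky g.
Proof.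
move=> gt; rewrite /bulky; apply/orP; right; apply: contraLR gt.
rewrite negb_exists -leqNgt => /forallP le1; rewrite -sum_count_fst.
apply: (@leq_trans (\sum_(v < n) 1)%N); last by rewrite sum_nat_const card_ord muln1.
by apply: leq_sum => v _; rewrite leqNgt; apply: le1.
Qed.

Lemma class_span_lift n (A : pred (gr n)) (x : graph_space V n) : class_span A x ->
  exists2 y, linspan (fun y : free_module F (gr n) => exists2 g, A g & y = << g >>) y
    & quotient_class (rel n) y = x.
Proof.
elim=> [|a _ y [g Ag ->] _ [z Sz zE]].
  by exists 0; [apply: subspace0 | apply: linear0].
exists (a *: << g >> + z); last by rewrite linearP /= zE.
by apply: (subspaceP (linspan _)).2 => //; apply: span_gen; exists g.
Qed.

Lemma class_span_chains n (x : free_module F (gr n)) : hairy_chains n x ->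
  class_span (@unicyclic F V n) (quotient_class (rel n) x).
Proof.
apply: (span_image (f := quotient_class (rel n))) => _ [g gA ->].
exact: class_span_gen.
Qed.

Lemma dQ_quotient_class n (x : free_module F (gr n.+1)) :
  dQ (quotient_class (rel n.+1) x) = quotient_class (rel n) (fglift (@graph_boundary V F n) x).
Proof.
apply: (linear_free_ext (f := @dQ F V n \o quotient_class (rel n.+1))
  (g := quotient_class (rel n) \o fglift (@graph_boundary V F n))) => g /=.
by rewrite fglift1; apply: dQ_class.
Qed.

(** Such a graph has a single loop, whose reversal leaves the graph as it is and changes the
    sign. *)
Lemma unicyclic1_class (g : gr 1) : unicyclic g -> graph_class g = 0.
Proof.
case: g => es ls /and3P[_ _]; rewrite /has_rank /=; case: es => [|[i j] []] // _.
apply: (opp_eq0 char0); rewrite -graph_class_reverse.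
by rewrite (ord1 i) (ord1 j).
Qed.

Lemma class_span1 (x : graph_space V 1) : class_span (@unicyclic F V 1) x -> x = 0.
Proof.
apply: (span_kills (f := idfun)) => _ [g ug ->]; exact: unicyclic1_class.
Qed.

Section Degree.
Variable k : nat.

Lemma proj_bulky (x : graph_space V k.+1) : class_span (@ubulky F V _) x -> proj x = 0.
Proof.
apply: (span_kills (f := @proj F V k)) => _ [g /andP[_ bg] ->]; rewrite /= projE; exact: polygon_part_bulky.
Qed.

Lemma proj_polygon_map : exists2 c : F, c != 0 &
  forall w : tensor_coinvariants V k, proj (polygon_map w) = c *: w.
Proof.
have [c c0 cE] := proj_polygon V k char0; exists c => // w.
apply: (presented_ext (f := @proj F V k \o @polygon_map F V k) (g := c \*: idfun)) => v /=.
rewrite -/(tensor_class v) polygon_mapE; exact: cE.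
Qed.

Lemma unicyclic_decomposition (x : graph_space V k.+1) : class_span (@unicyclic F V _) x ->
  exists w : tensor_coinvariants V k, class_span (@ubulky F V _) (x - polygon_map w).
Proof.
elim=> [|a _ y [g ug ->] _ [w Sw]].
  by exists 0; rewrite linear0 subrr; apply: (@subspace0 _ _ (class_span _)).
have [u Su] : exists u, class_span (@ubulky F V _) (graph_class g - polygon_map u).
  case: (boolP (bulky g)) => bg.
    by exists 0; rewrite linear0 subr0; apply: class_span_gen; apply/andP.
  have [v [b ->]] := nonbulky_polygon ug bg.
  exists ((-1) ^+ b *: tensor_class v); rewrite linearZ /= polygon_mapE subrr.
  exact: (@subspace0 _ _ (class_span _)).
exists (a *: u + w); rewrite linearP opprD addrACA -scalerBr.
exact: (subspaceP (class_span _)).2.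
Qed.

Lemma polygon_map_unicyclic (w : tensor_coinvariants V k) : class_span (@unicyclic F V _) (polygon_map w).
Proof.
elim/quotientW: w => z; rewrite -/(quotient_class _ z).
elim/free_ind: z => [v||a x y Sx Sy].
- rewrite -/(tensor_class v) polygon_mapE; apply: class_span_gen; exact: polygon_unicyclic.
- by rewrite !linear0; apply: (@subspace0 _ _ (class_span _)).
- by rewrite !linearP; apply: (subspaceP (class_span _)).2.
Qed.

(** Modulo bulky graphs the cycle is the image of some w, and the vanishing of its polygon part
    gives c w = 0; so the cycle is bulky. On one vertex all classes vanish and 0 bounds. *)
Lemma cycle_bounds (x : graph_space V k.+1) : class_span (@unicyclic F V _) x ->
  dQ x = 0 -> proj x = 0 ->
  exists2 y : graph_space V k.+2, class_span (@unicyclic F V _) y & dQ y = x.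
Proof.
move=> Sx dx px; have [w Sw] := unicyclic_decomposition Sx.
have [c c0 cE] := proj_polygon_map.
have w0 : w = 0.
  have /eqP := proj_bulky Sw; rewrite linearB /= px cE sub0r oppr_eq0 scaler_eq0 (negPf c0).
  by move/eqP.
rewrite w0 linear0 subr0 in Sw; move: x Sx dx Sw {px w w0 c c0 cE}; case: k => [|n] x Sx dx Sw.
  by exists 0; [apply: (@subspace0 _ _ (class_span _)) | rewrite linear0 (class_span1 Sx)].
have [y Sy yE] := bulky_cycle_bounds char0 Sw dx; exists y => //.
by apply: class_spanS Sy => g /andP[].
Qed.

(** A contraction keeps the n + 2 hairs but has only n + 1 vertices, so some vertex carries two
    hairs. *)
Lemma boundary_polygon n (v : {ffun 'I_n.+2 -> V}) :
  class_span (@ubulky F V _) (dQ (graph_class (polygon v))).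
Proof.
rewrite dQE; apply: subspace_sum_in => e ees ne; rewrite /contraction.
apply: (@subspaceZ _ _ (class_span _)); apply: class_span_gen.
apply/andP; split.
  have E := perm_to_rem ees; apply: unicyclic_contract => //.
  rewrite -surjective_pairing -(unicyclic_perm _ E) -surjective_pairing.
  exact: polygon_unicyclic.
by apply: bulky_leaves; rewrite /= size_map size_map size_enum_ord.
Qed.

Lemma boundary_polygon_map (w : tensor_coinvariants V k) :
  exists2 y, class_span (@ubulky F V _) y & dQ y = dQ (polygon_map w).
Proof.
move: w; case: k => [|n] w.
  by exists 0; [apply: (@subspace0 _ _ (class_span _)) | rewrite !dQ0].
have Sw : class_span (@ubulky F V _) (dQ (polygon_map w)).
  elim/quotientW: w => z; rewrite -/(quotient_class _ z).
  elim/free_ind: z => [v||a x y Sx Sy].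
  - rewrite -/(tensor_class v) polygon_mapE; exact: boundary_polygon.
  - by rewrite !linear0; apply: (@subspace0 _ _ (class_span _)).
  - by rewrite !linearP; apply: (subspaceP (class_span _)).2.
move: w Sw; case: n => [|n] w Sw.
  exists 0; first exact: (@subspace0 _ _ (class_span _)).
  by rewrite linear0 [RHS]class_span1 //; apply: class_spanS Sw => g /andP[].
by apply: (bulky_cycle_bounds char0 Sw); apply: dQ_dQ.
Qed.

Lemma polygon_part_boundary (g : gr k.+2) : unicyclic g ->
  fglift (@polygon_part F V k) (graph_boundary F g) = 0.
Proof.
move=> /unicyclic_leaves gl; rewrite linear_sum big1 //= => e _.
rewrite linearZ /= fglift1 /polygon_part /= !size_map.
by rewrite (gtn_eqF gl) andbF scaler0.
Qed.

Lemma hairy_homology_rank1 :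
  linearly_isomorphic (hairy_homology V k.+1 1) (tensor_coinvariants V k).
Proof.
exists (homology_map (C := hairy_complex V)
  (A := fun _ g => [&& admissible g, connected g & has_rank 1 g]) (k := k.+1)
  (@polygon_part_kills F V k) polygon_part_boundary).
apply: homology_map_bij => [x [Ax Rx] fx|w].
  have Sx := class_span_chains Ax.
  have dx : dQ (quotient_class (rel k.+1) x) = 0.
    by rewrite dQ_quotient_class; apply/quotient_class_eq0.
  have px : proj (quotient_class (rel k.+1) x) = 0.
    by rewrite [LHS]presented_map_class.
  have [y /class_span_lift[z Sz zE] yE] := cycle_bounds Sx dx px.
  exists z; first exact: Sz.
  by apply/quotient_class_eq; rewrite -[RHS]dQ_quotient_class zE yE.
have [c c0 cE] := proj_polygon_map.
(* The factor [c^-1] normalizes the polygon part. Subtracting [y] makes the polygon combination a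
   cycle and does not change its polygon part, because [y] is bulky. *)
have [y Sy yE] := boundary_polygon_map (c^-1 *: w).
have SX : class_span (@unicyclic F V _) (polygon_map (c^-1 *: w) - y).
  apply: (@subspaceB _ _ (class_span _)); first exact: polygon_map_unicyclic.
  by apply: class_spanS Sy => g /andP[].
have [x Sx xE] := class_span_lift SX.
exists x; first split; first exact: Sx.
  apply/quotient_class_eq0; rewrite -[LHS]dQ_quotient_class xE linearB /= yE.
  exact: subrr.
have := presented_map_class (@polygon_part_kills F V k) x; rewrite -[X in X = _]/(proj _) xE.
rewrite linearB /= cE proj_bulky // subr0 scalerA mulfV // scale1r.
by move=> ->.
Qed.

End Degree.
End HairyHomology.

Theorem mainTheorem5 (F : fieldType) (V : vectType F)
    (symp : {skew_symmetric V})
    (charF0 : [pchar F] =i pred0)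
    (sympP : is_psymplectic symp) :
  involutive_algebra_isomorphic (I_algebra V) (trivial_algebra V) /\
  (forall k : nat,
     linearly_isomorphic (hairy_homology V k.+1 1)
                         (skew_dihedral_homology (I_algebra V) k) /\
     linearly_isomorphic (skew_dihedral_homology (I_algebra V) k)
                         (tensor_coinvariants V k)).
Proof.
split=> [|k]; first exact: I_algebra_trivial.
have dihedral := I_algebra_dihedral V k; split=> //.
apply: linearly_isomorphic_trans (linearly_isomorphic_sym dihedral).
exact: hairy_homology_rank1.
Qed.
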